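(* Let $\epsilon>0$, let $q_0:[0,\infty)\to\mathbb{R}$ be such that $\phi_0(x)=\int_0^{|x|}q_0(s)\,ds$ belongs to $W^{1,\infty}(\mathbb{R}^n)$ and $\int_0^\infty q_0(s)\,ds<\infty$, and let $\rho_0\in L^\infty(\mathbb{R}^n)$ with $\int_{\mathbb{R}^n}\rho_0(x)\,dx<\infty$ (i.e. $\rho_0$ is integrable). Let $(u,\rho)$ be the solution of $$u_t+(u\cdot\nabla)u=\frac{\epsilon}{2}\Delta u,\qquad \rho_t+\nabla\cdot(\rho u)=0,\qquad x\in\mathbb{R}^n,\ t>0,$$ with initial conditions $u(x,0)=\frac{x}{|x|}q_0(|x|)=\nabla_x\phi_0(x)$ and $\rho(x,0)=\rho_0(x)$. Then $u(x,t)\to0$ as $t\to\infty$, uniformly for $x$ in compact subsets of $\mathbb{R}^n$, and the mass is conserved: $\int_{\mathbb{R}^n}\rho(x,t)\,dx=\int_{\mathbb{R}^n}\rho_0(x)\,dx$ for all $t>0$.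
   Context: ''The solution'' means the explicit one obtained from the Hopf–Cole transformation and the method of characteristics: $$u(x,t)=\frac{\int_{\mathbb{R}^n}\frac{x-y}{t}\,e^{-\frac1\epsilon\left[\frac{|x-y|^2}{2t}+\phi_0(y)\right]}dy}{\int_{\mathbb{R}^n}e^{-\frac1\epsilon\left[\frac{|x-y|^2}{2t}+\phi_0(y)\right]}dy},\qquad \rho(x,t)=\rho_0(X(x,t,0))\,J(x,t,0),$$ where $X(x,t,s)$ solves $\frac{dX(s)}{ds}=u(X(s),s)$, $X(s=t)=x$, and $J(x,t,0)$ is the Jacobian determinant of $x\mapsto X(x,t,0)$. *)

(* Defs.v *)
From HB Require Import structures.
From mathcomp Require Import all_boot all_order all_algebra.
From mathcomp Require Import all_classical all_reals all_analysis.

Set Implicit Arguments.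
Unset Strict Implicit.
Unset Printing Implicit Defensive.
Import Order.TTheory GRing.Theory Num.Theory.
Import numFieldNormedType.Exports.

Local Open Scope classical_set_scope.
Local Open Scope ring_scope.

(* R^n is 'rV[R]_n. The library has no measurable structure on row vectors:
   we take the sigma-algebra generated by the coordinates, i.e. the Borel
   sigma-algebra when T is the real line. *)
Definition measure_rV_display : measure_display -> measure_display.
Proof. exact. Qed.

Section measurable_rV.
Context {d} {T : sigmaRingType d} (n : nat).

Let coors : 'I_n -> 'rV[T]_n -> T := fun i x => x ord0 i.

Let rV_set0 : g_sigma_preimage coors set0.
Proof. exact: sigma_algebra0. Qed.

Let rV_setC A : g_sigma_preimage coors A -> g_sigma_preimage coors (~` A).
Proof. exact: sigma_algebraC. Qed.

Let rV_bigcup (F : _^nat) : (forall i, g_sigma_preimage coors (F i)) ->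
  g_sigma_preimage coors (\bigcup_i (F i)).
Proof. exact: sigma_algebra_bigcup. Qed.

HB.instance Definition _ := @isMeasurable.Build (measure_rV_display d)
  'rV[T]_n (g_sigma_preimage coors) rV_set0 rV_setC rV_bigcup.

End measurable_rV.

Lemma measurable_coor d (T : sigmaRingType d) n (i : 'I_n) :
  measurable_fun [set: 'rV[T]_n] (fun x : 'rV[T]_n => x ord0 i).
Proof.
move=> _ Y mY; rewrite setTI; apply: sub_sigma_algebra => /=.
rewrite -bigcup_seq/=; exists i => /=; first by rewrite mem_index_enum.
by exists Y => //; rewrite setTI.
Qed.

Lemma measurable_fun_rVP d1 d2 (T1 : measurableType d1)
    (T2 : measurableType d2) n (f : T1 -> 'rV[T2]_n) :
  measurable_fun [set: T1] f <->
  forall i, measurable_fun [set: T1] (fun x => f x ord0 i).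
Proof.
split=> [mf i|mf].
  exact: (measurableT_comp (measurable_coor (T := T2) i) mf).
apply: (@measurability _ _ _ _ _ _
  (\big[setU/set0]_(i < n)
     preimage_set_system setT (fun x : 'rV[T2]_n => x ord0 i) measurable)) => //.
move=> _ [B + <-].
rewrite -bigcup_seq/= => -[i _ [A mA <-]].
rewrite !setTI -[X in measurable X]setTI.
exact: mf.
Qed.

Section lebesgue_rV.
Context {R : realType}.

Definition rVcons n (p : R * 'rV[R]_n) : 'rV[R]_n.+1 :=
  row_mx (p.1)%:M p.2.

Definition rVuncons n (x : 'rV[R]_n.+1) : R * 'rV[R]_n :=
  (x ord0 ord0, rsubmx (x : 'rV[R]_(1 + n))).

Lemma rVconsK n : cancel (@rVcons n) (@rVuncons n).
Proof.
move=> [a v]; rewrite /rVuncons /rVcons/= row_mxKr; congr (_, _).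
have -> : ord0 = lshift n (ord0 : 'I_1) :> 'I_(1 + n) by exact/val_inj.
by rewrite (row_mxEl (a%:M : 'M[R]_1)) mxE eqxx.
Qed.

Lemma measurable_rVcons n : measurable_fun [set: _] (@rVcons n).
Proof.
apply/measurable_fun_rVP => i; rewrite /rVcons.
case: (splitP (i : 'I_(1 + n))) => [j ij|k ik].
  have -> : (fun x : R * 'rV[R]_n => row_mx (x.1)%:M x.2 ord0 i) = fst.
    apply/funext => x; rewrite (_ : i = lshift n j); last exact/val_inj.
    by rewrite row_mxEl mxE !ord1 eqxx.
  exact: measurable_fst.
have -> : (fun x : R * 'rV[R]_n => row_mx (x.1)%:M x.2 ord0 i) =
    (fun v : 'rV[R]_n => v ord0 k) \o snd.
  apply/funext => x; rewrite (_ : i = rshift 1 k); last exact/val_inj.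
  by rewrite row_mxEr.
exact: (measurableT_comp (measurable_coor (T := R) k) measurable_snd).
Qed.

Lemma measurable_rVuncons n : measurable_fun [set: _] (@rVuncons n).
Proof.
apply/measurable_fun_pairP; split => /=; first exact: measurable_coor.
apply/measurable_fun_rVP => i /=.
have -> : (fun x : 'rV[R]_n.+1 => rsubmx (x : 'rV[R]_(1 + n)) ord0 i) =
    (fun x => x ord0 (rshift 1 i)).
  by apply/funext => x; rewrite mxE.
exact: measurable_coor.
Qed.

Section step.
Variables (n : nat) (mu : {sigma_finite_measure set 'rV[R]_n -> \bar R}).

Definition lebesgue_rV_succ : set 'rV[R]_n.+1 -> \bar R :=
  pushforward (@lebesgue_measure R \x mu)%E (@rVcons n).

HB.instance Definition _ := Measure.copy lebesgue_rV_succ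
  (measure_function_pushforward__canonical__measure_function_Measure (@lebesgue_measure R \x mu)%E
    (@measurable_rVcons n)).

Let lebesgue_rV_succ_sigma_finite : sigma_finite setT lebesgue_rV_succ.
Proof.
have /sigma_finiteP[F [TF ndF Foo]] := sigma_finiteT (@lebesgue_measure R).
have /sigma_finiteP[G [TG ndG Goo]] := sigma_finiteT mu.
exists (fun k => @rVuncons n @^-1` (F k `*` G k)).
  apply/esym; rewrite -subTset => x _.
  have [i _ Fi] : (\bigcup_i F i) (rVuncons x).1 by rewrite -TF.
  have [j _ Gj] : (\bigcup_j G j) (rVuncons x).2 by rewrite -TG.
  exists (maxn i j) => //; split => /=.
  - by move: Fi; exact/subsetPset/ndF/leq_maxl.
  - by move: Gj; exact/subsetPset/ndG/leq_maxr.
move=> k; have [mF Fkoo] := Foo k; have [mG Gkoo] := Goo k.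
have mFG : measurable (F k `*` G k : set (R * 'rV[R]_n)) by exact: measurableX.
split.
  by rewrite -[X in measurable X]setTI; exact: measurable_rVuncons.
rewrite /lebesgue_rV_succ /pushforward -comp_preimage.
have -> : @rVuncons n \o @rVcons n = id by apply/funext; exact: rVconsK.
by rewrite preimage_id product_measure1E// lte_mul_pinfty// ge0_fin_numE.
Qed.

HB.instance Definition _ := Measure_isSigmaFinite.Build _ _ _
  lebesgue_rV_succ lebesgue_rV_succ_sigma_finite.

End step.

Fixpoint lebesgue_rV n : {sigma_finite_measure set 'rV[R]_n -> \bar R} :=
  match n with
  | 0 => dirac (0 : 'rV[R]_0)
  | m.+1 => lebesgue_rV_succ (lebesgue_rV m)
  end.

End lebesgue_rV.
Arguments lebesgue_rV R n : clear implicits.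

(* The norm `|x| of the library on 'rV[R]_n is the sup norm. *)
Definition enorm (R : realType) n (x : 'rV[R]_n) : R :=
  Num.sqrt (\sum_(i < n) x ord0 i ^+ 2).

Section sobolev.
Context {R : realType} {n : nat}.
Implicit Types (f g psi : 'rV[R]_n -> R) (i : 'I_n).

Definition partial i f : 'rV[R]_n -> R := 'D_(delta_mx ord0 i) f.

Fixpoint Ck (k : nat) f : Prop :=
  match k with
  | 0 => continuous f
  | m.+1 => continuous f /\
      forall i, (forall x, derivable f x (delta_mx ord0 i)) /\ Ck m (partial i f)
  end.

Definition test_function psi : Prop :=
  (forall k, Ck k psi) /\ compact (closure [set x | psi x != 0]).

Definition weak_partial i f g : Prop :=
  forall psi, test_function psi ->
    \int[lebesgue_rV R n]_x (f x * partial i psi x) =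
    - \int[lebesgue_rV R n]_x (g x * psi x).

Definition sobolev_W1oo f : Prop :=
  f \in Lfun (lebesgue_rV R n) +oo%E /\
  forall i, exists2 g, g \in Lfun (lebesgue_rV R n) +oo%E & weak_partial i f g.

End sobolev.

Section solution.
Context {R : realType} {n : nat}.

Definition radial_potential (q0 : R -> R) (x : 'rV[R]_n) : R :=
  \int[@lebesgue_measure R]_(s in `[0, enorm x]) q0 s.

Variables (eps : R) (phi0 : 'rV[R]_n -> R).

Definition hopf_cole_weight (x : 'rV[R]_n) (t : R) (y : 'rV[R]_n) : R :=
  expR (- eps^-1 * (enorm (x - y) ^+ 2 / (2 * t) + phi0 y)).

Definition hopf_cole (x : 'rV[R]_n) (t : R) : 'rV[R]_n :=
  \row_(i < n)
    ((\int[lebesgue_rV R n]_y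
        ((x ord0 i - y ord0 i) / t * hopf_cole_weight x t y)) /
     (\int[lebesgue_rV R n]_y hopf_cole_weight x t y)).

(* X x t s is the position at time s of the characteristic that is at x at
   time t. The velocity is only defined for positive times, so that the value
   at time 0 is fixed by continuity. *)
Definition characteristics (u : 'rV[R]_n -> R -> 'rV[R]_n)
    (X : 'rV[R]_n -> R -> R -> 'rV[R]_n) : Prop :=
  forall x t, 0 < t ->
    [/\ X x t t = x,
        {within `[0, t], continuous (X x t)} &
        forall s, 0 < s < t -> is_derive s 1 (X x t) (u (X x t s) s)].

Definition transported_density (rho0 : 'rV[R]_n -> R)
    (X : 'rV[R]_n -> R -> R -> 'rV[R]_n) (x : 'rV[R]_n) (t : R) : R :=
  rho0 (X x t 0) * \det ('J (fun z => X z t 0) x).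

End solution.

(* Main.v *)
(* With psi = exp (- phi0 / eps), the substitution y = x + sqrt t z turns the
   Hopf-Cole formula into u_i(x, t) = - t^(-1/2) T_i(x) / T_0(x), where T_0 and
   T_i are the averages of psi (x + sqrt t z) against the Gaussian kernels G(z)
   and z_i G(z). As phi0 is bounded and Lipschitz, psi is bounded, bounded away
   from 0 and Lipschitz, so that |u(x, t)| = O(t^(-1/2)) uniformly in x.

   Mass: u(., t) is Lipschitz with constant O(t^(-1/2)), and its parallelogram
   u(x+v+w) - u(x+v) - u(x+w) + u(x) is O(t^(-3/4) |v| |w|^(1/2)), because one
   increment can be put on psi and the other one on the kernel. Both constants
   are integrable at t = 0, so Gronwall's lemma transfers these two bounds to
   the backward flow, down to time 0, without differentiating u. A map with
   such bounds has a jointly continuous matrix of difference quotients, whose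
   diagonal is the Jacobian matrix. The flow is cut into finitely many steps
   that are so close to the identity that this matrix is positive definite; for
   such a map the change of variables formula follows by induction on the
   dimension, substituting in the first coordinate and passing to the Schur
   complement for the others.

   That phi0 is Lipschitz is read off its weak gradient: tested against a slab
   whose axial derivative is a difference of two mollifiers centred on the axis
   at a and a + h, it bounds the increment of the radial profile by M h. *)

From HB Require Import structures.
Require Import Defs.
From mathcomp Require Import all_boot all_order all_algebra.
From mathcomp Require Import all_classical all_reals all_analysis.
From mathcomp Require Import measurable_realfun ess_sup_inf.
From mathcomp Require Import ring lra.
Set Implicit Arguments.
Unset Strict Implicit.
Unset Printing Implicit Defensive.
Import Order.TTheory GRing.Theory Num.Theory.
Import numFieldNormedType.Exports.
Local Open Scope classical_set_scope.
Local Open Scope ring_scope.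

(** * Continuity and measurability on row vectors *)

(** The exponent 1/2 is a compromise. With [phi0] merely Lipschitz, the velocity has first
    differences of order t^(-1/2), but the available bound on its second derivatives is O(1/t),
    which is not integrable at 0. Asking only that first derivatives be Hölder of exponent 1/2 costs
    t^(-1/4) instead of t^(-1/2), and t^(-3/4) still has a primitive that is continuous at 0. All
    rates are therefore written as the derivative [b'] of such a function [b], and estimates follow
    from monotonicity of expressions in [b], never by integrating a singular rate.

    Difference quotients at pairs of points turn restriction to a fibre and composition into
    algebraic identities, so that no inverse or implicit function theorem intervenes. Positive
    definiteness is preferred to invertibility because it makes the first coordinate increase with
    slope at least [c], hence a bijection of the line, and because Schur complements keep the same
    [c]. It is not stable under composition, so the steps of the flow are composed through their
    integral identities. *)

Lemma continuous_mx_entries (R : realType) (T : topologicalType) m n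
    (f : T -> 'M[R]_(m, n)) (x : T) :
  (forall i j, {for x, continuous (fun t => f t i j)}) ->
  {for x, continuous f}.
Proof.
move=> cf A [P HP PA].
have : \forall t \near x, forall i j, P i j (f t i j).
  by apply: filter_forall => i; apply: filter_forall => j; exact: cf.
by apply: filterS => t Pt; apply: PA.
Qed.

(** An open set is the union of the countably many boxes [D c], with rational centre and radius
    1/(k+1), that it contains. Each box is a finite intersection of preimages under coordinates. *)
Lemma measurable_open_rV (R : realType) n (U : set 'rV[R]_n) :
  open U -> measurable U.
Proof.
move=> oU.
pose D (c : 'rV[rat]_n * nat) : set 'rV[R]_n :=
  [set x | forall i, `|x ord0 i - ratr (c.1 ord0 i)| < c.2.+1%:R^-1].
have mD c : measurable (D c).
  have -> : D c = \bigcap_(i in [set: 'I_n])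
      ((fun x : 'rV[R]_n => x ord0 i) @^-1`
        ball (ratr (c.1 ord0 i) : R) c.2.+1%:R^-1).
    apply/seteqP; split => [x Dx i _|x Dx i].
      by rewrite /= /ball /= distrC; exact: Dx.
    by have := Dx i Logic.I; rewrite /= /ball /= distrC.
  apply: fin_bigcap_measurable; first exact: finite_finset.
  move=> i _; rewrite -[X in measurable X]setTI; apply: measurable_coor => //.
  exact: measurable_ball.
pose E c := if `[< D c `<=` U >] then D c else set0.
suff -> : U = \bigcup_c E c.
  apply: countable_bigcupT_measurable; first exact: countableP.
  by move=> c; rewrite /E; case: ifP.
apply/seteqP; split => [x Ux|x [c _]]; last first.
  by rewrite /E; case: asboolP => // + Dx; apply.
have /nbhs_ballP[e e0 eU] : nbhs x U by exact: open_nbhs_nbhs.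
have [k ke] : exists k : nat, (k.+1%:R^-1 : R) < e / 2.
  have e20 : 0 < e / 2 by rewrite divr_gt0.
  by have [N _ HN] := near_infty_natSinv_lt (PosNum e20); exists N; apply: HN => /=.
have rx i : exists q : rat, `|x ord0 i - ratr q| < (k.+1%:R^-1 : R).
  have := @dense_rat R (ball (x ord0 i) k.+1%:R^-1).
  case; first by exists (x ord0 i); apply: ballxx; rewrite invr_gt0.
    exact: ball_open.
  by move=> y [xy [q _ qy]]; exists q; rewrite qy.
have [q Hq] := choice rx.
have Dx : D (\row_i q i, k) x by move=> i; rewrite mxE; exact: Hq.
exists (\row_i q i, k) => //; rewrite /E; case: asboolP => //; case => y Dy.
apply: eU; split => // i j; rewrite ord1 /ball /=.
have := Dy j; have := Dx j; rewrite !mxE /= => xj yj.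
rewrite (_ : _ - _ = (x ord0 j - ratr (q j)) - (y ord0 j - ratr (q j))); last ring.
rewrite (le_lt_trans (ler_normB _ _))// [ltRHS](splitr e).
by apply: ltrD; apply: lt_trans ke.
Qed.

Lemma continuous_measurable_rV (R : realType) n (f : 'rV[R]_n -> R) :
  continuous f -> measurable_fun [set: 'rV[R]_n] f.
Proof.
move=> cf; apply: (measurability _ (RGenOpens.measurableE R)).
move=> _ [_ [a [b ->] <-]]; rewrite setTI.
by apply: measurable_open_rV; apply: open_comp => //; move=> x _; exact: cf.
Qed.

Lemma continuous_measurable_rV_rV (R : realType) m n (f : 'rV[R]_m -> 'rV[R]_n) :
  continuous f -> measurable_fun [set: 'rV[R]_m] f.
Proof.
move=> cf; apply/measurable_fun_rVP => i; apply: continuous_measurable_rV => x.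
apply: (@continuous_comp _ _ _ f (fun M => M ord0 i) x (cf x)).
exact: coord_continuous.
Qed.

Lemma continuous_det (R : realType) (T : topologicalType) n
    (A : T -> 'M[R]_n) (x : T) :
  {for x, continuous A} -> {for x, continuous (fun t => \det (A t))}.
Proof.
move=> cA; rewrite /determinant.
have cE i j : A t i j @[t --> x] --> A x i j.
  exact: (@continuous_comp _ _ _ A (fun M => M i j) x cA (@coord_continuous _ _ _ _ _ _)).
apply: (@cvg_big R _ +%R 0); first exact: add_continuous.
move=> s _; apply: cvgM; first exact: cvg_cst.
apply: (@cvg_big R _ *%R 1); first exact: mul_continuous.
by move=> i _; exact: cE.
Qed.

(** * Measures given by a density *)

Section density.
Local Open Scope ereal_scope.
Context d (T : measurableType d) (R : realType).
Variables (mu : {measure set T -> \bar R}) (w : T -> R).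
Hypotheses (mw : measurable_fun [set: T] w) (w0 : forall x, (0 <= w x)%R).

Definition density_measure (A : set T) : \bar R := \int[mu]_(x in A) (w x)%:E.

Let density0 : density_measure set0 = 0.
Proof. by rewrite /density_measure integral_set0. Qed.

Let density_ge0 A : 0 <= density_measure A.
Proof. by apply: integral_ge0 => x _; rewrite lee_fin. Qed.

Let density_sigma_additive : semi_sigma_additive density_measure.
Proof.
move=> F mF tF mUF; rewrite /density_measure ge0_integral_bigcup//.
  by apply: is_cvg_nneseries => n _ _; exact: density_ge0.
  exact/measurable_EFinP/measurable_funTS.
by move=> x _; rewrite lee_fin.
Qed.

HB.instance Definition _ := isMeasure.Build _ _ _ density_measure
  density0 density_ge0 density_sigma_additive.

Definition mdensity : {measure set T -> \bar R} := density_measure.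

Import HBNNSimple.

(** Monotone convergence reduces the identity to simple functions, then to indicators, where both
    sides are the integral of [w] over a measurable set. *)
Lemma ge0_integral_density (f : T -> \bar R) :
  measurable_fun setT f -> (forall x, 0 <= f x) ->
  \int[mdensity]_x f x = \int[mu]_x (f x * (w x)%:E).
Proof.
move=> mf f0.
pose h := nnsfun_approx measurableT mf.
have hf x : (h n x)%:E @[n --> \oo] --> f x.
  by apply: cvg_nnsfun_approx => // *.
have -> : \int[mdensity]_x f x =
    lim (\int[mdensity]_x (h n x)%:E @[n --> \oo]).
  under eq_integral => x _ do rewrite -(cvg_lim _ (hf x))//.
  apply: monotone_convergence => //.
  - by move=> n; exact/measurable_EFinP/measurable_funP.
  - by move=> n x _; rewrite lee_fin.
  - by move=> x _ a b ab; rewrite lee_fin; exact/lefP/nd_nnsfun_approx.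
have -> : \int[mu]_x (f x * (w x)%:E) = lim (\int[mu]_x ((h n x)%:E * (w x)%:E) @[n --> \oo]).
  have hw x : (h n x)%:E * (w x)%:E @[n --> \oo] --> f x * (w x)%:E.
    exact: cvgeZr.
  under eq_integral => x _ do rewrite -(cvg_lim _ (hw x))//.
  apply: monotone_convergence => //.
  - move=> n; apply: emeasurable_funM; apply/measurable_EFinP => //.
  - by move=> n x _; rewrite mule_ge0 ?lee_fin.
  - move=> x _ a b ab; rewrite lee_wpmul2r ?lee_fin//.
    exact/lefP/nd_nnsfun_approx.
suff suf n : \int[mdensity]_x (h n x)%:E = \int[mu]_x ((h n x)%:E * (w x)%:E).
  by under eq_fun do rewrite suf.
transitivity (\int[mdensity]_x
   (\sum_(y \in range (h n)) (y * \1_(h n @^-1` [set y]) x)%:E)).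
  by apply: eq_integral => t tE; rewrite /= fimfunE -fsumEFin.
rewrite ge0_integral_fsum//; last 2 first.
  - by move=> y; exact/measurable_EFinP/measurable_funM.
  - by move=> y x _; exact: nnfun_muleindic_ge0.
transitivity (\int[mu]_x (\sum_(y \in range (h n))
    ((y * \1_(h n @^-1` [set y]) x)%:E * (w x)%:E))); last first.
  apply: eq_integral => x _.
  rewrite -ge0_mule_fsuml => [|y]; last exact: nnfun_muleindic_ge0.
  by rewrite fsumEFin // -(fimfunE _ x).
rewrite ge0_integral_fsum//; last 2 first.
  - move=> y; apply: emeasurable_funM; last exact/measurable_EFinP.
    exact/measurable_EFinP/measurable_funM.
  - by move=> y x _; apply: mule_ge0; rewrite ?EFinM ?nnfun_muleindic_ge0 ?lee_fin.
apply: eq_fsbigr => r rhn.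
rewrite integralZl_indic_nnsfun// integral_indic// setIT.
under eq_integral do rewrite EFinM -muleA.
rewrite ge0_integralZl//; last 3 first.
- by apply: emeasurable_funM; exact/measurable_EFinP.
- by move=> x _; rewrite mule_ge0// lee_fin.
- by move: rhn => /set_mem[t _ <-]; rewrite lee_fin.
congr (_ * _); rewrite /density_measure [LHS]integral_mkcond.
apply: eq_integral => x _; rewrite patchE/= indicE.
by case: ifPn => xr; rewrite ?mul1e ?mul0e.
Qed.

End density.

Lemma for_continuous_pair (T U V : topologicalType) (f : T -> U) (g : T -> V) x :
  {for x, continuous f} -> {for x, continuous g} ->
  {for x, continuous (fun t => (f t, g t))}.
Proof. by move=> cf cg; exact: cvg_pair. Qed.

Lemma for_continuous_cst (T U : topologicalType) (c : U) (x : T) :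
  {for x, continuous (fun _ : T => c)}.
Proof. exact: cvg_cst. Qed.

Lemma for_continuous_id (T : topologicalType) (x : T) : {for x, continuous (fun t : T => t)}.
Proof. exact: cvg_id. Qed.

Lemma for_continuous_entry (R : realType) (T : topologicalType) m n
    (A : T -> 'M[R]_(m, n)) (x : T) i j :
  {for x, continuous A} -> {for x, continuous (fun t => A t i j)}.
Proof.
move=> cA; apply: (@continuous_comp _ _ _ A (fun M => M i j) x cA).
exact: coord_continuous.
Qed.

Lemma for_continuous_comp2 (T U V W : topologicalType) (h : U * V -> W) (f : T -> U)
    (g : T -> V) (x : T) :
  {for x, continuous f} -> {for x, continuous g} -> {for (f x, g x), continuous h} ->
  {for x, continuous (fun t => h (f t, g t))}.
Proof.
move=> cf cg ch; apply: (@continuous_comp _ _ _ (fun t => (f t, g t)) h x _ ch).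
exact: for_continuous_pair.
Qed.

Lemma mx_norm_entry (R : realType) m n (A : 'M[R]_(m, n)) i j : `|A i j| <= `|A|.
Proof.
rewrite [leRHS]/Num.norm /= mx_normrE; apply/bigmax_geP; right => /=.
by exists (i, j).
Qed.

Lemma mx_norm_le (R : realType) m n (A : 'M[R]_(m, n)) b :
  0 <= b -> (forall i j, `|A i j| <= b) -> `|A| <= b.
Proof.
move=> b0 Ab; rewrite [leLHS]/Num.norm /= mx_normrE.
by apply/bigmax_leP; split => // -[i j] _ /=.
Qed.

(** The norm is the largest entry in absolute value, which is not submultiplicative: hence the
    factor [n]. *)
Lemma mx_norm_mul (R : realType) m n p (A : 'M[R]_(m, n)) (B : 'M[R]_(n, p)) :
  `|A *m B| <= n%:R * (`|A| * `|B|).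
Proof.
apply: mx_norm_le => [|i j]; first by rewrite !mulr_ge0.
rewrite mxE (le_trans (ler_norm_sum _ _ _))//.
have -> : n%:R * (`|A| * `|B|) = \sum_(k < n) `|A| * `|B|.
  by rewrite sumr_const card_ord mulr_natl.
by apply: ler_sum => k _; rewrite normrM ler_pM// mx_norm_entry.
Qed.

(** * Change of variables *)

(** Carathéodory's form of the derivative: the difference quotient at [x] coincides with [s] off
    [x], and [s] is continuous at [x]. *)
Lemma is_derive_slope (R : realType) (g s : R -> R) (x : R) :
  (forall y, g y - g x = (y - x) * s y) -> {for x, continuous s} ->
  is_derive x 1 g (s x).
Proof.
move=> gs cs.
have cvs : h^-1 *: ((g \o shift x) (h *: 1) - g x) @[h --> 0^'] --> s x.
  have cs0 : s (h + x) @[h --> 0^'] --> s x.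
    have : s (h + x) @[h --> 0] --> s x.
      have H : h + x @[h --> (0 : R)] --> x.
        by rewrite -[X in _ --> X]add0r; apply: cvgD; [exact: cvg_id|exact: cvg_cst].
      exact: (cvg_comp _ _ H cs).
    by move=> /cvg_within_filter; apply.
  apply: cvg_trans cs0; apply: near_eq_cvg; near=> h.
  have h0 : h != 0 by near: h; exact: nbhs_dnbhs_neq.
  by rewrite /= gs /= scaler1 addrK /GRing.scale/= mulrA mulVf// mul1r.
by apply: DeriveDef; [apply/cvg_ex; exists (s x)|exact/cvg_lim].
Unshelve. all: by end_near. Qed.

(** * Substitution along a function of one variable with slopes at least [c] *)

Section increasing_substitution.
Variables (R : realType) (g : R -> R) (psi : R -> R -> R) (c : R).
Hypotheses (c0 : 0 < c) (gpsi : forall x y, g y - g x = (y - x) * psi x y)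
  (psic : forall x y, c <= psi x y)
  (cpsi : continuous (fun p : R * R => psi p.1 p.2)).

Lemma slope_is_derive (x : R) : is_derive x (1 : R) g (psi x x).
Proof.
apply: is_derive_slope => //.
apply: (@continuous_comp _ _ _ (fun t => (x, t)) (fun p => psi p.1 p.2) x).
  by apply: for_continuous_pair; [exact: cvg_cst|exact: cvg_id].
exact: cpsi.
Qed.

Lemma slope_continuous : continuous g.
Proof.
move=> x; apply/differentiable_continuous/derivable1_diffP.
by have [] := slope_is_derive x.
Qed.

Lemma slope_lt x y : (g x < g y) = (x < y).
Proof.
have p0 a b : 0 < psi a b by apply: lt_le_trans (psic _ _).
by rewrite -subr_gt0 gpsi pmulr_lgt0// subr_gt0.
Qed.

Lemma slope_le x y : (g x <= g y) = (x <= y).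
Proof. by rewrite !leNgt slope_lt. Qed.

(** On each side of 0, over a length [M], the function [g] rises by at least [M * c], which is the
    distance from [y] to [g 0]. The intermediate value theorem does the rest. *)
Lemma slope_surj y : exists x, g x = y.
Proof.
pose M := `|y - g 0| / c.
have M0 : 0 <= M by rewrite divr_ge0// ltW.
have cM : M * c = `|y - g 0| by rewrite divfK// gt_eqF.
have gM : y <= g M.
  have := gpsi 0 M; rewrite subr0 => /eqP; rewrite subr_eq => /eqP ->.
  rewrite -lerBlDr (le_trans (ler_norm _))// -cM.
  exact: ler_wpM2l.
have gNM : g (- M) <= y.
  have := gpsi (-M) 0; rewrite sub0r opprK => /eqP; rewrite subr_eq addrC -subr_eq => /eqP <-.
  rewrite lerBlDr addrC -lerBlDr (le_trans (ler_norm _))// distrC -cM.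
  exact: ler_wpM2l.
have [|||x _ gx] := @IVT R g (- M) M y.
- by rewrite (le_trans _ M0)// oppr_le0.
- exact/continuous_subspaceT/slope_continuous.
- rewrite minEle maxEle.
  have -> : g (- M) <= g M by apply: le_trans gM.
  by rewrite gM gNM.
by exists x.
Qed.

Let psiD_continuous : continuous (fun x => psi x x).
Proof.
move=> x; apply: (@continuous_comp _ _ _ (fun t => (t, t)) (fun p => psi p.1 p.2) x).
  by apply: for_continuous_pair; exact: cvg_id.
exact: cpsi.
Qed.

Let psiD0 x : 0 <= psi x x.
Proof. by apply: le_trans (psic _ _); exact: ltW. Qed.

Let mpsiD : measurable_fun [set: measurableTypeR R] (fun x => psi x x).
Proof. exact: continuous_measurable_fun. Qed.

Lemma slope_measurable : measurable_fun [set: measurableTypeR R] (g : _ -> measurableTypeR R).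
Proof. by apply: continuous_measurable_fun; exact: slope_continuous. Qed.

Local Open Scope ereal_scope.
Local Notation mu := (@lebesgue_measure R).

(** The image under [g] of the measure with density [psi x x] gives []a, b]] the mass [b - a],
    because [g] is a primitive of that density. By uniqueness it is Lebesgue measure. *)
Lemma ge0_integral_slope (f : measurableTypeR R -> \bar R) :
  measurable_fun [set: measurableTypeR R] f -> (forall x, 0 <= f x) ->
  \int[mu]_x (f (g x) * (psi x x)%:E) = \int[mu]_x f x.
Proof.
move=> mf f0; apply/esym.
pose dm := @mdensity _ _ R mu (fun x : measurableTypeR R => psi x x) mpsiD psiD0.
pose nu := measure_function_pushforward__canonical__measure_function_Measure
  dm slope_measurable.
transitivity (\int[nu]_x f x).
  apply: eq_measure_integral => A mA _; symmetry; apply/esym.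
  apply: lebesgue_measure_unique => // _ [[a b] _ <-] /=.
  rewrite /pushforward /=/dm /density_measure.
  have [a' ga'] := slope_surj a; have [b' gb'] := slope_surj b.
  have -> : g @^-1` `]a, b] = `]a', b']%classic.
    by apply/seteqP; split => x /=; rewrite !in_itv /= -ga' -gb' slope_lt slope_le.
  have [ab|ba] := ltP a' b'; last first.
    have ba' : (b <= a)%R by rewrite -ga' -gb' slope_le.
    by rewrite !set_itv_ge ?integral_set0 ?measure0// bnd_simp -leNgt.
  rewrite integral_itv_obnd_cbnd; last exact/measurable_EFinP/measurable_funTS.
  rewrite (@continuous_FTC2 _ _ g)//.
  - rewrite lebesgue_measure_itv /= -ga' -gb' lte_fin slope_lt ab.
    by [].
  - exact: continuous_subspaceT.
  - split.
    + by move=> x _; have [] := slope_is_derive x.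
    + by apply: cvg_at_right_filter; exact: slope_continuous.
    + by apply: cvg_at_left_filter; exact: slope_continuous.
  - by move=> x _; rewrite derive1E; have [_ ->] := slope_is_derive x.
rewrite ge0_integral_pushforward//; last exact: slope_measurable.
rewrite preimage_setT /dm ge0_integral_density//=.
exact: measurableT_comp mf slope_measurable.
Qed.

End increasing_substitution.

(** * Integration over row vectors, one coordinate at a time *)

Section tonelli_rV.
Context {R : realType}.
Local Open Scope ereal_scope.
Local Notation mu := (@lebesgue_measure R).

Lemma ge0_integral_rV0 (f : 'rV[R]_0 -> \bar R) :
  measurable_fun [set: 'rV[R]_0] f -> \int[lebesgue_rV R 0]_x f x = f 0%R.
Proof. by move=> mf; rewrite /= integral_dirac// diracT mul1e. Qed.

Variables (n : nat) (f : 'rV[R]_n.+1 -> \bar R).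
Hypotheses (mf : measurable_fun [set: 'rV[R]_n.+1] f) (f0 : forall x, 0 <= f x).

Let mfc : measurable_fun [set: (measurableTypeR R * 'rV[R]_n)%type] (f \o @rVcons R n).
Proof. exact: measurableT_comp mf (@measurable_rVcons R n). Qed.

Lemma ge0_integral_rVS : \int[lebesgue_rV R n.+1]_x f x =
  \int[mu]_a \int[lebesgue_rV R n]_v f (rVcons (a, v)).
Proof.
rewrite /= /lebesgue_rV_succ ge0_integral_pushforward//; last exact: measurable_rVcons.
by rewrite preimage_setT fubini_tonelli1// => x; exact: f0.
Qed.

Lemma ge0_integral_rVS_swap : \int[lebesgue_rV R n.+1]_x f x =
  \int[lebesgue_rV R n]_v \int[mu]_a f (rVcons (a, v)).
Proof.
rewrite /= /lebesgue_rV_succ ge0_integral_pushforward//; last exact: measurable_rVcons.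
by rewrite preimage_setT fubini_tonelli2// => x; exact: f0.
Qed.

End tonelli_rV.

(** * Schur complements of positive definite matrices *)

Section schur.
Context {R : realType}.

Definition posdef c n (M : 'M[R]_n) :=
  forall v : 'rV[R]_n, c * (v *m v^T) ord0 ord0 <= (v *m M *m v^T) ord0 ord0.

Definition schur n (M : 'M[R]_n.+1) : 'M[R]_n :=
  \matrix_(i, j) (M (rshift 1 i) (rshift 1 j) -
    (M ord0 ord0)^-1 * (M (rshift 1 i) ord0 * M ord0 (rshift 1 j))).

Let ord0E n : ord0 = lshift n (ord0 : 'I_1) :> 'I_(1 + n).
Proof. exact/val_inj. Qed.

Lemma schurE n (M : 'M[R]_n.+1) (M' := M : 'M[R]_(1 + n)) :
  schur M = drsubmx M' - (M ord0 ord0)^-1 *: (dlsubmx M' *m ursubmx M').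
Proof.
apply/matrixP => i j; rewrite !mxE big_ord1 !mxE.
by rewrite -!ord0E.
Qed.

Lemma ulsubmx_scalar n (M : 'M[R]_n.+1) :
  ulsubmx (M : 'M[R]_(1 + n)) = (M ord0 ord0)%:M.
Proof. by apply/matrixP => i j; rewrite !mxE !ord1 -!ord0E eqxx mulr1n. Qed.

(** The hypothesis determines [k] from [d], and substituting it eliminates the first coordinate. It
    applies to two points at which the first coordinate of a map takes the same value. *)
Lemma mul_row_schur n (M : 'M[R]_n.+1) (M' := M : 'M[R]_(1 + n))
    (k : 'M[R]_1) (d : 'rV[R]_n) : M ord0 ord0 != 0 ->
  k *m ulsubmx M' + d *m dlsubmx M' = 0 ->
  k *m ursubmx M' + d *m drsubmx M' = d *m schur M.
Proof.
move=> M0; rewrite ulsubmx_scalar mul_mx_scalar => kd.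
have -> : k = - (M ord0 ord0)^-1 *: (d *m dlsubmx M').
  apply: (scalerI M0); rewrite scalerA mulrN mulfV// scaleN1r.
  by apply/eqP; rewrite -addr_eq0 kd.
by rewrite schurE mulmxBr -scalemxAl scaleNr -scalemxAr mulmxA addrC.
Qed.

(** Block LU factorization with a unit lower triangular factor. *)
Lemma det_schur n (M : 'M[R]_n.+1) : M ord0 ord0 != 0 ->
  \det M = M ord0 ord0 * \det (schur M).
Proof.
move=> M0; pose M' := M : 'M[R]_(1 + n).
have -> : \det M = \det (block_mx (1%:M : 'M[R]_1) 0 ((M ord0 ord0)^-1 *: dlsubmx M')
      (1%:M : 'M[R]_n) *m
    block_mx (ulsubmx M') (ursubmx M') 0 (schur M)).
  congr (\det _); rewrite mulmx_block !mul1mx !mul0mx !addr0 ulsubmx_scalar.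
  rewrite mul_mx_scalar scalerA mulfV// scale1r schurE -scalemxAl.
  rewrite addrC subrK -ulsubmx_scalar.
  exact: (esym (submxK M')).
by rewrite det_mulmx det_lblock det_ublock !det1 !mul1r ulsubmx_scalar det_scalar1.
Qed.

Lemma posdef_entry c n (M : 'M[R]_n.+1) : posdef c M -> c <= M ord0 ord0.
Proof.
move=> /(_ (delta_mx ord0 ord0)).
rewrite trmx_delta mul_delta_mx mxE !eqxx mulr1 => /le_trans; apply.
by rewrite -rowE -colE !mxE.
Qed.

(** The vector [v] is extended by the entry [k] for which the first entry of the product with [M]
    vanishes. On the extended vector the form of [M] equals that of the Schur complement on [v], and
    the squared norm only grows by the square of [k], so [c] is not diminished. *)
Lemma posdef_schur c n (M : 'M[R]_n.+1) : 0 < c -> posdef c M -> posdef c (schur M).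
Proof.
move=> c0 Mc v; pose M' := M : 'M[R]_(1 + n).
have M0 : M ord0 ord0 != 0 by rewrite gt_eqF// (lt_le_trans c0)//; exact: posdef_entry.
pose k : 'M[R]_1 := - (M ord0 ord0)^-1 *: (v *m dlsubmx M').
have ku : k *m ulsubmx M' + v *m dlsubmx M' = 0.
  by rewrite ulsubmx_scalar mul_mx_scalar scalerA mulrN mulfV// scaleN1r addNr.
have kM : row_mx k v *m M' = row_mx 0 (v *m schur M).
  by rewrite -[in LHS](submxK M') mul_row_block ku (mul_row_schur M0 ku).
have : c * (row_mx k v *m (row_mx k v)^T) ord0 ord0 <=
    (row_mx k v *m M' *m (row_mx k v)^T) ord0 ord0 by exact: Mc.
rewrite kM.
rewrite !tr_row_mx !mul_row_col mul0mx add0r; apply: le_trans.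
rewrite ler_pM2l// [leRHS]mxE lerDr mxE big_ord1.
by rewrite [k^T _ _]mxE -expr2 sqr_ge0.
Qed.

Lemma posdef_det c n (M : 'M[R]_n) : 0 < c -> posdef c M -> 0 < \det M.
Proof.
move=> c0; elim: n M => [|n IH] M Mc; first by rewrite det_mx00.
have M0 : 0 < M ord0 ord0 by rewrite (lt_le_trans c0)//; exact: posdef_entry.
by rewrite det_schur ?gt_eqF// mulr_gt0// IH//; exact: posdef_schur.
Qed.

Lemma continuous_schur (T : topologicalType) n (A : T -> 'M[R]_n.+1) (x : T) :
  A x ord0 ord0 != 0 -> {for x, continuous A} ->
  {for x, continuous (fun t => schur (A t))}.
Proof.
move=> A0 cA; apply: continuous_mx_entries => i j.
have cE i' j' : A t i' j' @[t --> x] --> A x i' j'.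
  exact: (@continuous_comp _ _ _ A (fun M => M i' j') x cA (@coord_continuous _ _ _ _ _ _)).
have -> : (fun t => schur (A t) i j) = fun t => A t (rshift 1 i) (rshift 1 j) -
    (A t ord0 ord0)^-1 * (A t (rshift 1 i) ord0 * A t ord0 (rshift 1 j)).
  by apply/funext => t; rewrite mxE.
by apply: cvgB => //; apply: cvgM; [exact: cvgV|exact: cvgM].
Qed.

End schur.

(** * Maps with a continuous matrix of difference quotients *)

Section change_of_variables.
Context {R : realType}.

Lemma rVcons_ord0 n (a : R) (v : 'rV[R]_n) : rVcons (a, v) ord0 ord0 = a.
Proof. by have := rVconsK (a, v) => -[]. Qed.

Lemma rsubmx_rVcons n (a : R) (v : 'rV[R]_n) :
  rsubmx (rVcons (a, v) : 'rV[R]_(1 + n)) = v.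
Proof. by have := rVconsK (a, v) => -[]. Qed.

Lemma continuous_rVcons n (T : topologicalType) (f : T -> R) (g : T -> 'rV[R]_n) x :
  {for x, continuous f} -> {for x, continuous g} ->
  {for x, continuous (fun t => rVcons (f t, g t))}.
Proof.
move=> cf cg; apply: continuous_mx_entries => i j; rewrite ord1 /rVcons /=.
case: (splitP (j : 'I_(1 + n))) => [k jk|k jk].
  have -> : (fun t => row_mx (f t)%:M (g t) ord0 j) = f.
    apply/funext => t; rewrite (_ : j = lshift n k); last exact/val_inj.
    by rewrite row_mxEl mxE !ord1 eqxx.
  exact: cf.
have -> : (fun t => row_mx (f t)%:M (g t) ord0 j) = fun t => g t ord0 k.
  apply/funext => t; rewrite (_ : j = rshift 1 k); last exact/val_inj.
  by rewrite row_mxEr.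
exact: (@continuous_comp _ _ _ g (fun M => M ord0 k) x cg (@coord_continuous _ _ _ _ _ _)).
Qed.

Lemma continuous_rsubmx n : continuous (fun x : 'rV[R]_n.+1 => rsubmx (x : 'rV[R]_(1 + n))).
Proof.
move=> x; apply: continuous_mx_entries => i j.
have -> : (fun x : 'rV[R]_n.+1 => rsubmx (x : 'rV[R]_(1 + n)) i j) =
    (fun x => x i (rshift 1 j)).
  by apply/funext => y; rewrite mxE.
exact: coord_continuous.
Qed.

(* Stands for "continuously differentiable"; vectors are rows, so [Psi x x] is
   the library's Jacobian matrix (see [slope_field_jacobian]). *)
Definition slope_field n (Y : 'rV[R]_n -> 'rV[R]_n) (Psi : 'rV[R]_n -> 'rV[R]_n -> 'M[R]_n) :=
  (forall x y, Y y - Y x = (y - x) *m Psi x y) /\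
  continuous (fun p : 'rV[R]_n * 'rV[R]_n => Psi p.1 p.2).

Lemma continuous_mulmx (T : topologicalType) m n p
    (A : T -> 'M[R]_(m, n)) (B : T -> 'M[R]_(n, p)) (x : T) :
  {for x, continuous A} -> {for x, continuous B} ->
  {for x, continuous (fun t => A t *m B t)}.
Proof.
move=> cA cB; apply: continuous_mx_entries => i j.
have cE i' j' : A t i' j' @[t --> x] --> A x i' j'.
  exact: (@continuous_comp _ _ _ A (fun M => M i' j') x cA (@coord_continuous _ _ _ _ _ _)).
have cE' i' j' : B t i' j' @[t --> x] --> B x i' j'.
  exact: (@continuous_comp _ _ _ B (fun M => M i' j') x cB (@coord_continuous _ _ _ _ _ _)).
have -> : (fun t => (A t *m B t) i j) = fun t => \sum_k A t i k * B t k j.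
  by apply/funext => t; rewrite mxE.
rewrite /prop_for /continuous_at; apply: (@cvg_big R _ +%R 0); first exact: add_continuous.
by move=> k _; apply: cvgM.
Qed.

Lemma slope_field_diag n (Y : 'rV[R]_n -> 'rV[R]_n) Psi :
  slope_field Y Psi -> continuous (fun x => Psi x x).
Proof.
move=> [YP cP] x.
apply: (for_continuous_comp2 (h := fun p => Psi p.1 p.2)); last exact: cP.
  exact: for_continuous_id.
exact: for_continuous_id.
Qed.

Lemma slope_field_continuous n (Y : 'rV[R]_n -> 'rV[R]_n) Psi :
  slope_field Y Psi -> continuous Y.
Proof.
move=> [YP cP] x.
have -> : Y = (fun y => Y x) \+ (fun y => (y - x) *m Psi x y).
  by apply/funext => y /=; rewrite -YP addrC subrK.
apply: continuousD; first exact: for_continuous_cst.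
apply: continuous_mulmx.
  apply: continuousB; first exact: for_continuous_id.
  exact: for_continuous_cst.
apply: (for_continuous_comp2 (h := fun p => Psi p.1 p.2)); last exact: cP.
  exact: for_continuous_cst.
exact: for_continuous_id.
Qed.

Lemma slope_field_comp n (Y1 Y2 : 'rV[R]_n -> 'rV[R]_n) Psi1 Psi2 :
  slope_field Y1 Psi1 -> slope_field Y2 Psi2 ->
  slope_field (Y2 \o Y1) (fun x y => Psi1 x y *m Psi2 (Y1 x) (Y1 y)).
Proof.
move=> /[dup] S1 [Y1P c1] [Y2P c2]; split => [x y|p]; first by rewrite /= Y2P Y1P mulmxA.
apply: continuous_mulmx; first exact: c1.
have cY := slope_field_continuous S1.
apply: (for_continuous_comp2 (h := fun p => Psi2 p.1 p.2)); last exact: c2.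
  by apply: (@continuous_comp _ _ _ fst Y1 p); [exact: cvg_fst|exact: cY].
by apply: (@continuous_comp _ _ _ snd Y1 p); [exact: cvg_snd|exact: cY].
Qed.

End change_of_variables.

Section measurable_slope.
Context {R : realType}.

Lemma measurable_slope_field_det n (Y : 'rV[R]_n -> 'rV[R]_n) Psi :
  slope_field Y Psi -> measurable_fun [set: 'rV[R]_n] (fun x => \det (Psi x x)).
Proof.
move=> YP; apply: continuous_measurable_rV => x.
apply: (@continuous_det _ _ _ (fun x => Psi x x) x).
exact: slope_field_diag YP _.
Qed.

Lemma measurable_slope_field n (Y : 'rV[R]_n -> 'rV[R]_n) Psi :
  slope_field Y Psi -> measurable_fun [set: 'rV[R]_n] Y.
Proof.
by move=> YP; apply: continuous_measurable_rV_rV; exact: slope_field_continuous YP.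
Qed.

End measurable_slope.

(** * Elimination of the first coordinate *)

Section cov_step.
Context {R : realType} (n : nat).
Variables (Y : 'rV[R]_n.+1 -> 'rV[R]_n.+1) (Psi : 'rV[R]_n.+1 -> 'rV[R]_n.+1 -> 'M[R]_n.+1).
Variables (c : R).
Hypotheses (c0 : 0 < c) (YPsi : slope_field Y Psi) (Psic : forall x y, posdef c (Psi x y)).

Let g (v : 'rV[R]_n) (a : R) := Y (rVcons (a, v)) ord0 ord0.
Let psi (v : 'rV[R]_n) (a b : R) := Psi (rVcons (a, v)) (rVcons (b, v)) ord0 ord0.

Let psic v a b : c <= psi v a b.
Proof. exact: posdef_entry. Qed.

Let Psi0 x y : Psi x y ord0 ord0 != 0.
Proof. by rewrite gt_eqF// (lt_le_trans c0)//; exact: posdef_entry. Qed.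

Lemma rVconsB (a b : R) (v w : 'rV[R]_n) :
  rVcons (b, w) - rVcons (a, v) = row_mx (b - a)%:M (w - v).
Proof.
have E : (row_mx b%:M w - row_mx a%:M v : 'rV[R]_(1 + n)) = row_mx (b - a)%:M (w - v).
  by rewrite opp_row_mx add_row_mx -raddfB.
exact: E.
Qed.

Lemma lsubmx_ord0 (x : 'rV[R]_n.+1) : lsubmx (x : 'rV[R]_(1 + n)) = (x ord0 ord0)%:M.
Proof.
apply/matrixP => i j; rewrite !mxE !ord1 eqxx mulr1n; congr (x _ _).
exact/val_inj.
Qed.

Lemma rVunconsK (x : 'rV[R]_n.+1) : rVcons (x ord0 ord0, rsubmx (x : 'rV[R]_(1 + n))) = x.
Proof. by rewrite /rVcons /= -lsubmx_ord0; exact: (@hsubmxK _ 1 1 n x). Qed.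

Let Ysplit (a b : R) (v w : 'rV[R]_n) (M := Psi (rVcons (a, v)) (rVcons (b, w)) : 'M[R]_(1 + n)) :
  (g w b - g v a)%:M = (b - a)%:M *m ulsubmx M + (w - v) *m dlsubmx M /\
  rsubmx (Y (rVcons (b, w)) : 'rV[R]_(1 + n)) - rsubmx (Y (rVcons (a, v)) : 'rV[R]_(1 + n)) =
  (b - a)%:M *m ursubmx M + (w - v) *m drsubmx M.
Proof.
have : (Y (rVcons (b, w)) - Y (rVcons (a, v)) : 'rV[R]_(1 + n)) =
    row_mx ((b - a)%:M *m ulsubmx M + (w - v) *m dlsubmx M)
      ((b - a)%:M *m ursubmx M + (w - v) *m drsubmx M).
  by rewrite YPsi.1 rVconsB -mul_row_block submxK.
move=> E; split.
  have := congr1 lsubmx E; rewrite row_mxKl => <-.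
  by rewrite lsubmx_ord0 !mxE.
have := congr1 rsubmx E; rewrite row_mxKr => <-.
by rewrite raddfB.
Qed.

Let gpsi v a b : g v b - g v a = (b - a) * psi v a b.
Proof.
have [+ _] := Ysplit a b v v; rewrite subrr mul0mx addr0 ulsubmx_scalar -scalar_mxM.
by move=> /matrixP/(_ ord0 ord0); rewrite !mxE eqxx !mulr1n.
Qed.

Let cpsi v : continuous (fun p : R * R => psi v p.1 p.2).
Proof.
move=> p; apply: for_continuous_entry.
apply: (for_continuous_comp2 (h := fun p => Psi p.1 p.2)); last exact: YPsi.2.
  by apply: continuous_rVcons; [exact: cvg_fst|exact: for_continuous_cst].
by apply: continuous_rVcons; [exact: cvg_snd|exact: for_continuous_cst].
Qed.

Lemma cov_inv : {h : 'rV[R]_n -> R -> R | forall v s, g v (h v s) = s}.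
Proof.
apply: cid.
have Hex (p : 'rV[R]_n * R) : exists a, g p.1 a = p.2.
  exact: (slope_surj c0 (gpsi p.1) (@psic p.1) (@cpsi p.1)).
by have [h Hh] := choice Hex; exists (fun v s => h (v, s)) => v s; exact: (Hh (v, s)).
Qed.

Let h := sval cov_inv.
Let gh v s : g v (h v s) = s. Proof. exact: (svalP cov_inv). Qed.

Let hg v a : h v (g v a) = a.
Proof.
have gi a1 a2 : g v a1 = g v a2 -> a1 = a2.
  move=> gab; apply/eqP; rewrite eq_le -(slope_le c0 (gpsi v) (@psic v)) gab lexx /=.
  by rewrite -(slope_le c0 (gpsi v) (@psic v)) gab lexx.
exact: gi (gh v (g v a)).
Qed.

(** As the slope is at least [c], the distance from [h v s] to [xi] is at most [c^-1] times that
    from [s] to [g v xi]. The latter is continuous in [(v, s)] and vanishes at [(v0, s0)]. *)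
Let ch : continuous (fun p : 'rV[R]_n * R => h p.1 p.2).
Proof.
move=> [v0 s0] /=; set xi := h v0 s0.
have cg : continuous (fun v => g v xi).
  move=> v; apply: for_continuous_entry.
  apply: (@continuous_comp _ _ _ (fun v => rVcons (xi, v)) Y v).
    by apply: continuous_rVcons; [exact: for_continuous_cst|exact: for_continuous_id].
  exact: slope_field_continuous YPsi _.
have K : c^-1 * `|p.2 - g p.1 xi| @[p --> (v0, s0)] --> (0 : R).
  have -> : 0 = c^-1 * `|s0 - g v0 xi| by rewrite /xi gh subrr normr0 mulr0.
  apply: cvgM; first exact: cvg_cst.
  apply: cvg_norm; apply: cvgB; first exact: cvg_snd.
  by apply: (@continuous_comp _ _ _ fst (fun v => g v xi) (v0, s0)); [exact: cvg_fst|exact: cg].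
apply/cvgrPdist_le => e e0; have /cvgrPdist_le/(_ e e0) := K.
apply: filterS => -[v s] /=; rewrite sub0r normrN; apply: le_trans.
rewrite [leRHS]ger0_norm ?mulr_ge0// ?invr_ge0 ?(ltW c0)//.
rewrite -[in leRHS](gh v s) gpsi normrM distrC mulrCA ler_peMr//.
rewrite -ler_pdivrMl ?invr_gt0// invrK mulr1.
by rewrite (le_trans (psic v xi (h v s)))// ler_norm.
Qed.

(** Inverse of the map that sends [rVcons (a, v)] to [rVcons (g v a, v)]. *)
Let Hmap (x : 'rV[R]_n.+1) : 'rV[R]_n.+1 := rVcons (h (rVuncons x).2 (rVuncons x).1, (rVuncons x).2).
Let Z (s : R) (v : 'rV[R]_n) : 'rV[R]_n := rsubmx (Y (rVcons (h v s, v)) : 'rV[R]_(1 + n)).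
Let Phi (s : R) (v w : 'rV[R]_n) : 'M[R]_n :=
  schur (Psi (rVcons (h v s, v)) (rVcons (h w s, w))).

Let ZPhi s : slope_field (Z s) (Phi s).
Proof.
split => [v w|p].
  have [gE ->] := Ysplit (h v s) (h w s) v w.
  (* Both points lie over the value [s] of the first coordinate of [Y], so its increment is zero. *)
  apply: mul_row_schur; first exact: Psi0.
  by rewrite -gE (gh w s) (gh v s) subrr raddf0.
apply: continuous_schur; first exact: Psi0.
have ch1 (v : 'rV[R]_n) : {for v, continuous (fun v => rVcons (h v s, v))}.
  apply: continuous_rVcons; last exact: for_continuous_id.
  apply: (for_continuous_comp2 (h := fun p => h p.1 p.2)); last exact: ch.
    exact: for_continuous_id.
  exact: for_continuous_cst.
apply: (for_continuous_comp2 (h := fun p => Psi p.1 p.2)); last exact: YPsi.2.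
  by apply: (@continuous_comp _ _ _ fst (fun v => rVcons (h v s, v)) p); [exact: cvg_fst|exact: ch1].
by apply: (@continuous_comp _ _ _ snd (fun v => rVcons (h v s, v)) p); [exact: cvg_snd|exact: ch1].
Qed.

Let cHmap : continuous Hmap.
Proof.
have c2 (x : 'rV[R]_n.+1) : {for x, continuous (fun x : 'rV[R]_n.+1 => (rVuncons x).2)}.
  exact: continuous_rsubmx.
move=> x; apply: (@continuous_rVcons _ _ _ (fun x : 'rV[R]_n.+1 => h (rVuncons x).2 (rVuncons x).1)
  (fun x => (rVuncons x).2) x); last exact: c2.
apply: (for_continuous_comp2 (h := fun p => h p.1 p.2)); last exact: ch.
  exact: c2.
exact: coord_continuous.
Qed.

(** This is [Y \o Hmap], with its first coordinate replaced by the equal [x ord0 ord0]. The map [Y]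
    is thus a substitution in the first coordinate followed by a map that preserves this
    coordinate. *)
Let Tmap (x : 'rV[R]_n.+1) : 'rV[R]_n.+1 :=
  rVcons (x ord0 ord0, rsubmx (Y (Hmap x) : 'rV[R]_(1 + n))).

Let cTmap : continuous Tmap.
Proof.
move=> x; apply: (@continuous_rVcons _ _ _ (fun x : 'rV[R]_n.+1 => x ord0 ord0)
  (fun x => rsubmx (Y (Hmap x) : 'rV[R]_(1 + n))) x); first exact: coord_continuous.
apply: (@continuous_comp _ _ _ (Y \o Hmap) (fun y : 'rV[R]_n.+1 => rsubmx (y : 'rV[R]_(1 + n))) x).
  by apply: continuous_comp; [exact: cHmap|exact: slope_field_continuous YPsi _].
exact: continuous_rsubmx.
Qed.

Let dmap (x : 'rV[R]_n.+1) : R := \det (schur (Psi (Hmap x) (Hmap x))).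

Let mdmap : measurable_fun [set: 'rV[R]_n.+1] dmap.
Proof.
apply: continuous_measurable_rV => x.
apply: (@continuous_det _ _ _ (fun x => schur (Psi (Hmap x) (Hmap x))) x).
apply: continuous_schur; first exact: Psi0.
apply: (@continuous_comp _ _ _ Hmap (fun x => Psi x x) x); first exact: cHmap.
exact: slope_field_diag YPsi _.
Qed.

Let HmapE s v : Hmap (rVcons (s, v)) = rVcons (h v s, v).
Proof. by rewrite /Hmap rVconsK. Qed.

Local Open Scope ereal_scope.

(* [h v] inverts the first coordinate [g v] of [Y (., v)]. At a fixed value [s]
   of that coordinate the others are given by [Z s], whose slope field is the
   Schur complement of that of [Y]; the substitution [s = g v a] then restores
   the missing factor of the determinant. *)
Lemma cov_step :
  (forall (Z : 'rV[R]_n -> 'rV[R]_n) Phi, slope_field Z Phi -> (forall x y, posdef c (Phi x y)) ->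
    forall f : 'rV[R]_n -> \bar R, measurable_fun [set: 'rV[R]_n] f -> (forall x, 0 <= f x) ->
    \int[lebesgue_rV R n]_x (f (Z x) * (\det (Phi x x))%:E) = \int[lebesgue_rV R n]_x f x) ->
  forall f : 'rV[R]_n.+1 -> \bar R, measurable_fun [set: 'rV[R]_n.+1] f -> (forall x, 0 <= f x) ->
  \int[lebesgue_rV R n.+1]_x (f (Y x) * (\det (Psi x x))%:E) = \int[lebesgue_rV R n.+1]_x f x.
Proof.
move=> IH f mf f0.
have mcons s : measurable_fun [set: 'rV[R]_n] (fun v => rVcons (s, v)).
  apply: continuous_measurable_rV_rV => v.
  by apply: continuous_rVcons; [exact: for_continuous_cst|exact: for_continuous_id].
have mcons' (v : 'rV[R]_n) : measurable_fun [set: measurableTypeR R] (fun s : R => rVcons (s, v)).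
  apply/measurable_fun_rVP => i; apply: continuous_measurable_fun => s.
  apply: (@for_continuous_entry R R _ _ (fun s : R => rVcons (s, v)) s ord0 i).
  apply: continuous_rVcons; first exact: for_continuous_id.
  exact: for_continuous_cst.
have PhiP s v w : posdef c (Phi s v w) by exact: posdef_schur.
have dPhi0 s v : (0 <= \det (Phi s v v))%R by rewrite ltW//; exact: (posdef_det c0 (PhiP s v v)).
have dPsi0 x : (0 <= \det (Psi x x))%R by rewrite ltW//; exact: (posdef_det c0).
pose F x := f (Tmap x) * (dmap x)%:E.
have mF : measurable_fun [set: 'rV[R]_n.+1] F.
  apply: emeasurable_funM; last exact/measurable_EFinP.
  by apply: measurableT_comp mf _; exact: continuous_measurable_rV_rV.
have F0 x : 0 <= F x.
  apply: mule_ge0; first exact: f0.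
  by rewrite lee_fin ltW//; apply: (posdef_det c0); exact: posdef_schur.
have FE s v : F (rVcons (s, v)) = f (rVcons (s, Z s v)) * (\det (Phi s v v))%:E.
  by rewrite /F /Tmap /dmap HmapE rVcons_ord0.
transitivity (\int[lebesgue_rV R n.+1]_x F x); last first.
  rewrite [LHS](ge0_integral_rVS mF F0) [RHS](ge0_integral_rVS mf f0); apply: eq_integral => s _.
  rewrite -[RHS](IH (Z s) (Phi s) (ZPhi s) (PhiP s))//.
  - by apply: eq_integral => v _; rewrite FE.
  - exact: measurableT_comp mf (mcons s).
rewrite [RHS](ge0_integral_rVS_swap mF F0).
rewrite [LHS](ge0_integral_rVS_swap (f := fun x => f (Y x) * (\det (Psi x x))%:E)); last 2 first.
- apply: emeasurable_funM; last first.
    by apply/measurable_EFinP; exact: (measurable_slope_field_det YPsi).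
  exact: measurableT_comp mf (measurable_slope_field YPsi).
- by move=> x; rewrite mule_ge0// lee_fin.
apply: eq_integral => v _.
rewrite -[RHS](ge0_integral_slope c0 (gpsi v) (@psic v) (@cpsi v))//; last first.
  exact: measurableT_comp mF (mcons' v).
apply: eq_integral => a _; rewrite FE /Phi /Z hg det_schur//.
have -> : rVcons (g v a, rsubmx (Y (rVcons (a, v)) : 'rV[R]_(1 + n))) = Y (rVcons (a, v)).
  exact: rVunconsK.
by rewrite EFinM [LHS]muleA muleAC.
Qed.

End cov_step.

(** * The change of variables formula and its composition *)

Section conservation.
Context {R : realType}.
Local Open Scope ereal_scope.

Theorem ge0_change_of_variables n (Y : 'rV[R]_n -> 'rV[R]_n) Psi (c : R) :
  (0 < c)%R -> slope_field Y Psi -> (forall x y, posdef c (Psi x y)) ->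
  forall f : 'rV[R]_n -> \bar R, measurable_fun [set: 'rV[R]_n] f -> (forall x, 0 <= f x) ->
  \int[lebesgue_rV R n]_x (f (Y x) * (\det (Psi x x))%:E) = \int[lebesgue_rV R n]_x f x.
Proof.
move=> c0; elim: n Y Psi => [|n IH] Y Psi YP Pc f mf f0; last first.
  exact: (cov_step c0 YP Pc).
congr (integral _ _ _); apply/funext => x.
by rewrite det_mx00 mule1 [Y x]thinmx0 [in RHS](thinmx0 x).
Qed.

(** A product of positive definite matrices need not be positive definite. What passes to
    compositions is the change of variables formula itself, kept together with a slope field and the
    sign of its determinant. *)
Definition conserves n (Y : 'rV[R]_n -> 'rV[R]_n) Psi :=
  [/\ slope_field Y Psi, forall x, (0 <= \det (Psi x x))%R &
    forall f : 'rV[R]_n -> \bar R, measurable_fun [set: 'rV[R]_n] f -> (forall x, 0 <= f x) ->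
    \int[lebesgue_rV R n]_x (f (Y x) * (\det (Psi x x))%:E) = \int[lebesgue_rV R n]_x f x].

Lemma posdef_conserves n (Y : 'rV[R]_n -> 'rV[R]_n) Psi (c : R) :
  (0 < c)%R -> slope_field Y Psi -> (forall x y, posdef c (Psi x y)) -> conserves Y Psi.
Proof.
move=> c0 YP Pc; split => //; first by move=> x; rewrite ltW//; exact: (posdef_det c0).
exact: (ge0_change_of_variables c0).
Qed.

Lemma conserves_comp n (Y1 Y2 : 'rV[R]_n -> 'rV[R]_n) Psi1 Psi2 :
  conserves Y1 Psi1 -> conserves Y2 Psi2 ->
  conserves (Y2 \o Y1) (fun x y => Psi1 x y *m Psi2 (Y1 x) (Y1 y)).
Proof.
move=> [S1 d1 I1] [S2 d2 I2]; split.
- exact: slope_field_comp.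
- by move=> x; rewrite det_mulmx mulr_ge0.
- move=> f mf f0; rewrite -(I2 f)// -(I1 (fun y => f (Y2 y) * (\det (Psi2 y y))%:E)).
  + apply: eq_integral => x _; rewrite det_mulmx EFinM /= muleA.
    by rewrite muleAC.
  + apply: emeasurable_funM; last first.
    by apply/measurable_EFinP; exact: (measurable_slope_field_det S2).
    exact: measurableT_comp mf (measurable_slope_field S2).
  + by move=> x; rewrite mule_ge0// lee_fin.
Qed.

(** Provides both the scaling of Gaussian integrals and, for [c = 1], the invariance under
    translation. *)
Lemma conserves_affine n (x0 : 'rV[R]_n) (c : R) : (0 < c)%R ->
  conserves (fun z => x0 + c *: z)%R (fun _ _ => c%:M).
Proof.
move=> c0; apply: (posdef_conserves c0).
  split => [x y|p]; last exact: for_continuous_cst.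
  by rewrite mul_mx_scalar opprD addrACA subrr add0r scalerBr.
move=> x y v; by rewrite mul_mx_scalar -scalemxAl [leRHS]mxE.
Qed.

(** Integrability comes from the formula for the absolute value of [f], the equality from its
    positive and negative parts. A nonnegative determinant can be moved in and out of these
    parts. *)
Lemma conserves_integral n (Y : 'rV[R]_n -> 'rV[R]_n) Psi (f : 'rV[R]_n -> R) :
  conserves Y Psi -> (lebesgue_rV R n).-integrable setT (EFin \o f) ->
  (lebesgue_rV R n).-integrable setT (fun x => (f (Y x) * \det (Psi x x))%:E) /\
  \int[lebesgue_rV R n]_x (f (Y x) * \det (Psi x x))%:E = \int[lebesgue_rV R n]_x (f x)%:E.
Proof.
move=> [S d I] /integrableP[mf fi].
have mfY : measurable_fun [set: 'rV[R]_n] (fun x => (f (Y x) * \det (Psi x x))%:E).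
  under eq_fun do rewrite EFinM.
  apply: emeasurable_funM; last first.
    by apply/measurable_EFinP; exact: (measurable_slope_field_det S).
  exact: measurableT_comp mf (measurable_slope_field S).
split.
  apply/integrableP; split => //.
  under eq_integral do rewrite EFinM abseM (gee0_abs (x := (\det _)%:E)) ?lee_fin//.
  by rewrite (I (fun y => `|(f y)%:E|))//; exact: measurableT_comp.
rewrite [LHS]integralE [RHS]integralE; congr (_ - _).
  rewrite -[RHS]I//; last exact: measurable_funepos.
  apply: eq_integral => x _; rewrite !funeposE /= EFinM maxe_pMl ?lee_fin//.
  by rewrite mul0e.
rewrite -[RHS]I//; last exact: measurable_funeneg.
apply: eq_integral => x _; rewrite !funenegE /= -mulNr EFinM maxe_pMl ?lee_fin//.
by rewrite mul0e.
Qed.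

End conservation.

(** The remainder of the linear approximation is [h *m (Psi x (h + x) - Psi x x)], which is o(h) by
    continuity of [Psi]. *)
Lemma slope_field_jacobian {R : realType} n (Y : 'rV[R]_n -> 'rV[R]_n) Psi x :
  slope_field Y Psi -> 'J Y x = Psi x x.
Proof.
move=> [YP cP]; pose df : {linear 'rV[R]_n -> 'rV[R]_n} := mulmxr (Psi x x).
have dfE : 'd Y x = df :> ('rV[R]_n -> 'rV[R]_n).
  apply: diff_unique.
    move=> v; apply: continuous_mulmx; first exact: for_continuous_id.
    exact: for_continuous_cst.
  apply/eqaddoP => _ /posnumP[e].
  (* The divisor absorbs the factor [n] of [mx_norm_mul] and stays positive for [n = 0]. *)
  have n0 : 0 < e%:num / (n%:R + 1) :> R by rewrite divr_gt0// ltr_wpDl.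
  have cPx : {for 0, continuous (fun h => Psi x (h + x))}.
    apply: (for_continuous_comp2 (h := fun p => Psi p.1 p.2)); last exact: cP.
      exact: for_continuous_cst.
    by apply: continuousD; [exact: for_continuous_id|exact: for_continuous_cst].
  have /cvgrPdist_le/(_ _ n0) := cPx.
  apply: filterS => h; rewrite /= add0r => hP.
  have -> : ((Y \o shift x) - (cst (Y x) + df)) h = h *m (Psi x (h + x) - Psi x x).
    rewrite mulmxBr -[X in X *m Psi x (h + x)](addrK x) -YP /=.
    by rewrite fctE /= opprD addrA.
  rewrite (le_trans (mx_norm_mul _ _))// mulrCA mulrC ler_wpM2r//.
  rewrite distrC (le_trans (ler_wpM2l _ hP))//.
  by rewrite mulrCA ger_pMr// ler_pdivrMr ?mul1r ?lerDl// ltr_wpDl.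
apply/row_matrixP => i; rewrite [LHS]rowE [LHS]mul_rV_lin1 dfE /= -rowE.
by [].
Qed.

(** * Slope fields from the parallelogram estimate *)

Section difference_quotient.
Context {R : realType} {n : nat}.
Variables (Y : 'rV[R]_n -> 'rV[R]_n) (L K : R) (e : 'rV[R]_n).
Hypotheses (L0 : 0 <= L) (K0 : 0 <= K) (e1 : `|e| = 1).
Hypothesis YL : forall x y, `|Y x - Y y| <= L * `|x - y|.
Hypothesis YK : forall x v w,
  `|Y (x + v + w) - Y (x + v) - Y (x + w) + Y x| <= K * (`|v| * Num.sqrt `|w|).

Definition diffq (x : 'rV[R]_n) (h : R) : 'rV[R]_n := h^-1 *: (Y (x + h *: e) - Y x).

Let norm_e h : `|h *: e| = `|h|. Proof. by rewrite normrZ e1 mulr1. Qed.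

Lemma diffqE x h : h != 0 -> Y (x + h *: e) - Y x = h *: diffq x h.
Proof. by move=> h0; rewrite scalerA mulfV// scale1r. Qed.

Lemma diffq_le x h : h != 0 -> `|diffq x h| <= L.
Proof.
move=> h0; rewrite normrZ normfV ler_pdivrMl ?normr_gt0// mulrC.
by rewrite (le_trans (YL _ _))// addrC addKr norm_e.
Qed.

(** The parallelogram with sides [h *: e] and [x - y] is [h] times the difference of the two
    quotients. As [YK] is of degree one in [v], the step [h] cancels. *)
Lemma diffq_holder x y h : h != 0 -> `|diffq x h - diffq y h| <= K * Num.sqrt `|x - y|.
Proof.
move=> h0; rewrite -scalerBr normrZ normfV ler_pdivrMl ?normr_gt0//.
have := YK y (h *: e) (x - y).
rewrite norm_e mulrCA; apply: le_trans; rewrite le_eqVlt; apply/orP; left; apply/eqP.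
congr (`|_|).
have -> : y + h *: e + (x - y) = x + h *: e by rewrite addrC addrA subrK.
have -> : y + (x - y) = x by rewrite addrC subrK.
by apply/rowP => j; rewrite !mxE; ring.
Qed.

Lemma diffqN x h : diffq x (- h) = diffq (x - h *: e) h.
Proof. by rewrite /diffq invrN !scaleNr subrK -scalerN opprB. Qed.

(** The increment over [m] steps telescopes into quotients with step [k], taken at points within [H]
    of [x]. By [diffq_holder] each differs from [diffq x k] by at most [K * Num.sqrt H]. *)
Lemma diffq_mul x k (m : nat) (H : R) : 0 < k -> m%:R * k <= H ->
  `|Y (x + (m%:R * k) *: e) - Y x - (m%:R * k) *: diffq x k| <= m%:R * k * (K * Num.sqrt H).
Proof.
move=> k0; elim: m => [|m IH] mH.
  by rewrite !mul0r !scale0r addr0 subrr subr0 normr0.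
have mkH : m%:R * k <= H.
  by apply: le_trans mH; rewrite ler_wpM2r ?(ltW k0)// ler_nat.
have := IH mkH => {}IH.
rewrite -natr1 !mulrDl mul1r scalerDl addrA scalerDl.
set z := x + (m%:R * k) *: e in IH *.
have -> : Y (z + k *: e) - Y x - ((m%:R * k) *: diffq x k + k *: diffq x k) =
  (Y z - Y x - (m%:R * k) *: diffq x k) + k *: (diffq z k - diffq x k).
  rewrite scalerBr -(diffqE z) ?gt_eqF//.
  by apply/rowP => j; rewrite !mxE; ring.
rewrite (le_trans (ler_normD _ _))// lerD//.
rewrite normrZ gtr0_norm// ler_pM2l// (le_trans (diffq_holder _ _ _)) ?gt_eqF//.
rewrite ler_wpM2l// ler_wsqrtr// /z addrC addKr norm_e.
by rewrite ger0_norm// mulr_ge0// ltW.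
Qed.

(** Rounding [H] down to a multiple of [k] leaves a rest of at most [k], over which [Y] and its
    linear approximation each move by at most [L * k]. This accounts for the second term. *)
Lemma diffq_cauchy x k H : 0 < k -> k <= H ->
  `|diffq x H - diffq x k| <= K * Num.sqrt H + 2 * L * k / H.
Proof.
move=> k0 kH; have H0 : 0 < H by apply: lt_le_trans kH.
pose m := Num.truncn (H / k).
have /andP[mH Hm] : m%:R * k <= H < (m%:R + 1) * k.
  rewrite -ler_pdivlMr// -ltr_pdivrMr// natr1.
  by apply: truncn_itv; rewrite divr_ge0// ltW.
have Hd : `|H *: (diffq x H - diffq x k)| <= H * (K * Num.sqrt H) + 2 * L * k.
  rewrite scalerBr -diffqE ?gt_eqF//.
  set z := m%:R * k in mH.
  have -> : Y (x + H *: e) - Y x - H *: diffq x k =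
    (Y (x + z *: e) - Y x - z *: diffq x k) +
    ((Y (x + H *: e) - Y (x + z *: e)) - (H - z) *: diffq x k).
    by apply/rowP => j; rewrite !mxE; ring.
  rewrite (le_trans (ler_normD _ _))//; apply: lerD.
    rewrite (le_trans (diffq_mul x k0 mH))// ler_wpM2r// mulr_ge0//.
  have Hz : `|H - z| <= k.
    by rewrite ger0_norm ?subr_ge0// lerBlDl; move: Hm; rewrite mulrDl mul1r => /ltW.
  rewrite (le_trans (ler_normB _ _))// -mulrA mulr_natl mulr2n; apply: lerD.
    rewrite (le_trans (YL _ _))// ler_wpM2l// opprD addrACA subrr add0r -scalerBl.
    by rewrite norm_e.
  by rewrite normrZ mulrC ler_pM// diffq_le// gt_eqF.
rewrite -(ler_pM2l H0).
have -> : H * (K * Num.sqrt H + 2 * L * k / H) = H * (K * Num.sqrt H) + 2 * L * k.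
  by field; rewrite gt_eqF.
by move: Hd; rewrite normrZ gtr0_norm.
Qed.

(* [diffq_mul] compares the steps [k] and [m k], so that the quotients are Cauchy
   as the step tends to 0 from above; [diffqN] covers negative steps. *)
Lemma diffq_lim x : exists l : 'rV[R]_n, forall h, h != 0 ->
  `|diffq x h - l| <= 2 * K * Num.sqrt `|h|.
Proof.
have sqrt_small (a : R) : 0 < a -> exists2 H, 0 < H & K * Num.sqrt H <= a.
  move=> a0; exists ((a / (K + 1)) ^+ 2); first by rewrite exprn_gt0// divr_gt0// ltr_wpDl.
  rewrite sqrtr_sqr ger0_norm ?divr_ge0 ?addr_ge0 ?(ltW a0)// mulrCA ger_pMr//.
  by rewrite ler_pdivrMr ?ltr_wpDl// mul1r lerDl.
have near_small (a b : R) : 0 < b -> \forall k \near 0^'+, a * k <= b.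
  move=> b0; have k0 : 0 < b / (`|a| + 1) by rewrite divr_gt0// ltr_wpDl.
  near=> k.
  have kp : 0 < k by near: k; exact: nbhs_right_gt.
  have kb : k <= b / (`|a| + 1) by near: k; exact: nbhs_right_le.
  rewrite (le_trans (ler_wpM2r (ltW kp) (ler_norm a)))//.
  rewrite (le_trans (ler_wpM2l _ kb))// mulrCA ger_pMr//.
  by rewrite ler_pdivrMr ?ltr_wpDl// mul1r lerDl.
have /cauchy_cvgP/cvg_ex[l Hl] : cauchy (diffq x k @[k --> 0^'+]).
  apply/cauchyP => _/posnumP[a].
  have a20 : 0 < a%:num / 2 / 2 :> R by [].
  have [H H0 HK] := sqrt_small _ a20.
  exists (diffq x H).
  suff : \forall k \near 0^'+, ball (diffq x H) a%:num (diffq x k) by [].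
  near=> k; rewrite -ball_normE /ball_ /=.
  have k0 : 0 < k by near: k; exact: nbhs_right_gt.
  have kH : k <= H by near: k; exact: nbhs_right_le.
  rewrite (le_lt_trans (diffq_cauchy x k0 kH))//.
  have : (2 * L / H) * k <= a%:num / 2 / 2 by near: k; exact: near_small.
  have := HK; have := gt0 a; rewrite (_ : 2 * L * k / H = 2 * L / H * k); last by rewrite mulrAC.
  by lra.
have Hpos h : 0 < h -> `|diffq x h - l| <= K * Num.sqrt h.
  move=> h0; apply/ler_addgt0Pr => a a0.
  have a20 : 0 < a / 2 by rewrite divr_gt0.
  have : \forall k \near (0 : R)^'+, `|diffq x h - l| <= K * Num.sqrt h + a.
    near=> k.
    have k0 : 0 < k by near: k; exact: nbhs_right_gt.
    have kh : k <= h by near: k; exact: nbhs_right_le.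
    have H1 : (2 * L / h) * k <= a / 2 by near: k; exact: near_small.
    have H2 : `|l - diffq x k| <= a / 2 by near: k; move/cvgrPdist_le : Hl => /(_ _ a20).
    have := ler_distD (diffq x k) (diffq x h) l; move/le_trans; apply.
    have := diffq_cauchy x k0 kh; rewrite (_ : 2 * L * k / h = 2 * L / h * k); last by rewrite mulrAC.
    by rewrite (distrC _ l); lra.
  by move=> /filter_ex[].
exists l => h h0; have [h_gt0|h_lt0|h00] := ltgtP 0 h; last by rewrite -h00 eqxx in h0.
  rewrite gtr0_norm// (le_trans (Hpos _ h_gt0))// -mulrA ler_peMl ?ler1n//.
  by rewrite mulr_ge0.
have Nh0 : 0 < - h by rewrite oppr_gt0.
rewrite ltr0_norm// -(opprK h) diffqN.
set h' := - h in Nh0 *; rewrite opprK.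
rewrite (le_trans (ler_distD (diffq x h') _ _))// -mulrA mulr_natl mulr2n lerD//; last exact: Hpos.
rewrite (le_trans (diffq_holder _ _ _)) ?gt_eqF//.
by rewrite addrC addKr normrN norm_e gtr0_norm.
Unshelve. all: by end_near. Qed.

End difference_quotient.

Section parallelogram_slope.
Context {R : realType} {n : nat}.
Variables (Y : 'rV[R]_n -> 'rV[R]_n) (L K : R).
Hypotheses (L0 : 0 <= L) (K0 : 0 <= K).
Hypothesis YL : forall x y, `|Y x - Y y| <= L * `|x - y|.
Hypothesis YK : forall x v w,
  `|Y (x + v + w) - Y (x + v) - Y (x + w) + Y x| <= K * (`|v| * Num.sqrt `|w|).

Let e (i : 'I_n) : 'rV[R]_n := delta_mx ord0 i.

Lemma norm_delta_rV i : `|e i| = 1.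
Proof.
apply/eqP; rewrite eq_le; apply/andP; split.
  apply: mx_norm_le => // a j; rewrite mxE !ord1 eqxx /=.
  by case: eqP => _; rewrite ?normr1 ?normr0.
by have := mx_norm_entry (e i) ord0 i; rewrite mxE !eqxx normr1.
Qed.

Lemma partial_slopes : {D : 'I_n -> 'rV[R]_n -> 'rV[R]_n | forall i x h, h != 0 ->
  `|diffq Y (e i) x h - D i x| <= 2 * K * Num.sqrt `|h|}.
Proof.
apply: cid.
have H (p : 'I_n * 'rV[R]_n) : exists l : 'rV[R]_n, forall h, h != 0 ->
    `|diffq Y (e p.1) p.2 h - l| <= 2 * K * Num.sqrt `|h|.
  exact: diffq_lim L0 K0 (norm_delta_rV p.1) YL YK p.2.
by have [D HD] := choice H; exists (fun i x => D (i, x)) => i x; exact: (HD (i, x)).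
Qed.

Let D := sval partial_slopes.
Let DP : forall i x h, h != 0 -> `|diffq Y (e i) x h - D i x| <= 2 * K * Num.sqrt `|h|
  := svalP partial_slopes.

Definition slope i (x : 'rV[R]_n) (h : R) := if h == 0 then D i x else diffq Y (e i) x h.

Let slopeE i x h : Y (x + h *: e i) - Y x = h *: slope i x h.
Proof.
rewrite /slope; case: eqP => [->|/eqP h0]; first by rewrite !scale0r addr0 subrr.
exact: diffqE.
Qed.

Let slope0 i x h : `|slope i x h - slope i x 0| <= 2 * K * Num.sqrt `|h|.
Proof.
rewrite /slope eqxx; case: eqP => [->|/eqP h0]; last exact: DP.
by rewrite subrr normr0 mulr_ge0// mulr_ge0.
Qed.

Let sqrt_small (a : R) : 0 < a -> exists2 H, 0 < H & 2 * K * Num.sqrt `|H| <= a.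
Proof.
move=> a0; exists ((a / (2 * K + 1)) ^+ 2).
  by rewrite exprn_gt0// divr_gt0// ltr_wpDl// mulr_ge0.
rewrite normrX -normrX ger0_norm ?sqr_ge0// sqrtr_sqr.
have K1 : 0 < 2 * K + 1 by rewrite ltr_wpDl// mulr_ge0.
rewrite ger0_norm ?divr_ge0 ?(ltW K1) ?(ltW a0)// mulrCA ger_pMr//.
by rewrite ler_pdivrMr// mul1r lerDl.
Qed.

Let slope_lim i x (b : R) (z : 'rV[R]_n) :
  (forall h, h != 0 -> `|slope i x h - z| <= b) -> `|slope i x 0 - z| <= b.
Proof.
move=> hb; apply/ler_addgt0Pr => a a0; have [H H0 HK] := sqrt_small a0.
rewrite (le_trans (ler_distD (slope i x H) _ _))// addrC lerD ?hb ?gt_eqF//.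
by rewrite distrC (le_trans (slope0 _ _ _)).
Qed.

Let slope_holder i x y h : `|slope i x h - slope i y h| <= K * Num.sqrt `|x - y|.
Proof.
have hol h' : h' != 0 -> `|slope i x h' - slope i y h'| <= K * Num.sqrt `|x - y|.
  move=> h0; rewrite /slope (negbTE h0).
  exact: diffq_holder (norm_delta_rV i) YK _ _ _ h0.
have [->|h0] := eqVneq h 0; last exact: hol.
apply/ler_addgt0Pr => a a0; have a20 : 0 < a / 2 by rewrite divr_gt0.
have [H H0 HK] := sqrt_small a20.
have -> : slope i x 0 - slope i y 0 = (slope i x H - slope i y H) -
    (slope i x H - slope i x 0) + (slope i y H - slope i y 0).
  by apply/rowP => j; rewrite !mxE; ring.
rewrite (le_trans (ler_normD _ _))// (splitr a) addrA lerD//; last first.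
  exact: le_trans (slope0 _ _ _) HK.
rewrite (le_trans (ler_normB _ _))// lerD//; first by apply: hol; rewrite gt_eqF.
exact: le_trans (slope0 _ _ _) HK.
Qed.

Let Y_continuous : continuous Y.
Proof.
suff H (x : 'rV[R]_n) : Y y @[y --> x] --> Y x by exact: H.
apply/(@cvgrPdist_le R 'rV[R]_n 'rV[R]_n (nbhs x) _ Y (Y x)) => a a0.
have aL : 0 < a / (L + 1) by rewrite divr_gt0// ltr_wpDl.
near=> y; rewrite (le_trans (YL _ _))//.
have : `|x - y| <= a / (L + 1) by near: y; apply: cvgr_dist_le => //; exact: cvg_id.
move=> /(ler_wpM2l L0)/le_trans; apply.
by rewrite mulrCA ger_pMr// ler_pdivrMr ?ltr_wpDl// mul1r lerDl.
Unshelve. all: by end_near. Qed.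

Let sqrt_near0 (x : 'rV[R]_n) (C a : R) : 0 < a -> \forall y \near x, C * Num.sqrt `|y - x| <= a.
Proof.
move=> a0; have : {for x, continuous (fun y : 'rV[R]_n => C * Num.sqrt `|y - x|)}.
  apply: continuousM; first exact: for_continuous_cst.
  apply: (@continuous_comp _ _ _ (fun y : 'rV[R]_n => `|y - x|) (@Num.sqrt R) x); last exact: sqrt_continuous.
  apply: (@continuous_comp _ _ _ (fun y : 'rV[R]_n => y - x) Num.norm x); last exact: norm_continuous.
  by apply: continuousB; [exact: for_continuous_id|exact: for_continuous_cst].
rewrite /prop_for /continuous_at subrr normr0 sqrtr0 mulr0 => /cvgrPdist_le/(_ _ a0).
by apply: filterS => y; rewrite sub0r normrN; apply: le_trans; exact: ler_norm.
Qed.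

Let slope_continuous_h i x : continuous (slope i x).
Proof.
suff H (h : R) : {for h, continuous (slope i x)} by move=> h; exact: H.
have [->|h0] := eqVneq h 0.
  apply/(@cvgrPdist_le R 'rV[R]_n R (nbhs (0 : R)) _ (slope i x)) => a a0.
  have : {for 0, continuous (fun k : R => 2 * K * Num.sqrt `|k|)}.
    apply: continuousM; first exact: for_continuous_cst.
    apply: (@continuous_comp _ _ _ (fun k : R => `|k|) (@Num.sqrt R) 0); last exact: sqrt_continuous.
    exact: norm_continuous.
  rewrite /prop_for /continuous_at normr0 sqrtr0 mulr0 => /cvgrPdist_le/(_ _ a0).
  apply: filterS => k; rewrite sub0r normrN distrC => H.
  by rewrite (le_trans (slope0 _ _ _))// (le_trans _ H)// ler_norm.
have cq : {for h, continuous (diffq Y (e i) x)}.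
  apply: continuousZ; first exact: cvgV.
  apply: continuousB; last exact: for_continuous_cst.
  apply: (@continuous_comp _ _ _ (fun k : R => x + k *: e i) Y h); last exact: Y_continuous.
  apply: continuousD; first exact: for_continuous_cst.
  by apply: continuousZ; [exact: for_continuous_id|exact: for_continuous_cst].
have E : diffq Y (e i) x h = slope i x h by rewrite /slope (negbTE h0).
rewrite /prop_for /continuous_at -E.
apply: cvg_trans cq; apply: near_eq_cvg; near=> k.
have k0 : k != 0 by near: k; exact: (@cvgr_neq0 _ R^o _ (nbhs h) _ id h).
by rewrite /slope (negbTE k0).
Unshelve. all: by end_near. Qed.

(** The Hölder bound in [x] is uniform in [h], so continuity in [h] at the fixed base point [x] is
    enough. *)
Lemma slope_continuous2 i : continuous (fun p : 'rV[R]_n * R => slope i p.1 p.2).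
Proof.
move=> [x h]; apply/cvgrPdist_le => a a0.
have a20 : 0 < a / 2 by rewrite divr_gt0.
have H1 : \forall p \near (x, h), K * Num.sqrt `|p.1 - x| <= a / 2.
  exact: (cvg_fst (F := nbhs x) (G := nbhs h) (sqrt_near0 x K a20)).
have H2 : \forall p \near (x, h), `|slope i x h - slope i x p.2| <= a / 2.
  have /cvgrPdist_le/(_ _ a20) := @slope_continuous_h i x h.
  exact: (cvg_snd (F := nbhs x) (G := nbhs h)).
apply: filterS2 H1 H2 => -[y k] /= H1 H2.
rewrite (le_trans (ler_distD (slope i x k) _ _))// [leRHS](splitr a) lerD//.
by rewrite (le_trans (slope_holder _ _ _ _))// distrC.
Qed.

(** The hybrids form a path from [x] to [y] parallel to the axes. Along it [Y y - Y x] telescopes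
    into increments in one coordinate, and the [i]-th quotient becomes row [i] of [hybrid_slope]. *)
Definition hybrid (k : nat) (x y : 'rV[R]_n) : 'rV[R]_n :=
  \row_j (if (j < k)%N then y ord0 j else x ord0 j).

Definition hybrid_slope (x y : 'rV[R]_n) : 'M[R]_n :=
  \matrix_(i, j) slope i (hybrid i x y) (y ord0 i - x ord0 i) ord0 j.

Let hybridS (i : 'I_n) x y : hybrid i.+1 x y = hybrid i x y + (y ord0 i - x ord0 i) *: e i.
Proof.
apply/rowP => j; rewrite !mxE eqxx /= ltnS leq_eqVlt.
have [->|ji] := eqVneq j i; first by rewrite eqxx ltnn /= mulr1 addrC subrK.
by rewrite (inj_eq val_inj) (negbTE ji) /= mulr0 addr0.
Qed.

Let continuous_hybrid k : continuous (fun p : 'rV[R]_n * 'rV[R]_n => hybrid k p.1 p.2).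
Proof.
move=> p; apply: continuous_mx_entries => a j.
have -> : (fun p : 'rV[R]_n * 'rV[R]_n => hybrid k p.1 p.2 a j) =
    fun p => if (j < k)%N then p.2 ord0 j else p.1 ord0 j.
  by apply/funext => q; rewrite mxE.
by case: (j < k)%N; apply: for_continuous_entry; [exact: cvg_snd|exact: cvg_fst].
Qed.

Lemma hybrid_slope_field : slope_field Y hybrid_slope.
Proof.
split => [x y|p].
  have -> : Y y - Y x = \sum_(i < n) (Y (hybrid i.+1 x y) - Y (hybrid i x y)).
    rewrite -(big_mkord xpredT (fun i => Y (hybrid i.+1 x y) - Y (hybrid i x y))).
    rewrite telescope_sumr//; congr (Y _ - Y _); apply/rowP => j; rewrite mxE //.
    by rewrite ltn_ord.
  apply/rowP => j; rewrite summxE mxE; apply: eq_bigr => i _.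
  by rewrite hybridS slopeE !mxE.
apply: continuous_mx_entries => i j.
have -> : (fun p : 'rV[R]_n * 'rV[R]_n => hybrid_slope p.1 p.2 i j) =
    fun p => slope i (hybrid i p.1 p.2) (p.2 ord0 i - p.1 ord0 i) ord0 j.
  by apply/funext => q; rewrite mxE.
apply: for_continuous_entry.
apply: (for_continuous_comp2 (h := fun p => slope i p.1 p.2)); last exact: slope_continuous2.
  exact: continuous_hybrid.
by apply: continuousB; apply: for_continuous_entry; [exact: cvg_snd|exact: cvg_fst].
Qed.

Variable delta : R.
Hypothesis Yid : forall x y, `|Y x - Y y - (x - y)| <= delta * `|x - y|.

(** For a nonzero step this is [Yid] along an axis, divided by the step. The bound passes to the
    limit at step 0. *)
Lemma hybrid_slope_id x y i j : `|hybrid_slope x y i j - (i == j)%:R| <= delta.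
Proof.
rewrite mxE; set z := hybrid _ _ _; set h := y ord0 i - x ord0 i.
suff H k : `|slope i z k - e i| <= delta.
  rewrite (le_trans _ (H h))//; have := mx_norm_entry (slope i z h - e i) ord0 j.
  by rewrite [(slope i z h - e i) _ _]mxE [(- e i) _ _]mxE [e i _ _]mxE eqxx /= eq_sym.
have Hk k' : k' != 0 -> `|slope i z k' - e i| <= delta.
  move=> k0; have k'0 : 0 < `|k'| by rewrite normr_gt0.
  rewrite -(ler_pM2l k'0) -normrZ scalerBr -slopeE.
  have := Yid (z + k' *: e i) z; rewrite [z + _ - z]addrC addKr normrZ norm_delta_rV mulr1.
  by rewrite mulrC.
have [->|] := eqVneq k 0; last exact: Hk.
exact: slope_lim.
Qed.

(** The entries of [P - 1] are at most [delta], and |v_i v_j| is at most (v_i^2 + v_j^2) / 2, so the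
    form of [P - 1] is at most [n%:R * delta] times the squared norm. Half of the identity is
    left. *)
Lemma near_identity_posdef x y : n%:R * delta <= 1 / 2 -> posdef (1 / 2) (hybrid_slope x y).
Proof.
move=> nd v; set P := hybrid_slope x y.
have vv : (v *m v^T) ord0 ord0 = \sum_i v ord0 i ^+ 2.
  by rewrite mxE; apply: eq_bigr => i _; rewrite mxE expr2.
have -> : (v *m P *m v^T) ord0 ord0 =
    (v *m v^T) ord0 ord0 + \sum_j \sum_i v ord0 i * (P i j - (i == j)%:R) * v ord0 j.
  rewrite !mxE -big_split /=; apply: eq_bigr => j _; rewrite !mxE.
  rewrite mulr_suml -[v ord0 j in X in _ = X + _]mulr1.
  have -> : \sum_i v ord0 i * P i j * v ord0 j = \sum_i
      (v ord0 i * (P i j - (i == j)%:R) * v ord0 j + v ord0 i * (i == j)%:R * v ord0 j).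
    by apply: eq_bigr => i _; rewrite -mulrDl -mulrDr subrK.
  rewrite big_split /= addrC; congr (_ + _).
  rewrite (bigD1 j)//= eqxx mulr1 big1 ?addr0 ?mulr1// => i /negbTE ->.
  by rewrite mulr0 mul0r.
rewrite vv; set s := \sum_i v ord0 i ^+ 2.
have s0 : 0 <= s by apply: sumr_ge0 => i _; exact: sqr_ge0.
suff : `|\sum_j \sum_i v ord0 i * (P i j - (i == j)%:R) * v ord0 j| <= n%:R * delta * s.
  rewrite ler_norml => /andP[+ _]; have := ler_wpM2r s0 nd.
  by move: (n%:R * delta * s) (\sum_j _) => a b; lra.
rewrite (le_trans (ler_norm_sum _ _ _))//.
have -> : n%:R * delta * s = \sum_(j < n) \sum_(i < n) delta * ((v ord0 i ^+ 2 + v ord0 j ^+ 2) / 2).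
  under eq_bigr do rewrite -mulr_sumr -mulr_suml big_split /= -/s sumr_const card_ord.
  rewrite -mulr_sumr -mulr_suml big_split /= sumr_const card_ord.
  under [X in _ + X]eq_bigr do rewrite -mulr_natl.
  by rewrite -mulr_sumr -/s -mulr_natl; field.
apply: ler_sum => j _; rewrite (le_trans (ler_norm_sum _ _ _))//; apply: ler_sum => i _.
rewrite normrM normrM mulrAC mulrC ler_pM//; first exact: hybrid_slope_id.
have := sqr_ge0 (`|v ord0 i| - `|v ord0 j|); rewrite -(real_normK (num_real (v ord0 i))).
rewrite -(real_normK (num_real (v ord0 j))); move: (`|v ord0 i|) (`|v ord0 j|) => a b.
by rewrite !expr2; nra.
Qed.

Lemma parallelogram_conserves : n%:R * delta <= 1 / 2 -> conserves Y hybrid_slope.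
Proof.
move=> nd; apply: (@posdef_conserves _ _ _ _ (1 / 2)) => //; first exact: hybrid_slope_field.
by move=> x y; exact: near_identity_posdef.
Qed.

End parallelogram_slope.

(** * Flow of a vector field with integrable bounds *)

Section derivative_facts.
Context {R : realType}.

Lemma is_derive_cvg (V : normedModType R) (f : R -> V) (x : R) (l : V) :
  is_derive x 1 f l -> h^-1 *: (f (h *: 1 + x) - f x) @[h --> (0 : R)^'] --> l.
Proof. by move=> [df <-]; exact: df. Qed.

Lemma cvg_is_derive (V : normedModType R) (f : R -> V) (x : R) (l : V) :
  h^-1 *: (f (h *: 1 + x) - f x) @[h --> (0 : R)^'] --> l -> is_derive x 1 f l.
Proof.
move=> fl; apply: DeriveDef; first by apply/cvg_ex; exists l.
exact: cvg_lim fl.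
Qed.

Lemma is_derive_entry n (S : R -> 'rV[R]_n) (s : R) (dS : 'rV[R]_n) i :
  is_derive s 1 S dS -> is_derive s 1 (fun r => S r ord0 i) (dS ord0 i).
Proof.
move=> /is_derive_cvg HS; apply: cvg_is_derive.
have := @cvg_comp _ _ _ _ (fun M : 'rV[R]_n => M ord0 i) _ _ _ HS (@coord_continuous _ _ _ ord0 i dS).
apply: cvg_trans; apply: near_eq_cvg; near=> h.
by rewrite /= !mxE.
Unshelve. all: by end_near. Qed.

Lemma is_derive_le (m m' : R -> R) (a b : R) : {within `[a, b], continuous m} ->
  (forall s, a < s < b -> is_derive s 1 m (m' s)) -> (forall s, a < s < b -> 0 <= m' s) ->
  forall x y, a <= x -> x <= y -> y <= b -> m x <= m y.
Proof.
move=> cm dm m0 x y ax xy yb; apply: (@ger0_derive1_le_cc R m a b) => //.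
- by move=> s; rewrite in_itv /= => /dm[].
- by move=> s; rewrite in_itv /= => sab; rewrite derive1E; have [_ ->] := dm s sab; exact: m0.
- by rewrite in_itv /= ax (le_trans xy).
- by rewrite in_itv /= yb (le_trans ax).
Qed.

End derivative_facts.

Section sum_of_squares.
Context {R : realType}.

(** The squared Euclidean norm. It is differentiable, unlike the sup norm, so Gronwall's argument
    runs on it and is translated back at a cost depending on [n]. *)
Definition sumsq n (z : 'rV[R]_n) : R := \sum_i z ord0 i ^+ 2.

Lemma sumsq_ge0 n (z : 'rV[R]_n) : 0 <= sumsq z.
Proof. by apply: sumr_ge0 => i _; exact: sqr_ge0. Qed.

Lemma continuous_sumsq n : continuous (@sumsq n).
Proof.
apply: (@continuous_big R 'I_n +%R 0 xpredT); first exact: add_continuous.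
move=> i _ v; apply: (@continuousM _ _ (fun v : 'rV[R]_n => v ord0 i) (fun v => v ord0 i)).
  exact: coord_continuous.
exact: coord_continuous.
Qed.

End sum_of_squares.

(** * Gronwall's lemma, backward in time *)

Section gronwall.
Context {R : realType} {n : nat}.
Variables (b b' : R -> R) (B T : R).
Hypotheses (cb : continuous b) (db : forall s : R, 0 < s -> is_derive s 1 b (b' s))
  (b'0 : forall s : R, 0 < s -> 0 <= b' s) (b0 : forall s, 0 <= b s)
  (bB : forall s, s <= T -> b s <= B).

Definition gronwall_const := Num.sqrt (n.+1%:R * expR (4 * n%:R * B)).

Lemma gronwall_const_ge0 : 0 <= gronwall_const. Proof. exact: sqrtr_ge0. Qed.

Let norm_sumsq (v : 'rV[R]_n) : `|v| ^+ 2 <= sumsq v.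
Proof.
have s0 : 0 <= sumsq v by apply: sumr_ge0 => i _; exact: sqr_ge0.
rewrite -[leRHS]sqr_sqrtr// ler_sqr ?nnegrE ?sqrtr_ge0//.
apply: mx_norm_le => [|i j]; first exact: sqrtr_ge0.
rewrite ord1 -sqrtr_sqr ler_sqrt// /sumsq (bigD1 j)//= lerDl.
by apply: sumr_ge0 => k _; exact: sqr_ge0.
Qed.

Let sumsq_norm (v : 'rV[R]_n) : sumsq v <= n%:R * `|v| ^+ 2.
Proof.
have -> : n%:R * `|v| ^+ 2 = \sum_(i < n) `|v| ^+ 2 by rewrite sumr_const card_ord mulr_natl.
apply: ler_sum => i _; rewrite -[leLHS]real_normK ?num_real//.
by rewrite ler_sqr ?nnegrE// mx_norm_entry.
Qed.

(* [(sumsq (S r) + e ^+ 2) * expR (4 * n%:R * b r)] is nondecreasing in [r]. *)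
Lemma gronwall (S S' : R -> 'rV[R]_n) (t e : R) : 0 < t <= T -> 0 <= e ->
  {within `[0, t], continuous S} ->
  (forall s, 0 < s < t -> is_derive s 1 S (S' s)) ->
  (forall s, 0 < s < t -> `|S' s| <= b' s * (`|S s| + e)) ->
  forall r, 0 <= r <= t -> `|S r| <= gronwall_const * (`|S t| + e).
Proof.
move=> /andP[t0 tT] e0 cS dS S'b r /andP[r0 rt].
pose d r := sumsq (S r) + e ^+ 2.
pose m r := d r * expR (4 * n%:R * b r).
pose m' s := d s * (expR (4 * n%:R * b s) * (4 * n%:R * b' s)) +
  expR (4 * n%:R * b s) * (\sum_i (2 * S s ord0 i * S' s ord0 i)).
have e20 : 0 <= e ^+ 2 by exact: sqr_ge0.
have cm : {within `[0, t], continuous m}.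
  have cd : {within `[0, t], continuous d}.
    apply: (@within_continuous_comp _ _ _ _ S (fun v => sumsq v + e ^+ 2)); last exact: cS.
    move=> v _; apply: continuousD; last exact: for_continuous_cst.
    exact: continuous_sumsq.
  have ce : {within `[0, t], continuous (fun r => expR (4 * n%:R * b r))}.
    apply: continuous_subspaceT => x.
    apply: (@continuous_comp _ _ _ (fun r => 4 * n%:R * b r) expR x); last exact: continuous_expR.
    by apply: continuousM; [exact: for_continuous_cst|exact: cb].
  by move=> x; apply: (@continuousM R (subspace `[0, t]) d _ x); [exact: cd|exact: ce].
have dm s : 0 < s < t -> is_derive s 1 m (m' s).
  move=> /[dup] s0t /andP[s0 st].
  have dd : is_derive s 1 d (\sum_i (2 * S s ord0 i * S' s ord0 i)).
    have -> : d = \sum_(i < n) (fun r => S r ord0 i) ^+ 2 + cst (e ^+ 2).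
      apply/funext => x; rewrite /d /sumsq fctE /= fct_sumE; congr (_ + _).
    have dSi i := is_derive_entry i (dS s s0t).
    have H1 := @is_derive_sum _ _ _ _ (fun i => (fun r => S r ord0 i) ^+ 2) s 1 _
      (fun i => is_deriveX 2 (dSi i)).
    have H2 := is_deriveD H1 (is_derive_cst (e ^+ 2) s 1).
    apply: (is_derive_eq H2); rewrite addr0; apply: eq_bigr => i _.
    by rewrite /= expr1.
  have de : is_derive s 1 (fun r => expR (4 * n%:R * b r))
      (expR (4 * n%:R * b s) * (4 * n%:R * b' s)).
    apply: (@is_derive1_comp _ expR (fun r => 4 * n%:R * b r)).
    exact: (is_deriveZ (4 * n%:R) (db s0)).
  exact: is_deriveM dd de.
have m'0 s : 0 < s < t -> 0 <= m' s.
  move=> /[dup] s0t /andP[s0 st].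
  suff H : - \sum_i (2 * S s ord0 i * S' s ord0 i) <= d s * (4 * n%:R * b' s).
    rewrite /m' mulrCA -mulrDr mulr_ge0 ?expR_ge0//.
    by rewrite -lerBlDr sub0r.
  (* Each of the [n] summands is at most [4 * b' s * d s], since x (x + e) is at most 2 (x^2 + e^2).
     This fixes the rate [4 * n%:R] of the exponential. *)
  rewrite -sumrN (le_trans (y := \sum_(i < n) 4 * b' s * d s))//; last first.
    by rewrite sumr_const card_ord -mulr_natr le_eqVlt; apply/orP; left; apply/eqP; ring.
  apply: ler_sum => i _.
  rewrite (le_trans (ler_norm _))// normrN !normrM gtr0_norm//.
  have Hi : `|S' s ord0 i| <= b' s * (`|S s| + e) := le_trans (mx_norm_entry _ _ _) (S'b s s0t).
  have Hs : `|S s ord0 i| <= `|S s| by exact: mx_norm_entry.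
  have Hd : `|S s| ^+ 2 + e ^+ 2 <= d s by rewrite lerD.
  have := b'0 s0; have := normr_ge0 (S s ord0 i); have := normr_ge0 (S' s ord0 i).
  have := normr_ge0 (S s).
  move: (`|S s|) (`|S s ord0 i|) (`|S' s ord0 i|) (b' s) (d s) Hi Hs Hd => x y z w D Hz Hy HD x0 z0 y0 w0.
  have H1 : y * z <= x * (w * (x + e)) by apply: ler_pM.
  have H2 : x * (w * (x + e)) <= w * (2 * D).
    rewrite mulrCA ler_wpM2l//; have := sqr_ge0 (x - e); rewrite !expr2 in HD *; nra.
  by nra.
have mrt : m r <= m t by exact: (is_derive_le cm dm m'0).
have dr : d r <= n.+1%:R * expR (4 * n%:R * B) * (`|S t| + e) ^+ 2.
  have d0 x : 0 <= d x by rewrite addr_ge0// sumr_ge0// => i _; exact: sqr_ge0.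
  have er : 1 <= expR (4 * n%:R * b r) by rewrite -expR0 ler_expR mulr_ge0// mulr_ge0.
  have et : expR (4 * n%:R * b t) <= expR (4 * n%:R * B).
    by rewrite ler_expR ler_wpM2l ?bB// mulr_ge0.
  rewrite (le_trans (y := m r)) ?ler_peMr//.
  rewrite (le_trans mrt)// /m [leRHS]mulrAC ler_pM ?expR_ge0//.
  have := sumsq_norm (S t); rewrite /d; have := normr_ge0 (S t).
  have n0 : 0 <= n%:R :> R by [].
  rewrite -natr1; move: (`|S t|) (sumsq (S t)) (n%:R : R) n0 => x y N N0 x0 xy.
  have h1 : 0 <= N * (x * e) by rewrite !mulr_ge0.
  have h2 : 0 <= N * (e * e) by rewrite !mulr_ge0.
  have h3 : 0 <= x * e by rewrite mulr_ge0.
  have h4 : 0 <= x * x by rewrite mulr_ge0.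
  rewrite !expr2 in xy *; nra.
have : `|S r| ^+ 2 <= (gronwall_const * (`|S t| + e)) ^+ 2.
  rewrite exprMn sqr_sqrtr ?mulr_ge0 ?expR_ge0// (le_trans _ dr)// (le_trans (norm_sumsq _))//.
  by rewrite lerDl.
by rewrite ler_sqr ?nnegrE// mulr_ge0 ?gronwall_const_ge0// addr_ge0.
Qed.

End gronwall.

(** * The backward flow and its steps *)

Section flow.
Context {R : realType} {n : nat}.
Variables (b b' : R -> R) (T : R) (u : 'rV[R]_n -> R -> 'rV[R]_n).
Hypotheses (cb : continuous b) (db : forall s : R, 0 < s -> is_derive s 1 b (b' s))
  (b'0 : forall s : R, 0 < s -> 0 <= b' s) (b0 : forall s, 0 <= b s)
  (bT : forall s, s <= T -> b s <= b T).
Hypothesis uL : forall s x y, 0 < s <= T -> `|u x s - u y s| <= b' s * `|x - y|.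
Hypothesis uK : forall s x v w, 0 < s <= T ->
  `|u (x + v + w) s - u (x + v) s - u (x + w) s + u x s| <= b' s * (`|v| * Num.sqrt `|w|).

Let Q := @gronwall_const R n (b T).
Let Q0 : 0 <= Q. Proof. exact: gronwall_const_ge0. Qed.

Definition trajectory (t : R) (xi : R -> 'rV[R]_n) :=
  {within `[0, t], continuous xi} /\ forall s, 0 < s < t -> is_derive s 1 xi (u (xi s) s).

Lemma trajectoryW s t xi : s <= t -> trajectory t xi -> trajectory s xi.
Proof.
move=> st [cxi dxi]; split.
  by apply: continuous_subspaceW cxi; apply: subset_itvl; rewrite bnd_simp.
by move=> r /andP[r0 rs]; apply: dxi; rewrite r0 (lt_le_trans rs).
Qed.

Let trajT s t : 0 < t <= T -> 0 < s < t -> 0 < s <= T.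
Proof. by move=> /andP[t0 tT] /andP[-> st]; rewrite ltW// (lt_le_trans st). Qed.

Lemma trajectory_lip t xi eta : 0 < t <= T -> trajectory t xi -> trajectory t eta ->
  forall r, 0 <= r <= t -> `|xi r - eta r| <= Q * `|xi t - eta t|.
Proof.
move=> tT [cx dx] [cy dy] r rt.
have := @gronwall R n b b' (b T) T cb db b'0 b0 bT (xi - eta)
  (fun s => u (xi s) s - u (eta s) s) t 0 tT (lexx _).
rewrite [_ + 0]addr0; apply => //; first exact: within_continuousB.
- by move=> s st; apply: is_deriveB; [exact: dx|exact: dy].
- by move=> s st; rewrite addr0; apply: uL; exact: trajT st.
Qed.

(** With [w] the difference of the trajectories and [c * b'] a bound on its velocity, both
    [c * b + w_i] and [c * b - w_i] are nondecreasing for every coordinate. The factor [b t - b r]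
    makes short steps close to the identity. *)
Lemma trajectory_id t xi eta : 0 < t <= T -> trajectory t xi -> trajectory t eta ->
  forall r, 0 <= r <= t ->
  `|xi r - eta r - (xi t - eta t)| <= (b t - b r) * (Q * `|xi t - eta t|).
Proof.
move=> tT tx ty r /[dup] rt /andP[r0 rlt].
set c := Q * _; have c0 : 0 <= c by rewrite mulr_ge0.
have bt s : 0 < s < t -> `|u (xi s) s - u (eta s) s| <= c * b' s.
  move=> st; rewrite (le_trans (uL _ _ (trajT tT st)))// mulrC ler_wpM2r//.
    by case/andP: st => s0 _; exact: b'0.
  by apply: trajectory_lip => //; case/andP: st => s0 st; rewrite !ltW.
have [[cx dx] [cy dy]] := (tx, ty).
have cw i : {within `[0, t], continuous (fun s => (xi s - eta s) ord0 i)}.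
  apply: (@within_continuous_comp _ _ _ _ (xi - eta) (fun v : 'rV[R]_n => v ord0 i)).
    by move=> v _; exact: coord_continuous.
  exact: within_continuousB.
have dw i s : 0 < s < t ->
    is_derive s 1 (fun s => (xi s - eta s) ord0 i) ((u (xi s) s - u (eta s) s) ord0 i).
  by move=> st; apply: (@is_derive_entry _ _ (xi - eta)); apply: is_deriveB; [exact: dx|exact: dy].
have ccb : {within `[0, t], continuous (c \*: b)}.
  apply: continuous_subspaceT => x.
  by apply: (@continuousM R R (fun=> c) b x); [exact: for_continuous_cst|exact: cb].
have bt' i s : 0 < s < t -> `|(u (xi s) s - u (eta s) s) ord0 i| <= c * b' s.
  by move=> st; rewrite (le_trans (mx_norm_entry _ _ _))// bt.
have btr : 0 <= b t - b r.
  rewrite subr_ge0; apply: (@is_derive_le R b b' 0 t) => //.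
  - exact: continuous_subspaceT.
  - by move=> s /andP[s0 _]; exact: db.
  - by move=> s /andP[s0 _]; exact: b'0.
apply: mx_norm_le => [|a i]; first by rewrite mulr_ge0.
have -> : (xi r - eta r - (xi t - eta t)) a i =
    (xi r - eta r) ord0 i - (xi t - eta t) ord0 i.
  by rewrite ord1 mxE [X in _ + X]mxE.
rewrite ler_norml; apply/andP; split.
  have := @is_derive_le R ((c \*: b) - (fun s => (xi s - eta s) ord0 i)) _ 0 t
    (within_continuousB ccb (cw i))
    (fun s st => is_deriveB (is_deriveZ c (db (proj1 (andP st)))) (dw i s st)).
  move=> /(_ _ r t r0 rlt (lexx t)); rewrite !fctE /=.
  move: ((xi r - eta r) ord0 i) ((xi t - eta t) ord0 i) => p q.
  have H s : 0 < s < t -> 0 <= c *: b' s - (u (xi s) s - u (eta s) s) ord0 i.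
    by move=> /(bt' i); rewrite ler_norml => /andP[_]; rewrite subr_ge0.
  by move=> /(_ H); rewrite /GRing.scale /=; lra.
have := @is_derive_le R ((c \*: b) + (fun s => (xi s - eta s) ord0 i)) _ 0 t
    (within_continuousD ccb (cw i))
    (fun s st => is_deriveD (is_deriveZ c (db (proj1 (andP st)))) (dw i s st)).
move=> /(_ _ r t r0 rlt (lexx t)); rewrite !fctE /=.
move: ((xi r - eta r) ord0 i) ((xi t - eta t) ord0 i) => p q.
have H s : 0 < s < t -> 0 <= c *: b' s + (u (xi s) s - u (eta s) s) ord0 i.
  by move=> /(bt' i); rewrite ler_norml => /andP[+ _]; rewrite /GRing.scale /=; lra.
by move=> /(_ H); rewrite /GRing.scale /=; lra.
Qed.

(* The second difference solves the equation of a first difference, up to the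
   parallelogram of [u] at [x4], which plays the part of [e] in [gronwall]. *)
Lemma trajectory_parallelogram t x1 x2 x3 x4 : 0 < t <= T -> x1 t - x2 t - x3 t + x4 t = 0 ->
  trajectory t x1 -> trajectory t x2 -> trajectory t x3 -> trajectory t x4 ->
  forall r, 0 <= r <= t -> `|x1 r - x2 r - x3 r + x4 r| <=
    Q * (Q * Num.sqrt Q) * (`|x2 t - x4 t| * Num.sqrt `|x3 t - x4 t|).
Proof.
move=> tT xt t1 t2 t3 t4 r rt.
have [[c1 d1] [c2 d2] [c3 d3] [c4 d4]] := And4 t1 t2 t3 t4.
(* By [trajectory_lip] the two sides of the parallelogram grow by at most [Q]. The second one enters
   under a square root. *)
pose e := (Q * Num.sqrt Q) * (`|x2 t - x4 t| * Num.sqrt `|x3 t - x4 t|).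
have e0 : 0 <= e by rewrite !mulr_ge0// ?sqrtr_ge0.
have := @gronwall R n b b' (b T) T cb db b'0 b0 bT (x1 - x2 - x3 + x4)
  (fun s => u (x1 s) s - u (x2 s) s - u (x3 s) s + u (x4 s) s) t e tT e0.
have -> : (x1 - x2 - x3 + x4) t = 0 by [].
rewrite normr0 add0r -[gronwall_const _ * _]/(Q * e) /e [Q * (_ * _)]mulrA; apply => //.
- apply: within_continuousD => //; apply: within_continuousB => //.
  exact: within_continuousB.
- move=> s st; apply: is_deriveD; last exact: d4.
  by apply: is_deriveB; [apply: is_deriveB; [exact: d1|exact: d2]|exact: d3].
move=> s st; have st' : 0 <= s <= t by case/andP: st => s0 st; rewrite !ltW.
have sT := trajT tT st.
(* The vertex that completes a parallelogram with [x4 s], [x2 s] and [x3 s]. The difference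
   [x1 s - z] is the second difference itself, to which the Lipschitz bound applies. *)
pose z := x2 s + x3 s - x4 s.
have -> : u (x1 s) s - u (x2 s) s - u (x3 s) s + u (x4 s) s =
  (u (x1 s) s - u z s) + (u z s - u (x2 s) s - u (x3 s) s + u (x4 s) s).
  by apply/rowP => j; rewrite !mxE; ring.
rewrite (le_trans (ler_normD _ _))// mulrDr lerD//.
  rewrite (le_trans (uL _ _ sT))// le_eqVlt; apply/orP; left; apply/eqP.
  by congr (_ * `|_|); apply/rowP => j; rewrite !mxE; ring.
have := uK (x4 s) (x2 s - x4 s) (x3 s - x4 s) sT.
have -> : x4 s + (x2 s - x4 s) + (x3 s - x4 s) = z.
  by apply/rowP => j; rewrite !mxE; ring.
have -> : x4 s + (x2 s - x4 s) = x2 s by apply/rowP => j; rewrite !mxE; ring.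
have -> : x4 s + (x3 s - x4 s) = x3 s by apply/rowP => j; rewrite !mxE; ring.
move=> /le_trans; apply; rewrite ler_wpM2l//; first by case/andP: st => s0 _; exact: b'0.
rewrite mulrACA ler_pM//; first exact: trajectory_lip.
by rewrite -sqrtrM// ler_wsqrtr//; exact: trajectory_lip.
Qed.

Variable X : 'rV[R]_n -> R -> R -> 'rV[R]_n.
Hypothesis XP : characteristics u X.

Let Xtraj x t : 0 < t -> trajectory t (X x t).
Proof. by move=> t0; have [_ c d] := XP x t0; split. Qed.

Let Xt x t : 0 < t -> X x t t = x.
Proof. by move=> t0; have [] := XP x t0. Qed.

(** Both sides are trajectories through the same point at time [s], and [trajectory_lip] gives
    uniqueness down to time 0. *)
Lemma flow_semigroup x t s r : 0 < s <= t -> t <= T -> 0 <= r <= s ->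
  X (X x t s) s r = X x t r.
Proof.
move=> /andP[s0 st] tT rs; have t0 : 0 < t by exact: lt_le_trans st.
apply/eqP; rewrite -subr_eq0 -normr_le0.
have sT : 0 < s <= T by rewrite s0 (le_trans st).
rewrite (le_trans (trajectory_lip sT (Xtraj _ s0) (trajectoryW st (Xtraj _ t0)) rs))//.
by rewrite Xt// subrr normr0 mulr0.
Qed.

Lemma flow_step_conserves t s : 0 < t <= T -> 0 <= s <= t -> n%:R * ((b t - b s) * Q) <= 1 / 2 ->
  exists Psi, conserves (fun x => X x t s) Psi.
Proof.
move=> tT st small; have /andP[t0 _] := tT.
have YL x y : `|X x t s - X y t s| <= Q * `|x - y|.
  have := trajectory_lip tT (Xtraj x t0) (Xtraj y t0) st.
  by rewrite !Xt.
have YK x v w : `|X (x + v + w) t s - X (x + v) t s - X (x + w) t s + X x t s| <=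
    Q * (Q * Num.sqrt Q) * (`|v| * Num.sqrt `|w|).
  have E0 : X (x + v + w) t t - X (x + v) t t - X (x + w) t t + X x t t = 0.
    by rewrite !Xt//; apply/rowP => j; rewrite !mxE; ring.
  have := trajectory_parallelogram tT E0 (Xtraj _ t0) (Xtraj _ t0) (Xtraj _ t0) (Xtraj x t0) st.
  by rewrite !Xt// ![x + _ - x]addrC !addKr.
have Yid x y : `|X x t s - X y t s - (x - y)| <= (b t - b s) * Q * `|x - y|.
  have := trajectory_id tT (Xtraj x t0) (Xtraj y t0) st.
  by rewrite !Xt// mulrA.
have K0 : 0 <= Q * (Q * Num.sqrt Q) by rewrite !mulr_ge0// sqrtr_ge0.
by eexists; exact: (parallelogram_conserves Q0 K0 YL YK Yid small).
Qed.

(** The partition has to make the increments of [b] small, rather than those of time, because [b]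
    measures the distance of a step to the identity. Its times after the first are positive, as
    characteristics are prescribed only at positive starting times. *)
Lemma flow_conserves :
  (forall d : R, 0 < d -> exists N (tau : nat -> R), [/\ tau 0%N = 0, tau N = T,
     forall k, 0 < tau k.+1, forall k, tau k <= tau k.+1 & forall k, b (tau k.+1) - b (tau k) <= d]) ->
  0 < T -> exists Psi, conserves (fun x => X x T 0) Psi.
Proof.
move=> Hpart T0.
(* An increment of [b] of this size satisfies the smallness condition of [flow_step_conserves]; the
   summand 1 keeps the divisor positive. *)
have d0 : 0 < 1 / 2 / (n%:R * Q + 1) by rewrite !divr_gt0// ltr_wpDl// mulr_ge0.
have [N [tau [tau0 tauN tau_gt0 tauS taub]]] := Hpart _ d0.
have tau_le k m : (k <= m)%N -> tau k <= tau m.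
  move=> km; rewrite -(subnK km); elim: (m - k)%N => [|j IH]//.
  by rewrite (le_trans IH).
have step k : (k < N)%N -> exists Psi, conserves (fun x => X x (tau k.+1) (tau k)) Psi.
  move=> kN; apply: flow_step_conserves.
  - by rewrite tau_gt0 -tauN tau_le.
  - by rewrite tauS -tau0 tau_le.
  rewrite mulrCA (le_trans (ler_wpM2r _ (taub k)))// ?mulr_ge0//.
  rewrite mulrAC ler_pdivrMr ?ltr_wpDl ?mulr_ge0//.
  by rewrite ler_wpM2l// lerDl.
have N0 : (0 < N)%N by case: (N) tauN => //; rewrite tau0 => T00; rewrite -T00 ltxx in T0.
have [m Nm] : exists m, N = m.+1 by exists N.-1; rewrite prednK.
suff H k : (k < N)%N -> exists Psi, conserves (fun x => X x (tau k.+1) 0) Psi.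
  by rewrite -tauN Nm; apply: H; rewrite Nm.
elim: k => [|k IH] kN; first by have := step 0%N kN; rewrite tau0.
have [P1 H1] := step _ kN; have [P2 H2] := IH (ltnW kN).
exists (fun x y => P1 x y *m P2 (X x (tau k.+2) (tau k.+1)) (X y (tau k.+2) (tau k.+1))).
have -> : (fun x => X x (tau k.+2) 0) =
    (fun x => X x (tau k.+1) 0) \o (fun x => X x (tau k.+2) (tau k.+1)).
  apply/funext => x /=; rewrite flow_semigroup//.
  - by rewrite tau_gt0 tauS.
  - by rewrite -tauN tau_le.
  - by rewrite lexx ltW.
exact: conserves_comp.
Qed.

End flow.

(** * Gaussian smoothing *)

Section gaussian.
Context {R : realType}.

Lemma sumsq_rVcons n (a : R) (v : 'rV[R]_n) : sumsq (rVcons (a, v)) = a ^+ 2 + sumsq v.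
Proof.
rewrite /sumsq big_ord_recl rVcons_ord0; congr (_ + _); apply: eq_bigr => i _.
have -> : lift ord0 i = rshift 1 i by exact: val_inj.
have /matrixP/(_ ord0 i) := rsubmx_rVcons a v.
by rewrite mxE => ->.
Qed.

Definition gauss n (k : R) (z : 'rV[R]_n) : R := expR (- (k * sumsq z)).

Lemma gauss_gt0 n k (z : 'rV[R]_n) : 0 < gauss k z. Proof. exact: expR_gt0. Qed.

Lemma continuous_gauss n k : continuous (@gauss n k).
Proof.
move=> z; apply: (@continuous_comp _ _ _ (fun z : 'rV[R]_n => - (k * sumsq z)) expR z).
  apply: (@continuousN _ _ _ (fun z : 'rV[R]_n => k * sumsq z)).
  apply: (@continuousM _ _ (fun=> k) (@sumsq R n)); first exact: for_continuous_cst.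
  exact: continuous_sumsq.
exact: continuous_expR.
Qed.

Definition gauss_mass n (k : R) : R := (Num.sqrt pi / Num.sqrt k) ^+ n.

Lemma gauss_mass_gt0 n k : 0 < k -> 0 < gauss_mass n k.
Proof. by move=> k0; rewrite exprn_gt0// divr_gt0// sqrtr_gt0// pi_gt0. Qed.

Local Open Scope ereal_scope.

Lemma integral_gauss1 k : (0 < k)%R ->
  \int[@lebesgue_measure R]_x (expR (- (k * x ^+ 2)))%:E = (Num.sqrt pi / Num.sqrt k)%:E.
Proof.
move=> k0; have sk : (0 < Num.sqrt k)%R by rewrite sqrtr_gt0.
pose f (x : R) := (gauss_fun x)%:E * ((Num.sqrt k)^-1)%:E.
have mg : measurable_fun [set: measurableTypeR R] (fun x : R => (gauss_fun x)%:E).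
  by apply/measurable_EFinP; exact: measurable_gauss_fun.
have f0 x : 0 <= f x by rewrite mule_ge0// lee_fin ?gauss_fun_ge0// invr_ge0 ltW.
transitivity (\int[@lebesgue_measure R]_x f x); last first.
  by rewrite ge0_integralZr ?integralT_gauss// => x _; rewrite lee_fin gauss_fun_ge0.
rewrite -[RHS](@ge0_integral_slope R (fun x => Num.sqrt k * x)%R (fun _ _ => Num.sqrt k) (Num.sqrt k))//.
- apply: eq_integral => x _; rewrite /f -!EFinM divfK ?gt_eqF//.
  by rewrite /gauss_fun exprMn sqr_sqrtr// ltW.
- by move=> x y; rewrite -mulrBr mulrC.
- by move=> p; exact: for_continuous_cst.
- by apply: emeasurable_funM => //; exact: measurable_cst.
Qed.

Lemma integral_gauss n k : (0 < k)%R ->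
  \int[lebesgue_rV R n]_z (gauss k z)%:E = (gauss_mass n k)%:E.
Proof.
move=> k0; elim: n => [|n IH].
  rewrite ge0_integral_rV0; last first.
    by apply/measurable_EFinP; apply: continuous_measurable_rV; exact: continuous_gauss.
  by rewrite /gauss /sumsq big_ord0 mulr0 oppr0 expR0.
have mgauss m : measurable_fun [set: 'rV[R]_m] (fun z => (gauss k z)%:E).
  by apply/measurable_EFinP; apply: continuous_measurable_rV; exact: continuous_gauss.
rewrite (ge0_integral_rVS (mgauss n.+1)); last by move=> x; rewrite lee_fin ltW// gauss_gt0.
transitivity (\int[@lebesgue_measure R]_x ((expR (- (k * x ^+ 2)))%:E * (gauss_mass n k)%:E)).
  apply: eq_integral => a _; rewrite -IH -ge0_integralZl ?lee_fin ?expR_ge0//; last first.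
  - by move=> v _; rewrite lee_fin ltW// gauss_gt0.
  - exact: mgauss.
  by apply: eq_integral => v _; rewrite /gauss sumsq_rVcons mulrDr opprD expRD EFinM.
rewrite ge0_integralZr ?lee_fin ?(ltW (gauss_mass_gt0 _ _))//.
  by rewrite [gauss_mass n.+1 k]exprS EFinM; congr (_ * _); exact: integral_gauss1.
apply/measurable_EFinP; apply: continuous_measurable_fun => x.
apply: (@continuous_comp _ _ _ (fun x : R => - (k * x ^+ 2))%R expR x); last exact: continuous_expR.
apply: (@continuousN _ _ _ (fun x : R => k * x ^+ 2)%R).
apply: (@continuousM _ _ (fun=> k) (fun x : R => x ^+ 2)%R); first exact: for_continuous_cst.
exact: exprn_continuous.
Qed.

Lemma integrable_gauss n k : (0 < k)%R ->
  (lebesgue_rV R n).-integrable setT (EFin \o gauss k).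
Proof.
move=> k0; apply/integrableP; split.
  by apply/measurable_EFinP; apply: continuous_measurable_rV; exact: continuous_gauss.
under eq_integral do rewrite /= ger0_norm ?(ltW (gauss_gt0 _ _))//.
by rewrite integral_gauss// ltry.
Qed.

Lemma gauss_bound_integrable n k (C : R) (f : 'rV[R]_n -> R) : (0 < k)%R ->
  continuous f -> (forall z, `|f z| <= C * gauss k z)%R ->
  (lebesgue_rV R n).-integrable setT (EFin \o f).
Proof.
move=> k0 cf fC; apply: (@le_integrable _ _ _ _ _ measurableT _ (fun z => C%:E * (gauss k z)%:E)).
- by apply/measurable_EFinP; exact: continuous_measurable_rV.
- by move=> z _; rewrite /= lee_fin (le_trans (fC z))// ler_norm.
- exact: integrableZl (integrable_gauss n k0).
Qed.

Lemma gauss_bound_Rintegral n k (C : R) (f : 'rV[R]_n -> R) : (0 < k)%R ->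
  continuous f -> (forall z, `|f z| <= C * gauss k z)%R ->
  (`|\int[lebesgue_rV R n]_z f z| <= C * gauss_mass n k)%R.
Proof.
move=> k0 cf fC; have If := gauss_bound_integrable k0 cf fC.
rewrite (le_trans (le_normr_Rintegral _ If))//.
have -> : (C * gauss_mass n k = \int[lebesgue_rV R n]_z (C * gauss k z))%R.
  rewrite RintegralZl//; last exact: integrable_gauss.
  by rewrite /Rintegral integral_gauss.
apply: le_Rintegral => //; first exact: integrable_norm.
exact: integrableZl (integrable_gauss n k0).
Qed.

End gaussian.
Section gaussian_kernels.
Context {R : realType}.

Lemma Rintegral_affine n (x : 'rV[R]_n) (c : R) (f : 'rV[R]_n -> R) : 0 < c ->
  continuous f -> (lebesgue_rV R n).-integrable setT (fun z => (f (x + c *: z))%:E) ->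
  \int[lebesgue_rV R n]_y f y = c ^+ n * \int[lebesgue_rV R n]_z f (x + c *: z).
Proof.
move=> c0 cf If; have CY := conserves_affine x c0; have [S d I] := CY.
have mf : measurable_fun [set: 'rV[R]_n] (EFin \o f).
  by apply/measurable_EFinP; exact: continuous_measurable_rV.
have detc : \det (c%:M : 'M[R]_n) = c ^+ n by rewrite det_scalar.
have If' : (lebesgue_rV R n).-integrable setT (EFin \o f).
  apply/integrableP; split => //.
  rewrite -(I (fun y => `|(f y)%:E|%E))//; last exact: measurableT_comp.
  have [mz iz] := integrableP _ _ _ If.
  rewrite detc ge0_integralZr ?lee_fin ?exprn_ge0 ?(ltW c0)//; last exact: measurableT_comp.
  by rewrite muleC lte_mul_pinfty// lee_fin exprn_ge0// ltW.
have [_ E] := conserves_integral CY If'.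
rewrite /Rintegral -[in LHS]E detc mulrC -/(Rintegral _ _ _) -/(Rintegral _ _ _).
by rewrite RintegralZr.
Qed.

Lemma expR_lip (a b m : R) : a <= m -> b <= m -> `|expR a - expR b| <= expR m * `|a - b|.
Proof.
wlog ab : a b / b <= a.
  by move=> H am bm; have /orP[|] := le_total a b => /H; [rewrite distrC (distrC a)|]; exact.
move=> am bm; rewrite !ger0_norm ?subr_ge0 ?ler_expR//.
have -> : expR a - expR b = expR a * (1 - expR (b - a)).
  by rewrite mulrBr mulr1 -expRD [a + _]addrC subrK.
have H1 : 1 - expR (b - a) <= a - b by have := expR_ge1Dx (b - a); lra.
apply: (@le_trans _ _ (expR a * (a - b))); first by rewrite ler_wpM2l// expR_ge0.
by rewrite ler_wpM2r ?subr_ge0// ler_expR.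
Qed.

(** Half of the exponent absorbs the polynomial factor: by 1 + x <= exp x, the product of [S] and
    [expR (- (k / 2 * S))] is at most [2 / k]. *)
Lemma gauss_absorb (k a b S : R) : 0 < k -> 0 <= a -> 0 <= b -> 0 <= S ->
  (a + b * S) * expR (- (k * S)) <= (a + b * (2 / k)) * expR (- (k / 2 * S)).
Proof.
move=> k0 a0 b0 S0; have -> : - (k * S) = - (k / 2 * S) + - (k / 2 * S) by field.
rewrite expRD mulrA ler_wpM2r ?expR_ge0// mulrDl lerD//.
  by rewrite ler_piMr// -expR0 ler_expR oppr_le0 !mulr_ge0// ltW.
rewrite -mulrA ler_wpM2l// expRN ler_pdivrMr ?expR_gt0//.
have := expR_ge1Dx (k / 2 * S); move=> H.
rewrite mulrAC ler_pdivlMr//; nra.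
Qed.

Variable n : nat.

(** Increments are restricted to size at most 1 because decay at [z] controls the kernel at
    [z + eta] only for bounded [eta]. Larger increments are handled by the size of the integrals
    alone. *)
Definition gauss_kernel (k C : R) (K : 'rV[R]_n -> R) :=
  [/\ continuous K, forall z, `|K z| <= C * gauss k z &
    forall z eta, `|eta| <= 1 -> `|K (z + eta) - K z| <= C * `|eta| * gauss k z].

Lemma gauss_le (k k' : R) (z : 'rV[R]_n) : k <= k' -> gauss k' z <= gauss k z.
Proof. by move=> kk; rewrite ler_expR lerN2 ler_wpM2r// sumsq_ge0. Qed.

Lemma coord_le_sumsq (z : 'rV[R]_n) i : `|z ord0 i| <= 1 + sumsq z.
Proof.
have H : z ord0 i ^+ 2 <= sumsq z.
  by rewrite /sumsq (bigD1 i)//= lerDl sumr_ge0// => j _; exact: sqr_ge0.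
have := sqr_ge0 (`|z ord0 i| - 1); rewrite -(real_normK (num_real (z ord0 i))) in H.
move: H; rewrite !expr2; nra.
Qed.

(** The first bound makes the exponent Lipschitz up to a quadratic factor. The second says that the
    shift keeps half of the exponent; it comes from the square of z_i / 2 + eta_i. *)
Let sumsq_shift (z eta : 'rV[R]_n) : `|eta| <= 1 ->
  `|sumsq (z + eta) - sumsq z| <= `|eta| * (2 * n%:R + sumsq z) /\
  sumsq z / 2 - n%:R <= sumsq (z + eta).
Proof.
move=> e1; have n1 : n%:R = \sum_(i < n) (1 : R) by rewrite sumr_const card_ord.
have ei i : `|eta ord0 i| <= `|eta| by exact: mx_norm_entry.
split.
  rewrite /sumsq -sumrB n1 mulr_sumr -big_split /= mulr_sumr.
  rewrite (le_trans (ler_norm_sum _ _ _))//; apply: ler_sum => i _; rewrite mxE.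
  have -> : (z ord0 i + eta ord0 i) ^+ 2 - z ord0 i ^+ 2 = eta ord0 i * (2 * z ord0 i + eta ord0 i).
    by ring.
  rewrite normrM ler_pM// (le_trans (ler_normD _ _))//.
  rewrite normrM gtr0_norm// -(real_normK (num_real (z ord0 i))).
  have := sqr_ge0 (`|z ord0 i| - 1); have := le_trans (ei i) e1; rewrite !expr2; nra.
rewrite /sumsq mulr_suml n1 -sumrB; apply: ler_sum => i _; rewrite mxE.
have : eta ord0 i ^+ 2 <= 1.
  rewrite -(real_normK (num_real _)) expr_le1//; exact: le_trans (ei i) e1.
have := sqr_ge0 (z ord0 i / 2 + eta ord0 i); rewrite !expr2; nra.
Qed.

Lemma gauss_shift k (z eta : 'rV[R]_n) : 0 < k -> `|eta| <= 1 ->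
  gauss k (z + eta) <= expR (k * n%:R) * gauss (k / 2) z.
Proof.
move=> k0 /(sumsq_shift z)[_ H]; rewrite /gauss -expRD ler_expR.
have := ler_wpM2l (ltW k0) H; lra.
Qed.

(** One halving of the rate pays for the shift and one for the factor [2 * n%:R + sumsq z] of the
    increment. The rate [k / 8] is weaker than the resulting [k / 4]. *)
Lemma gauss_kernel_gauss k : 0 < k -> exists2 C, 0 <= C & gauss_kernel (k / 8) C (@gauss R n k).
Proof.
move=> k0; have k20 : 0 < k / 2 by rewrite divr_gt0.
pose C := k * expR (k * n%:R) * (2 * n%:R + 1 * (2 / (k / 2))).
have C0 : 0 <= C.
  apply: mulr_ge0; first by rewrite mulr_ge0 ?expR_ge0// ltW.
  by rewrite addr_ge0 ?mulr_ge0 ?invr_ge0 ?(ltW k20)//.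
exists (1 + C); first by rewrite addr_ge0.
split; first exact: continuous_gauss.
  move=> z; rewrite ger0_norm ?(ltW (gauss_gt0 _ _))// mulrDl mul1r.
  rewrite (le_trans (gauss_le z (_ : k / 8 <= k)))//; first by lra.
  by rewrite lerDl mulr_ge0// ltW// gauss_gt0.
move=> z eta e1; have [H1 H2] := sumsq_shift z e1.
have S0 := sumsq_ge0 z.
have m1 : - (k * sumsq (z + eta)) <= k * n%:R - k / 2 * sumsq z.
  by have := ler_wpM2l (ltW k0) H2; lra.
have m2 : - (k * sumsq z) <= k * n%:R - k / 2 * sumsq z.
  have : 0 <= k * n%:R by rewrite mulr_ge0// ltW.
  by have := mulr_ge0 (ltW k0) S0; lra.
rewrite (le_trans (expR_lip m1 m2))//.
have -> : - (k * sumsq (z + eta)) - - (k * sumsq z) = - (k * (sumsq (z + eta) - sumsq z)) by ring.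
rewrite normrN normrM gtr0_norm// expRD.
apply: (@le_trans _ _ (expR (k * n%:R) * expR (- (k / 2 * sumsq z)) *
    (k * (`|eta| * (2 * n%:R + 1 * sumsq z))))).
  by rewrite mul1r !ler_wpM2l// ?mulr_ge0 ?expR_ge0// ltW.
have -> : expR (k * n%:R) * expR (- (k / 2 * sumsq z)) * (k * (`|eta| * (2 * n%:R + 1 * sumsq z))) =
  k * expR (k * n%:R) * `|eta| * ((2 * n%:R + 1 * sumsq z) * expR (- (k / 2 * sumsq z))) by ring.
apply: (@le_trans _ _ (k * expR (k * n%:R) * `|eta| *
    ((2 * n%:R + 1 * (2 / (k / 2))) * expR (- (k / 2 / 2 * sumsq z))))).
  rewrite ler_wpM2l ?mulr_ge0 ?expR_ge0 ?(ltW k0)//.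
  by apply: gauss_absorb; rewrite ?mulr_ge0.
have -> : k * expR (k * n%:R) * `|eta| *
    ((2 * n%:R + 1 * (2 / (k / 2))) * expR (- (k / 2 / 2 * sumsq z))) = C * `|eta| * gauss (k / 2 / 2) z.
  by rewrite /C /gauss; ring.
rewrite mulrDl mulrDl mul1r (le_trans (y := C * `|eta| * gauss (k / 8) z))//.
  apply: ler_wpM2l; first by rewrite mulr_ge0.
  by apply: gauss_le; lra.
by rewrite lerDr mulr_ge0// ltW// gauss_gt0.
Qed.

(** A product rule for increments. The coordinate factor is absorbed by one more halving of the
    rate. *)
Lemma gauss_kernel_coord k i : 0 < k ->
  exists2 C, 0 <= C & gauss_kernel (k / 8 / 2) C (fun z => z ord0 i * @gauss R n k z).
Proof.
move=> k0; have [C C0 [_ GC Gd]] := gauss_kernel_gauss k0.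
have k80 : 0 < k / 8 by rewrite divr_gt0.
pose D := C * (1 + 1 * (2 / (k / 8))).
have D0 : 0 <= D by rewrite mulr_ge0// addr_ge0// mul1r divr_ge0// ltW.
have mulG (x y z : R) (v : 'rV[R]_n) : 0 <= z -> `|x| <= 1 + sumsq v -> `|y| <= C * z * gauss (k / 8) v ->
    `|x * y| <= D * z * gauss (k / 8 / 2) v.
  move=> z0 xv yv; rewrite normrM (le_trans (ler_pM _ _ xv yv))//.
  have -> : (1 + sumsq v) * (C * z * gauss (k / 8) v) =
    C * z * ((1 + 1 * sumsq v) * expR (- (k / 8 * sumsq v))) by rewrite /gauss; ring.
  have -> : D * z * gauss (k / 8 / 2) v =
    C * z * ((1 + 1 * (2 / (k / 8))) * expR (- (k / 8 / 2 * sumsq v))) by rewrite /gauss /D; ring.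
  by rewrite ler_wpM2l ?mulr_ge0// gauss_absorb// sumsq_ge0.
exists (D + expR (k * n%:R)); first by rewrite addr_ge0// expR_ge0.
split.
- move=> z; apply: (@continuousM _ _ (fun z : 'rV[R]_n => z ord0 i) (gauss k)).
    exact: coord_continuous.
  exact: continuous_gauss.
- move=> z; rewrite mulrDl (le_trans (y := D * 1 * gauss (k / 8 / 2) z))//.
    by apply: mulG => //; rewrite ?mulr1; [exact: coord_le_sumsq|exact: GC].
  by rewrite mulr1 lerDl mulr_ge0 ?expR_ge0.
move=> z eta e1; rewrite mxE.
have -> : (z ord0 i + eta ord0 i) * gauss k (z + eta) - z ord0 i * gauss k z =
  z ord0 i * (gauss k (z + eta) - gauss k z) + eta ord0 i * gauss k (z + eta) by ring.
rewrite (le_trans (ler_normD _ _))// mulrDl mulrDl lerD//.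
  by apply: mulG => //; [exact: coord_le_sumsq|exact: Gd].
rewrite normrM [`|gauss _ _|]ger0_norm ?(ltW (gauss_gt0 _ _))// mulrAC mulrC.
rewrite ler_pM ?(ltW (gauss_gt0 _ _)) ?mx_norm_entry//.
rewrite (le_trans (gauss_shift z k0 e1))// ler_wpM2l ?expR_ge0//.
by apply: gauss_le; lra.
Qed.

Lemma gauss_kernelW k k' C K : k' <= k -> 0 <= C -> gauss_kernel k C K -> gauss_kernel k' C K.
Proof.
move=> kk C0 [cK bK dK]; split => // [z|z eta e1].
  by rewrite (le_trans (bK z))// ler_wpM2l// gauss_le.
by rewrite (le_trans (dK z eta e1))// ler_wpM2l ?mulr_ge0// gauss_le.
Qed.

End gaussian_kernels.

(** The source of the exponent 1/2: for [r <= 1] the Lipschitz bound suffices as r <= sqrt r, and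
    for larger [r] the crude bound [P] does as sqrt r >= 1. *)
Lemma norm_le_sqrt {R : realType} (P L r : R) (d : R) : 0 <= r -> 0 <= P -> 0 <= L ->
  d <= P -> (r <= 1 -> d <= L * r) -> d <= (P + L) * Num.sqrt r.
Proof.
move=> r0 P0 L0 dP dL; have s0 := sqrtr_ge0 r.
have [r1|r1] := leP r 1.
  have : r <= Num.sqrt r.
    rewrite -[X in X <= _]sqr_sqrtr// expr2 ler_piMr//.
    by rewrite -(@sqrtr1 R) ler_sqrt.
  move=> H; rewrite (le_trans (dL r1))// mulrDl (le_trans (ler_wpM2l L0 H))//.
  by rewrite lerDr mulr_ge0.
have : 1 <= Num.sqrt r by rewrite -(@sqrtr1 R) ler_sqrt// ltW.
move=> H; rewrite (le_trans dP)// mulrDl; have := ler_wpM2l P0 H; rewrite mulr1 => H1.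
by rewrite (le_trans H1)// lerDl mulr_ge0.
Qed.

Section smoothing.
Context {R : realType} {n : nat}.
Variables (psi : 'rV[R]_n -> R) (P L : R).
Hypotheses (P0 : 0 <= P) (L0 : 0 <= L) (psiP : forall x, `|psi x| <= P)
  (psiL : forall x y, `|psi x - psi y| <= L * `|x - y|).

Lemma lipschitz_continuous_rV : continuous psi.
Proof.
suff H (x : 'rV[R]_n) : psi y @[y --> x] --> psi x by exact: H.
apply/(@cvgrPdist_le R R 'rV[R]_n (nbhs x) _ psi (psi x)) => a a0.
have aL : 0 < a / (L + 1) by rewrite divr_gt0// ltr_wpDl.
near=> y; rewrite (le_trans (psiL _ _))//.
have : `|x - y| <= a / (L + 1) by near: y; apply: cvgr_dist_le => //; exact: cvg_id.
move=> /(ler_wpM2l L0)/le_trans; apply.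
by rewrite mulrCA ger_pMr// ler_pdivrMr ?ltr_wpDl// mul1r lerDl.
Unshelve. all: by end_near. Qed.

Variables (k C : R) (K : 'rV[R]_n -> R).
Hypotheses (k0 : 0 < k) (C0 : 0 <= C) (HK : gauss_kernel k C K).

Definition smoothing (c : R) (x : 'rV[R]_n) : R :=
  \int[lebesgue_rV R n]_z (K z * psi (x + c *: z)).

Let W := @gauss_mass R n k.
Let W0 : 0 <= W. Proof. exact: ltW (gauss_mass_gt0 _ k0). Qed.

Let cK : continuous K. Proof. by case: HK. Qed.

Let cpsi_affine (c : R) (x : 'rV[R]_n) : continuous (fun z : 'rV[R]_n => psi (x + c *: z)).
Proof.
move=> z; apply: (@continuous_comp _ _ _ (fun z : 'rV[R]_n => x + c *: z) psi z); last exact: lipschitz_continuous_rV.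
apply: continuousD; first exact: for_continuous_cst.
by apply: (@continuousZ _ _ _ (fun=> c) id); [exact: for_continuous_cst|exact: for_continuous_id].
Qed.

Lemma continuous_smoothing_integrand c x : continuous (fun z : 'rV[R]_n => K z * psi (x + c *: z)).
Proof. by move=> z; apply: continuousM; [exact: cK|exact: cpsi_affine]. Qed.

Lemma smoothing_integrand_le c x z : `|K z * psi (x + c *: z)| <= C * P * gauss k z.
Proof. by rewrite normrM mulrAC ler_pM//; case: HK. Qed.

Lemma smoothing_integrable c x :
  (lebesgue_rV R n).-integrable setT (EFin \o (fun z : 'rV[R]_n => K z * psi (x + c *: z))).
Proof.
apply: (gauss_bound_integrable k0 (@continuous_smoothing_integrand c x)).
exact: smoothing_integrand_le.
Qed.

Lemma smoothing_le c x : `|smoothing c x| <= C * P * W.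
Proof.
apply: gauss_bound_Rintegral => //; first exact: continuous_smoothing_integrand.
exact: smoothing_integrand_le.
Qed.

Lemma smoothing_lip c x y : `|smoothing c x - smoothing c y| <= C * L * W * `|x - y|.
Proof.
rewrite /smoothing -RintegralB//; try exact: smoothing_integrable.
rewrite mulrAC; apply: gauss_bound_Rintegral => //.
  move=> z; apply: (@continuousB _ _ _ (fun z : 'rV[R]_n => K z * psi (x + c *: z))
    (fun z : 'rV[R]_n => K z * psi (y + c *: z))); exact: continuous_smoothing_integrand.
move=> z; rewrite -mulrBr normrM.
rewrite (_ : C * L * `|x - y| * gauss k z = C * gauss k z * (L * `|x - y|)); last by ring.
rewrite ler_pM//; first by case: HK.
by rewrite (le_trans (psiL _ _))// opprD addrACA subrr addr0.
Qed.

Lemma smoothing_parallelogram c x v w : 0 < c ->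
  `|smoothing c (x + v + w) - smoothing c (x + v) - smoothing c (x + w) + smoothing c x| <=
  3 * C * L * W * (`|v| * Num.sqrt (c^-1 * `|w|)).
Proof.
move=> c0; pose D y := psi (y + v) - psi y.
have DL y : `|D y| <= L * `|v| by rewrite (le_trans (psiL _ _))// addrC addKr.
have cD : continuous D.
  move=> y; apply: (@continuousB _ _ _ (fun y : 'rV[R]_n => psi (y + v)) psi); last exact: lipschitz_continuous_rV.
  apply: (@continuous_comp _ _ _ (fun y : 'rV[R]_n => y + v) psi y); last exact: lipschitz_continuous_rV.
  by apply: continuousD; [exact: for_continuous_id|exact: for_continuous_cst].
pose F (y z : 'rV[R]_n) := K z * D (y + c *: z).
have cF y : continuous (F y).
  move=> z; apply: (@continuousM _ _ K (fun z : 'rV[R]_n => D (y + c *: z))); first exact: cK.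
  apply: (@continuous_comp _ _ _ (fun z : 'rV[R]_n => y + c *: z) D z); last exact: cD.
  apply: continuousD; first exact: for_continuous_cst.
  by apply: (@continuousZ _ _ _ (fun=> c) id); [exact: for_continuous_cst|exact: for_continuous_id].
have FE y : smoothing c (y + v) - smoothing c y = \int[lebesgue_rV R n]_z F y z.
  rewrite /smoothing -RintegralB//; try exact: smoothing_integrable.
  by apply: eq_Rintegral => z _; rewrite -mulrBr /F /D addrAC.
have -> : smoothing c (x + v + w) - smoothing c (x + v) - smoothing c (x + w) + smoothing c x =
    (smoothing c (x + w + v) - smoothing c (x + w)) - (smoothing c (x + v) - smoothing c x).
  by rewrite (addrAC x v w); ring.
rewrite !FE; pose eta := - (c^-1 *: w).
pose F' z := K (z + eta) * D (x + c *: z).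
have cF' : continuous F'.
  move=> z; apply: (@continuousM _ _ (fun z : 'rV[R]_n => K (z + eta)) (fun z : 'rV[R]_n => D (x + c *: z))).
    apply: (@continuous_comp _ _ _ (fun z : 'rV[R]_n => z + eta) K z); last exact: cK.
    by apply: continuousD; [exact: for_continuous_id|exact: for_continuous_cst].
  apply: (@continuous_comp _ _ _ (fun z : 'rV[R]_n => x + c *: z) D z); last exact: cD.
  apply: continuousD; first exact: for_continuous_cst.
  by apply: (@continuousZ _ _ _ (fun=> c) id); [exact: for_continuous_cst|exact: for_continuous_id].
have F'E z : F' (- eta + 1 *: z) = F (x + w) z.
  have E1 : - eta + z + eta = z by rewrite addrAC addNr add0r.
  have E2 : x + c *: (- eta + z) = x + w + c *: z.
    by rewrite /eta opprK scalerDr scalerA mulfV ?gt_eqF// scale1r addrA.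
  by rewrite /F' /F scale1r E1 E2.
have bF y z : `|F y z| <= C * (L * `|v|) * gauss k z.
  by rewrite normrM mulrAC ler_pM//; case: HK.
have IF y : (lebesgue_rV R n).-integrable setT (EFin \o F y).
  exact: (gauss_bound_integrable k0 (cF y) (bF y)).
have E1 : \int[lebesgue_rV R n]_z F (x + w) z = \int[lebesgue_rV R n]_z F' z.
  rewrite (Rintegral_affine (x := - eta) ltr01 cF').
    by rewrite expr1n mul1r; apply: eq_Rintegral => z _; rewrite F'E.
  by under eq_fun do rewrite F'E; exact: IF.
have absE1 : `|\int[lebesgue_rV R n]_z F (x + w) z| <= C * (L * `|v|) * W.
  exact: (gauss_bound_Rintegral k0 (cF _) (bF _)).
have absE2 : `|\int[lebesgue_rV R n]_z F x z| <= C * (L * `|v|) * W.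
  exact: (gauss_bound_Rintegral k0 (cF _) (bF _)).
have eta_norm : `|eta| = c^-1 * `|w| by rewrite normrN normrZ gtr0_norm ?invr_gt0.
have CLvW0 : 0 <= C * (L * `|v|) * W by rewrite !mulr_ge0.
have small : `|eta| <= 1 -> `|\int[lebesgue_rV R n]_z F (x + w) z - \int[lebesgue_rV R n]_z F x z| <=
    C * (L * `|v|) * W * `|eta|.
  move=> e1.
  have bd z : `|F' z - F x z| <= C * (L * `|v|) * `|eta| * gauss k z.
    rewrite /F' /F -mulrBl normrM.
    have -> : C * (L * `|v|) * `|eta| * gauss k z = C * `|eta| * gauss k z * (L * `|v|) by ring.
    by apply: ler_pM => //; case: HK => _ _; exact.
  have IF' : (lebesgue_rV R n).-integrable setT (EFin \o F').
    have -> : EFin \o F' = (EFin \o (fun z => F' z - F x z)) \+ (EFin \o F x).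
      by apply/funext => z; rewrite /= -EFinD subrK.
    apply: integrableD => //.
    apply: (gauss_bound_integrable k0 _ bd).
    by move=> z; apply: (@continuousB _ _ _ F' (F x)); [exact: cF'|exact: cF].
  rewrite E1 -RintegralB// [leRHS]mulrAC.
  apply: gauss_bound_Rintegral => //.
  by move=> z; apply: (@continuousB _ _ _ F' (F x)); [exact: cF'|exact: cF].
(* The crude bound counts twice, once per integral, and the bound for a small shift once: hence the
   constant 3. *)
have := @norm_le_sqrt R (2 * (C * (L * `|v|) * W)) (C * (L * `|v|) * W) `|eta|
  `|\int[lebesgue_rV R n]_z F (x + w) z - \int[lebesgue_rV R n]_z F x z|.
have -> : 3 * C * L * W * (`|v| * Num.sqrt (c^-1 * `|w|)) =
   (2 * (C * (L * `|v|) * W) + C * (L * `|v|) * W) * Num.sqrt `|eta|.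
  by rewrite eta_norm; ring.
have tot : `|\int[lebesgue_rV R n]_z F (x + w) z - \int[lebesgue_rV R n]_z F x z| <=
    2 * (C * (L * `|v|) * W).
  by rewrite (le_trans (ler_normB _ _))// mulr_natl mulr2n lerD.
by apply => //; rewrite mulr_ge0.
Qed.

End smoothing.

Lemma addr_entry {R : realType} m n (A B : 'M[R]_(m, n)) i j : (A + B) i j = A i j + B i j.
Proof. by rewrite mxE. Qed.

Lemma subr_entry {R : realType} m n (A B : 'M[R]_(m, n)) i j : (A - B) i j = A i j - B i j.
Proof. by rewrite mxE [X in _ + X]mxE. Qed.

(** * Bounds for a quotient with denominator bounded away from 0 *)

Section quotient.
Context {R : realType} {n : nat}.
Variables (A B : 'rV[R]_n -> R) (M m r : R).
Hypotheses (M0 : 0 <= M) (m0 : 0 < m) (r1 : 1 <= r).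
Hypotheses (AM : forall x, `|A x| <= M) (BM : forall x, `|B x| <= M) (Bm : forall x, m <= B x).
Hypotheses (AL : forall x y, `|A x - A y| <= M * `|x - y|)
  (BL : forall x y, `|B x - B y| <= M * `|x - y|).
Hypotheses
  (AP : forall x v w, `|A (x + v + w) - A (x + v) - A (x + w) + A x| <= M * (`|v| * (r * Num.sqrt `|w|)))
  (BP : forall x v w, `|B (x + v + w) - B (x + v) - B (x + w) + B x| <= M * (`|v| * (r * Num.sqrt `|w|))).

Let q x := A x / B x.
Let N := M / m + M / m * (M / m).

Let B0 x : 0 < B x. Proof. exact: lt_le_trans (Bm x). Qed.

Let Mm0 : 0 <= M / m. Proof. by rewrite divr_ge0// ltW. Qed.

Let divB_le (a b : R) x : `|a * B x| <= b -> `|a| <= b / m.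
Proof.
rewrite normrM (gtr0_norm (B0 x)) ler_pdivlMr// => H.
by apply: le_trans H; rewrite ler_wpM2l.
Qed.

Lemma quotient_le x : `|q x| <= M / m.
Proof. by apply: (@divB_le _ _ x); rewrite /q divfK ?gt_eqF. Qed.

Lemma quotient_lip x y : `|q x - q y| <= N * `|x - y|.
Proof.
have -> : N * `|x - y| = (M + M * (M / m)) * `|x - y| / m.
  by rewrite /N; field; rewrite gt_eqF.
apply: (@divB_le _ _ x).
have -> : (q x - q y) * B x = (A x - A y) - (B x - B y) * q y.
  by rewrite /q; field; rewrite !gt_eqF.
rewrite (le_trans (ler_normB _ _))// [leRHS]mulrDl lerD//.
by rewrite normrM mulrAC ler_pM// quotient_le.
Qed.

(* Bound for the terms of
   [B x1 * (q x1 - q x2 - q x3 + q x) = (A x1 - A x2 - A x3 + A x)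
    - (B x3 - B x) * (q x2 - q x) - (B x2 - B x) * (q x3 - q x)
    + (B x1 - B x2 - B x3 + B x) * (q x - q x2 - q x3)]. *)
Definition quotient_const := (M + 3 * M * N + M * (2 * (M / m) + N) + M * (3 * (M / m))) / m.

Lemma quotient_parallelogram x v w :
  `|q (x + v + w) - q (x + v) - q (x + w) + q x| <= quotient_const * (`|v| * (r * Num.sqrt `|w|)).
Proof.
set x1 := x + v + w; set x2 := x + v; set x3 := x + w; set s := Num.sqrt `|w|.
have s0 : 0 <= s by exact: sqrtr_ge0.
have N0 : 0 <= N by rewrite addr_ge0// mulr_ge0.
have srs : s <= r * s by rewrite ler_peMl.
have d2 : `|x2 - x| = `|v| by rewrite /x2 addrC addKr.
have d3 : `|x3 - x| = `|w| by rewrite /x3 addrC addKr.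
(* In each product of first differences one factor carries [|v|], so the other only has to be of
   order [s]. The assumption [1 <= r] then brings [s] below [r * s]. *)
have B34 : `|B x3 - B x| <= 3 * M * s.
  have -> : 3 * M = 2 * M + M by ring.
  apply: norm_le_sqrt => //; first by rewrite mulr_ge0.
    by rewrite (le_trans (ler_normB _ _))// mulr_natl mulr2n lerD.
  by move=> _; rewrite -d3.
have q34 : `|q x3 - q x| <= (2 * (M / m) + N) * s.
  apply: norm_le_sqrt => //; first by rewrite mulr_ge0.
    by rewrite (le_trans (ler_normB _ _))// mulr_natl mulr2n lerD// quotient_le.
  by move=> _; rewrite -d3; exact: quotient_lip.
have B24 : `|B x2 - B x| <= M * `|v| by rewrite -d2.
have q24 : `|q x2 - q x| <= N * `|v| by rewrite -d2; exact: quotient_lip.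
have q423 : `|q x - q x2 - q x3| <= 3 * (M / m).
  have -> : 3 * (M / m) = M / m + M / m + M / m by ring.
  by rewrite (le_trans (ler_normB _ _))// lerD ?quotient_le// (le_trans (ler_normB _ _))// lerD ?quotient_le.
have al := AP x v w; have be := BP x v w; rewrite -/x1 -/x2 -/x3 -/s in al be.
rewrite /quotient_const mulrAC; apply: (@divB_le _ _ x1).
have -> : (q x1 - q x2 - q x3 + q x) * B x1 =
  (A x1 - A x2 - A x3 + A x) - (B x3 - B x) * (q x2 - q x) - (B x2 - B x) * (q x3 - q x)
  + (B x1 - B x2 - B x3 + B x) * (q x - q x2 - q x3).
  by rewrite /q; field; rewrite !gt_eqF.
rewrite [leRHS]mulrDl [X in _ <= X + _]mulrDl [X in _ <= X + _ + _]mulrDl.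
rewrite (le_trans (ler_normD _ _))// lerD//; last first.
  by rewrite normrM mulrAC ler_pM.
rewrite (le_trans (ler_normB _ _))// lerD//; last first.
  rewrite normrM (_ : _ * _ * _ = (M * `|v|) * ((2 * (M / m) + N) * (r * s))); last by ring.
  rewrite ler_pM// (le_trans q34)// ler_wpM2l//.
  by rewrite addr_ge0// mulr_ge0.
rewrite (le_trans (ler_normB _ _))// lerD//.
rewrite normrM (_ : 3 * M * N * (`|v| * (r * s)) = (3 * M * (r * s)) * (N * `|v|)); last by ring.
by rewrite ler_pM// (le_trans B34)// ler_wpM2l// mulr_ge0.
Qed.

End quotient.

(** * The Hopf-Cole velocity *)

Section hopf_cole_estimates.
Context {R : realType} {n : nat}.
Variables (eps : R) (phi0 : 'rV[R]_n -> R) (Mphi Lphi : R).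
Hypotheses (eps0 : 0 < eps) (Lphi0 : 0 <= Lphi) (phiM : forall x, `|phi0 x| <= Mphi)
  (phiL : forall x y, `|phi0 x - phi0 y| <= Lphi * `|x - y|).

Let psi (y : 'rV[R]_n) := expR (- (eps^-1 * phi0 y)).
Let P := expR (eps^-1 * Mphi).
Let L := P * (eps^-1 * Lphi).
Let P0 : 0 <= P. Proof. exact: expR_ge0. Qed.
Let ie0 : 0 < eps^-1. Proof. by rewrite invr_gt0. Qed.
Let L0 : 0 <= L. Proof. by rewrite mulr_ge0// mulr_ge0// ltW. Qed.

Let psiP x : `|psi x| <= P.
Proof.
rewrite ger0_norm ?expR_ge0// ler_expR -mulrN ler_wpM2l ?(ltW ie0)//.
by have := phiM x; rewrite ler_norml lerNl => /andP[].
Qed.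

Let psi_lower x : P^-1 <= psi x.
Proof.
rewrite -expRN ler_expR lerN2 ler_wpM2l ?(ltW ie0)//.
by have := phiM x; rewrite ler_norml => /andP[].
Qed.

Let psiL x y : `|psi x - psi y| <= L * `|x - y|.
Proof.
have e z : - (eps^-1 * phi0 z) <= eps^-1 * Mphi.
  rewrite -mulrN ler_wpM2l ?(ltW ie0)//.
  by have := phiM z; rewrite ler_norml lerNl => /andP[].
rewrite (le_trans (expR_lip (e x) (e y)))// -/P /L -mulrA ler_wpM2l//.
have -> : - (eps^-1 * phi0 x) - - (eps^-1 * phi0 y) = - (eps^-1 * (phi0 x - phi0 y)) by ring.
by rewrite normrN normrM gtr0_norm// -mulrA ler_wpM2l ?(ltW ie0).
Qed.

(** The substitution y = x + sqrt t z turns |x - y|^2 / (2 t eps) into |z|^2 / (2 eps). *)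
Let k := (2 * eps)^-1.
Let k0 : 0 < k. Proof. by rewrite invr_gt0 mulr_gt0. Qed.
(* [None] is the kernel of the denominator. *)
Let K (i : option 'I_n) (z : 'rV[R]_n) : R :=
  if i is Some i then z ord0 i * gauss k z else gauss k z.

Let S i (t : R) (x : 'rV[R]_n) := smoothing psi (K i) (Num.sqrt t) x.

Let cphi0 : continuous phi0. Proof. exact: lipschitz_continuous_rV Lphi0 phiL. Qed.

Let weightE x t y : 0 < t -> hopf_cole_weight eps phi0 x t y =
  expR (- eps^-1 * (sumsq (x - y) / (2 * t) + phi0 y)).
Proof. by move=> t0; rewrite /hopf_cole_weight /enorm sqr_sqrtr// sumsq_ge0. Qed.

Let continuous_weight x t : 0 < t -> continuous (hopf_cole_weight eps phi0 x t).
Proof.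
move=> t0; have -> : hopf_cole_weight eps phi0 x t =
    fun y => expR (- eps^-1 * (sumsq (x - y) / (2 * t) + phi0 y)).
  by apply/funext => y; rewrite weightE.
move=> y; apply: (@continuous_comp _ _ _
  (fun y : 'rV[R]_n => - eps^-1 * (sumsq (x - y) / (2 * t) + phi0 y)) expR y); last exact: continuous_expR.
apply: (@continuousM _ _ (fun=> - eps^-1)); first exact: for_continuous_cst.
apply: (@continuousD _ _ _ (fun y : 'rV[R]_n => sumsq (x - y) / (2 * t)) phi0); last exact: cphi0.
apply: (@continuousM _ _ (fun y : 'rV[R]_n => sumsq (x - y)) (fun=> (2 * t)^-1)); last exact: for_continuous_cst.
apply: (@continuous_comp _ _ _ (fun y : 'rV[R]_n => x - y) (@sumsq R n) y); last exact: continuous_sumsq.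
by apply: continuousB; [exact: for_continuous_cst|exact: for_continuous_id].
Qed.

Let weight_affine x t z : 0 < t ->
  hopf_cole_weight eps phi0 x t (x + Num.sqrt t *: z) = gauss k z * psi (x + Num.sqrt t *: z).
Proof.
move=> t0; rewrite weightE// /gauss /psi -expRD; congr expR.
have -> : sumsq (x - (x + Num.sqrt t *: z)) = t * sumsq z.
  rewrite /sumsq mulr_sumr; apply: eq_bigr => i _; rewrite !mxE opprD addrA subrr sub0r sqrrN.
  by rewrite exprMn sqr_sqrtr// ltW.
by rewrite /k; field; rewrite !gt_eqF.
Qed.

Let kernels : exists2 C, 0 <= C & forall i, gauss_kernel (k / 8 / 2) C (K i).
Proof.
have [C0 C00 H0] := @gauss_kernel_gauss R n k k0.
have H i : exists C : R, 0 <= C /\ gauss_kernel (k / 8 / 2) C (K (Some i)).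
  by have [C C0' H1] := @gauss_kernel_coord R n k i k0; exists C.
have [C HC] := choice H.
have Cle C1 C2 i : 0 <= C1 -> C1 <= C2 -> gauss_kernel (k / 8 / 2) C1 (K i) ->
    gauss_kernel (k / 8 / 2) C2 (K i).
  move=> C10 C12 [cK bK dK]; split => // [z|z eta e1].
    by rewrite (le_trans (bK z))// ler_wpM2r// ltW// gauss_gt0.
  rewrite (le_trans (dK z eta e1))// ler_wpM2r//; first by rewrite ltW// gauss_gt0.
  by rewrite ler_wpM2r.
have s0 : 0 <= \sum_i C i by apply: sumr_ge0 => i _; case: (HC i).
exists (C0 + \sum_i C i); first by rewrite addr_ge0.
case=> [i|].
  have [Ci0 Hi] := HC i; apply: (Cle (C i) _ (Some i) Ci0 _ Hi).
  rewrite (bigD1 i)//= addrCA lerDl addr_ge0// sumr_ge0// => j _.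
  by case: (HC j).
apply: (Cle C0 _ None C00); first by rewrite lerDl.
apply: (gauss_kernelW _ C00 H0).
by rewrite ler_pdivrMr// ler_peMr ?divr_ge0 ?(ltW k0)// ler1n.
Qed.

Let smoothing_affine i (f : 'rV[R]_n -> R) a x t : 0 < t -> continuous f ->
  (forall z, f (x + Num.sqrt t *: z) = a * (K i z * psi (x + Num.sqrt t *: z))) ->
  \int[lebesgue_rV R n]_y f y = Num.sqrt t ^+ n * (a * S i t x).
Proof.
move=> t0 cf fE; have [C C0 HK] := kernels.
have k20 : 0 < k / 8 / 2 by rewrite !divr_gt0.
have IS := smoothing_integrable L0 psiP psiL k20 (HK i) (Num.sqrt t) x.
rewrite (Rintegral_affine (x := x) (c := Num.sqrt t)) ?sqrtr_gt0//; last first.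
  by under eq_fun do rewrite fE EFinM; exact: integrableZl.
congr (_ * _); rewrite /S /smoothing -RintegralZl//.
by apply: eq_Rintegral => z _; rewrite fE.
Qed.

Lemma hopf_coleE x t i : 0 < t -> hopf_cole eps phi0 x t ord0 i =
  - (Num.sqrt t)^-1 * (S (Some i) t x / S None t x).
Proof.
move=> t0; have st0 : Num.sqrt t != 0 by rewrite gt_eqF// sqrtr_gt0.
rewrite mxE (@smoothing_affine None _ 1 x t t0 (@continuous_weight x t t0)); last first.
  by move=> z; rewrite weight_affine// mul1r.
rewrite (@smoothing_affine (Some i) _ (- (Num.sqrt t)^-1) x t t0); last 2 first.
- move=> y; apply: (@continuousM _ _ (fun y : 'rV[R]_n => (x ord0 i - y ord0 i) / t)
    (hopf_cole_weight eps phi0 x t)); last exact: continuous_weight.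
  apply: (@continuousM _ _ (fun y : 'rV[R]_n => x ord0 i - y ord0 i) (fun=> t^-1)); last exact: for_continuous_cst.
  by apply: (@continuousB _ _ _ (fun=> x ord0 i) (fun y : 'rV[R]_n => y ord0 i)); [exact: for_continuous_cst|exact: coord_continuous].
- move=> z; rewrite weight_affine// !mxE -[X in _ / X](sqr_sqrtr (ltW t0)) /=.
  by field.
rewrite mul1r invfM mulrACA mulfV ?mul1r ?expf_neq0//.
by rewrite mulrA.
Qed.

Lemma smoothing_weight_lower t x : P^-1 * gauss_mass n k <= S None t x.
Proof.
have [C C0 HK] := kernels.
have k20 : 0 < k / 8 / 2 by rewrite !divr_gt0.
rewrite (_ : P^-1 * gauss_mass n k = \int[lebesgue_rV R n]_z (P^-1 * gauss k z)); last first.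
  rewrite RintegralZl//; last exact: integrable_gauss.
  by rewrite /Rintegral integral_gauss.
apply: le_Rintegral => //.
- exact: integrableZl (integrable_gauss n k0).
- exact: (smoothing_integrable L0 psiP psiL k20 (HK None)).
- by move=> z _; rewrite /= mulrC ler_wpM2l// ltW// gauss_gt0.
Qed.

(** The smoothing scale is sqrt t, so the parallelogram bound brings the inverse fourth root of t.
    Adding 1 to it gives the factor at least 1 that the quotient estimates need. *)
Lemma hopf_cole_estimates : exists2 M, 0 <= M & forall t, 0 < t ->
  [/\ forall x, `|hopf_cole eps phi0 x t| <= M * (Num.sqrt t)^-1,
    forall x y, `|hopf_cole eps phi0 x t - hopf_cole eps phi0 y t| <= M * (Num.sqrt t)^-1 * `|x - y| &
    forall x v w, `|hopf_cole eps phi0 (x + v + w) t - hopf_cole eps phi0 (x + v) t -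
        hopf_cole eps phi0 (x + w) t + hopf_cole eps phi0 x t| <=
      M * (Num.sqrt t)^-1 * (`|v| * ((1 + (Num.sqrt (Num.sqrt t))^-1) * Num.sqrt `|w|))].
Proof.
have [C C0 HK] := kernels.
have k20 : 0 < k / 8 / 2 by rewrite !divr_gt0.
pose W := @gauss_mass R n (k / 8 / 2); have W0 : 0 < W by exact: gauss_mass_gt0.
pose m := P^-1 * gauss_mass n k.
have m0 : 0 < m by rewrite mulr_gt0 ?gauss_mass_gt0// invr_gt0 expR_gt0.
pose M := C * P * W + 3 * C * L * W.
have CPW : 0 <= C * P * W by rewrite !mulr_ge0// ltW.
have CLW : 0 <= C * L * W by rewrite !mulr_ge0// ltW.
have CLW3 : 0 <= 3 * C * L * W by rewrite !mulr_ge0// ltW.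
have M0 : 0 <= M by rewrite addr_ge0.
have SM i t x : `|S i t x| <= M.
  by rewrite (le_trans (smoothing_le L0 psiP psiL k20 (HK i) _ _))// lerDl.
have SL i t x y : `|S i t x - S i t y| <= M * `|x - y|.
  rewrite (le_trans (smoothing_lip L0 psiP psiL k20 (HK i) _ _ _))// ler_wpM2r//.
  rewrite /M (_ : 3 * C * L * W = 3 * (C * L * W)); last by ring.
  by move: CPW CLW; rewrite -/W; lra.
have SP i t x v w : 0 < t -> `|S i t (x + v + w) - S i t (x + v) - S i t (x + w) + S i t x| <=
    M * (`|v| * ((1 + (Num.sqrt (Num.sqrt t))^-1) * Num.sqrt `|w|)).
  move=> t0; have st0 : 0 < Num.sqrt t by rewrite sqrtr_gt0.
  rewrite (le_trans (smoothing_parallelogram L0 psiP psiL k20 C0 (HK i) _ _ _ st0))//.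
  have -> : Num.sqrt ((Num.sqrt t)^-1 * `|w|) = (Num.sqrt (Num.sqrt t))^-1 * Num.sqrt `|w|.
    by rewrite sqrtrM ?invr_ge0 ?(ltW st0)// sqrtrV ?(ltW st0).
  apply: ler_pM; first exact: CLW3.
  - by rewrite !mulr_ge0 ?invr_ge0 ?sqrtr_ge0.
  - by rewrite /M lerDr.
  - by rewrite ler_wpM2l// ler_wpM2r ?sqrtr_ge0// lerDr.
have r1 (t : R) : 1 <= 1 + (Num.sqrt (Num.sqrt t))^-1 by rewrite lerDl invr_ge0 sqrtr_ge0.
pose N := M / m + M / m * (M / m).
have Mm : 0 <= M / m by rewrite divr_ge0// ltW.
have N0 : 0 <= N by rewrite addr_ge0// mulr_ge0.
have Q0 : 0 <= quotient_const M m.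
  rewrite /quotient_const -/N; apply: divr_ge0; last exact: ltW.
  have H1 : 0 <= 3 * M * N by rewrite !mulr_ge0.
  have H2 : 0 <= M * (2 * (M / m) + N) by rewrite mulr_ge0// addr_ge0// mulr_ge0.
  have H3 : 0 <= M * (3 * (M / m)) by rewrite mulr_ge0// mulr_ge0.
  by rewrite !addr_ge0.
exists (N + quotient_const M m); first by rewrite addr_ge0.
move=> t t0; have st0 : 0 < Num.sqrt t by rewrite sqrtr_gt0.
have sti : 0 <= (Num.sqrt t)^-1 by rewrite invr_ge0 ltW.
have lower x : m <= S None t x by exact: smoothing_weight_lower.
have ns (a b : R) : a <= b -> (Num.sqrt t)^-1 * a <= b * (Num.sqrt t)^-1.
  by move=> ab; rewrite mulrC ler_wpM2r.
move: (hopf_cole eps phi0) (fun x i => @hopf_coleE x t i t0) => U UE.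
clearbody S.
split.
- move=> x; apply: mx_norm_le => [|a i]; first by rewrite !mulr_ge0// addr_ge0.
  rewrite ord1 UE normrM normrN (ger0_norm sti) ns//.
  rewrite (le_trans (quotient_le m0 (SM (Some i) t) lower x))//.
  by rewrite -addrA lerDl addr_ge0// mulr_ge0.
- move=> x y; apply: mx_norm_le => [|a i]; first by rewrite !mulr_ge0// addr_ge0.
  rewrite ord1 subr_entry !UE -mulrBr normrM normrN (ger0_norm sti).
  rewrite [leRHS]mulrAC ns//.
  rewrite (le_trans (quotient_lip m0 (SM (Some i) t) lower (SL (Some i) t) (SL None t) x y))//.
  by rewrite -/N ler_wpM2r// lerDl.
- move=> x v w; apply: mx_norm_le => [|a i].
    rewrite mulr_ge0 ?mulr_ge0 ?sqrtr_ge0 ?(le_trans ler01 (r1 t))//.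
    by rewrite addr_ge0.
  have -> : (U (x + v + w) t - U (x + v) t -
     U (x + w) t + U x t) a i = - (Num.sqrt t)^-1 *
     (S (Some i) t (x + v + w) / S None t (x + v + w) - S (Some i) t (x + v) / S None t (x + v) -
      S (Some i) t (x + w) / S None t (x + w) + S (Some i) t x / S None t x).
    rewrite ord1 addr_entry subr_entry subr_entry !UE mulrDr mulrBr mulrBr.
    by [].
  rewrite normrM normrN (ger0_norm sti) [leRHS]mulrAC ns//.
  rewrite (le_trans (quotient_parallelogram M0 m0 (r1 t) (SM (Some i) t) (SM None t) lower
    (SL (Some i) t) (SL None t) (fun x v w => SP (Some i) t x v w t0) (fun x v w => SP None t x v w t0) x v w))//.
  rewrite ler_wpM2r ?lerDr// !mulr_ge0 ?sqrtr_ge0 ?addr_ge0 ?invr_ge0 ?sqrtr_ge0//.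
Qed.

End hopf_cole_estimates.

Section hopf_cole_flow.
Context {R : realType} {n : nat}.
Variables (eps : R) (phi0 : 'rV[R]_n -> R) (Mphi Lphi : R).
Hypotheses (eps0 : 0 < eps) (Lphi0 : 0 <= Lphi) (phiM : forall x, `|phi0 x| <= Mphi)
  (phiL : forall x y, `|phi0 x - phi0 y| <= Lphi * `|x - y|).

Lemma hopf_cole_cvg0 (A : set 'rV[R]_n) :
  {uniform A, (fun t x => hopf_cole eps phi0 x t) @ +oo --> (fun=> 0 : 'rV[R]_n)}.
Proof.
have [M M0 HM] := hopf_cole_estimates eps0 Lphi0 phiM phiL.
move=> P /uniform_nbhs[E []]; rewrite -entourage_ballE => -[/= e e0 eE] EP.
have H : \forall t \near +oo, forall x, `|hopf_cole eps phi0 x t| < e.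
  near=> t; move=> x.
  have t0 : 0 < t by near: t; apply: nbhs_pinfty_gt; rewrite num_real.
  have te : (M / e) ^+ 2 < t by near: t; apply: nbhs_pinfty_gt; rewrite num_real.
  have [Hx _ _] := HM t t0.
  rewrite (le_lt_trans (Hx x))// ltr_pdivrMr ?sqrtr_gt0// mulrC -ltr_pdivrMr//.
  rewrite -[ltLHS]ger0_norm ?divr_ge0 ?(ltW e0)// -sqrtr_sqr.
  by rewrite ltr_sqrt.
apply: filterS H => t Ht; apply: EP => x _ /=; apply: eE => /=.
by rewrite -ball_normE /ball_ /= sub0r normrN.
Unshelve. all: by end_near. Qed.

Let root4 (s : R) := Num.sqrt (Num.sqrt s).

Let root4_ge0 s : 0 <= root4 s. Proof. exact: sqrtr_ge0. Qed.

Let root4_gt0 s : 0 < s -> 0 < root4 s. Proof. by move=> s0; rewrite !sqrtr_gt0. Qed.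

Let root4_le s t : s <= t -> root4 s <= root4 t.
Proof. by move=> st; rewrite ler_wsqrtr// ler_wsqrtr. Qed.

Lemma hopf_cole_flow_conserves (X : 'rV[R]_n -> R -> R -> 'rV[R]_n) (T : R) :
  characteristics (hopf_cole eps phi0) X -> 0 < T ->
  exists Psi, conserves (fun x => X x T 0) Psi.
Proof.
move=> XP T0.
have [M M0 HM] := hopf_cole_estimates eps0 Lphi0 phiM phiL.
(* For 0 < s <= T, both 1 and 1 + 1 / root4 s are at most (root4 T + 1) / root4 s. The two rates are
   thus bounded by [b' s], a multiple of s^(-3/4), whose primitive is [b]. *)
pose C := M * (root4 T + 1); have C0 : 0 <= C by rewrite mulr_ge0// addr_ge0.
pose b s := 4 * C * root4 s; pose b' s := C * (root4 s)^-1 * (Num.sqrt s)^-1.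
have b0 s : 0 <= b s by rewrite /b mulr_ge0// mulr_ge0.
have bT s : s <= T -> b s <= b T.
  by move=> sT; apply: ler_wpM2l; [rewrite mulr_ge0|exact: root4_le].
have b'0 s : 0 < s -> 0 <= b' s.
  by move=> s0; rewrite /b' mulr_ge0 ?invr_ge0 ?sqrtr_ge0// mulr_ge0 ?invr_ge0.
have cb : continuous b.
  move=> s; apply: (@continuousM R R (fun=> 4 * C) root4 s); first exact: for_continuous_cst.
  apply: (@continuous_comp _ _ _ (@Num.sqrt R) (@Num.sqrt R) s); exact: sqrt_continuous.
have db (s : R) : 0 < s -> is_derive s 1 b (b' s).
  move=> s0; have ss0 : 0 < Num.sqrt s by rewrite sqrtr_gt0.
  have H := is_derive1_comp (is_derive1_sqrt ss0) (is_derive1_sqrt s0).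
  apply: (is_derive_eq (is_deriveZ (4 * C) H)).
  rewrite /GRing.scale /= /b' /root4 -/(root4 s); have := root4_gt0 s0; rewrite /root4 => r0.
  by field; rewrite !gt_eqF.
apply: (@flow_conserves R n b b' T _ cb db b'0 b0 bT _ _ X XP _ T0).
- move=> s x y /andP[s0 sT]; have [_ H _] := HM s s0.
  rewrite (le_trans (H x y))// ler_wpM2r// ler_wpM2r ?invr_ge0 ?sqrtr_ge0//.
  rewrite ler_pdivlMr ?root4_gt0// ler_wpM2l// (le_trans (root4_le sT))//.
  by rewrite lerDl.
- move=> s x v w /andP[s0 sT]; have [_ _ H] := HM s s0.
  rewrite (le_trans (H x v w))// -/(root4 s).
  have -> : M * (Num.sqrt s)^-1 * (`|v| * ((1 + (root4 s)^-1) * Num.sqrt `|w|)) =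
    M * (1 + (root4 s)^-1) * (Num.sqrt s)^-1 * (`|v| * Num.sqrt `|w|) by ring.
  rewrite ler_wpM2r ?mulr_ge0 ?sqrtr_ge0// ler_wpM2r ?invr_ge0 ?sqrtr_ge0//.
  rewrite ler_pdivlMr ?root4_gt0// -mulrA ler_wpM2l//.
  by rewrite mulrDl mul1r mulVf ?gt_eqF ?root4_gt0// lerD2r root4_le.
move=> d d0.
pose N := (Num.truncn (b T / d)).+1.
have NP : b T <= N%:R * d.
  rewrite -ler_pdivrMr// ltW//; have /andP[_] := truncn_itv (divr_ge0 (b0 T) (ltW d0)).
  by [].
have N0 : 0 < N%:R :> R by rewrite ltr0n.
(* This choice makes [b], which is proportional to the fourth root, equidistant. *)
pose tau (k : nat) := T * (k%:R / N%:R) ^+ 4.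
have btau k : b (tau k) = b T / N%:R * k%:R.
  have kN : 0 <= k%:R / N%:R :> R by rewrite divr_ge0.
  have -> : b (tau k) = 4 * C * (root4 T * (k%:R / N%:R)).
    congr (_ * _); rewrite /tau; move: (k%:R / N%:R) kN => x x0.
    have -> : x ^+ 4 = (x ^+ 2) ^+ 2 by rewrite -exprM.
    rewrite /root4 (sqrtrM _ (ltW T0)) sqrtr_sqr (ger0_norm (sqr_ge0 _)).
    by rewrite (sqrtrM _ (sqrtr_ge0 _)) sqrtr_sqr (ger0_norm x0).
  by rewrite /b; field; rewrite gt_eqF.
exists N, tau; split.
- by rewrite /tau mul0r expr0n mulr0.
- by rewrite /tau mulfV ?gt_eqF// expr1n mulr1.
- by move=> k; rewrite /tau mulr_gt0// exprn_gt0// divr_gt0.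
- move=> k; rewrite /tau ler_pM2l// lerXn2r ?nnegrE ?divr_ge0//.
  by rewrite ler_wpM2r ?invr_ge0 ?(ltW N0)// ler_nat.
- move=> k; rewrite !btau -mulrBr -natr1 addrC addKr mulr1.
  by rewrite ler_pdivrMr// mulrC.
Qed.

End hopf_cole_flow.

(** * Lipschitz bound from a weak derivative *)

Section smooth_mollifier.
Context {R : realType}.

Fixpoint diffk (k : nat) (f : R -> R) : Prop :=
  if k is k'.+1 then exists2 g, (forall s : R, is_derive s 1 f (g s)) & diffk k' g else True.

Lemma diffkS k f : diffk k.+1 f -> diffk k f.
Proof. by elim: k f => //= k IH f [g fg [g' gg' kg']]; exists g => //; apply: IH; exists g'. Qed.

Lemma diffkD k f g : diffk k f -> diffk k g -> diffk k (f \+ g).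
Proof.
elim: k f g => //= k IH f g [f' ff' kf'] [g' gg' kg']; exists (f' \+ g'); last exact: IH.
by move=> s; apply: is_deriveD.
Qed.

Lemma diffkM k f g : diffk k f -> diffk k g -> diffk k (f \* g).
Proof.
elim: k f g => //= k IH f g kf kg.
have [f' ff' kf'] := kf; have [g' gg' kg'] := kg.
exists ((f \* g') \+ (f' \* g)).
  move=> s; apply: (is_derive_eq (is_deriveM (ff' s) (gg' s))).
  by rewrite /GRing.scale /= [g s * _]mulrC.
apply: diffkD; apply: IH => //; first exact: diffkS kf.
exact: diffkS kg.
Qed.

Lemma diffk_cst k c : diffk k (fun=> c).
Proof. by elim: k c => //= k IH c; exists (fun=> 0) => // s; exact: is_derive_cst. Qed.

Lemma diffk_affine k f a b : diffk k f -> diffk k (fun s => f (a * s + b)).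
Proof.
elim: k f => //= k IH f [g fg kg].
exists ((fun=> a) \* (fun s => g (a * s + b))); last first.
  by apply: diffkM; [exact: diffk_cst|exact: IH].
move=> s.
have H : is_derive s 1 (fun s => a * s + b) a.
  apply: (is_derive_eq (is_deriveD (is_deriveZ a (is_derive_id s (1 : R))) (is_derive_cst b s 1))).
  by rewrite addr0 /GRing.scale /= mulr1.
apply: (is_derive_eq (@is_derive1_comp _ f (fun s => a * s + b) s _ _ (fg _) H)).
by rewrite mulrC.
Qed.

(** For [k = 0] this is the classical smooth function that is flat at 0. The powers of the inverse
    make the family closed under derivation up to linear combinations, so smoothness is an induction
    on the order. *)
Definition flat (k : nat) (s : R) : R := if 0 < s then s^-1 ^+ k * expR (- s^-1) else 0.

(** The [k]-th power of y / k <= exp (y / k). *)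
Lemma expr_le_expR (y : R) k : 0 <= y -> y ^+ k <= k%:R ^+ k * expR y.
Proof.
move=> y0; case: k => [|k]; first by rewrite !expr0 mul1r -expR0 ler_expR.
have k0 : 0 < k.+1%:R :> R by rewrite ltr0n.
have -> : expR y = expR (y / k.+1%:R) ^+ k.+1.
  by rewrite -expRM_natl mulrC divfK// gt_eqF.
rewrite -exprMn lerXn2r ?nnegrE ?mulr_ge0 ?expR_ge0//.
rewrite -ler_pdivrMl// mulrC.
by apply: le_trans (expR_ge1Dx _); rewrite lerDr.
Qed.

Lemma flat_ge0 k s : 0 <= flat k s.
Proof.
by rewrite /flat; case: ifP => // s0; rewrite mulr_ge0 ?expR_ge0// exprn_ge0// invr_ge0 ltW.
Qed.

Lemma flat_le k s : 0 < s -> flat k s <= k.+2%:R ^+ k.+2 * s ^+ 2.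
Proof.
move=> s0; rewrite /flat s0 expRN ler_pdivrMr ?expR_gt0//.
have := @expr_le_expR s^-1 k.+2; rewrite invr_ge0 => /(_ (ltW s0)).
rewrite -[in s^-1 ^+ k.+2]addn2 exprD => H.
rewrite -mulrA mulrCA mulrC -ler_pdivrMr ?exprn_gt0// -exprVn.
by rewrite (le_trans H).
Qed.

Lemma is_derive_flat k (s : R) : is_derive s 1 (flat k) (flat k.+2 s - k%:R * flat k.+1 s).
Proof.
have [s0|s0|<-] := ltgtP 0 s.
- apply: (@near_eq_is_derive _ _ _ (fun t : R => t^-1 ^+ k * expR (- t^-1))).
    near=> t => /=; rewrite /flat; have -> : 0 < t by near: t; exact: lt_nbhsr.
    by [].
  have sN0 : s != 0 by rewrite gt_eqF.
  have dV : is_derive s 1 (fun t : R => t^-1) (- s ^- 2).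
    apply: (is_derive_eq (is_deriveV sN0 (is_derive_id s (1 : R)))).
    by rewrite /GRing.scale /= mulr1.
  have dE : is_derive s 1 (fun t : R => expR (- t^-1)) (s ^- 2 * expR (- s^-1)).
    apply: (is_derive_eq (@is_derive1_comp _ expR (fun t : R => - t^-1) s _ _ (is_derive_expR _) (is_deriveN dV))).
    by rewrite opprK mulrC.
  have dX : is_derive s 1 (fun t : R => t^-1 ^+ k) (k%:R * s^-1 ^+ k.-1 *: - s ^- 2).
    have -> : (fun t : R => t^-1 ^+ k) = (fun t : R => t^-1) ^+ k by rewrite exprfctE.
    exact: is_deriveX.
  apply: (is_derive_eq (is_deriveM dX dE)).
  rewrite /flat s0 /GRing.scale /= -!exprVn.
  case: k dX => [|k] _; first by rewrite !mulr0n !mul0r !mulr0 expr0 subr0 addr0 mul1r.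
  by rewrite /= !exprS; ring.
- apply: (@near_eq_is_derive _ _ _ (cst 0)).
    near=> t; rewrite /flat ltNge (_ : t <= 0)//.
    by apply: ltW; near: t; exact: lt_nbhsl.
  by rewrite /flat ltNge (ltW s0) /= mulr0 subr0; exact: is_derive_cst.
- rewrite /flat ltxx mulr0 subr0; apply: cvg_is_derive.
  apply/cvgrPdist_le => e e0.
  pose C : R := k.+2%:R ^+ k.+2.
  have C0 : 0 < C by rewrite exprn_gt0.
  near=> h.
  have h0 : h != 0 by near: h; exact: nbhs_dnbhs_neq.
  have hC : `|h| <= e / C by near: h; apply: dnbhs0_le; rewrite divr_gt0.
  rewrite /= sub0r normrN addr0 ltxx subr0 /GRing.scale /= mulr1.
  case: ifP => [hp|_]; last by rewrite mulr0 normr0 ltW.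
  rewrite ger0_norm; last by rewrite mulr_ge0 ?invr_ge0 ?(ltW hp)// mulr_ge0 ?expR_ge0 ?exprn_ge0 ?invr_ge0 ?ltW.
  have := flat_le k hp; rewrite /flat hp => H.
  rewrite ler_pdivrMl//; apply: (le_trans H).
  rewrite (gtr0_norm hp) ler_pdivlMr// in hC.
  by rewrite expr2 mulrCA ler_pM2l// mulrC.
Unshelve. all: by end_near.
Qed.

Lemma diffk_flat m k : diffk m (flat k).
Proof.
elim: m k => //= m IH k; exists (flat k.+2 \+ (fun=> - k%:R) \* flat k.+1).
  by move=> s; apply: (is_derive_eq (is_derive_flat k s)); rewrite /= mulNr.
by apply: diffkD => //; apply: diffkM => //; exact: diffk_cst.
Qed.

(* Supported in [-d, d] and not normalized. *)
Definition mollifier (d s : R) : R := flat 0 (1 * s + d) * flat 0 (- 1 * s + d).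

Lemma diffk_mollifier k d : diffk k (mollifier d).
Proof. by apply: diffkM; apply: diffk_affine; exact: diffk_flat. Qed.

Lemma mollifier_ge0 d s : 0 <= mollifier d s.
Proof. by rewrite mulr_ge0 ?flat_ge0. Qed.

Lemma mollifier_le1 d s : mollifier d s <= 1.
Proof.
have F t : flat 0 t <= 1.
  rewrite /flat; case: ifP => // t0; rewrite expr0 mul1r -expR0 ler_expR oppr_le0 invr_ge0.
  exact: ltW.
by rewrite -[leRHS](mulr1 1) ler_pM ?flat_ge0.
Qed.

Lemma mollifier_eq0 d s : d <= `|s| -> mollifier d s = 0.
Proof.
rewrite /mollifier /flat ler_normr => /orP[ds|ds].
  by rewrite [X in _ * X]ifF ?mulr0// ltNge -[~~ _]/(~~ _); apply/negbTE; rewrite negbK; lra.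
by rewrite ifF ?mul0r//; apply/negbTE; rewrite -leNgt; lra.
Qed.

Lemma mollifier_gt0 d s : `|s| < d -> 0 < mollifier d s.
Proof.
rewrite ltr_norml => /andP[sd1 sd2]; rewrite /mollifier /flat.
have -> : 0 < 1 * s + d by lra.
have -> : 0 < - 1 * s + d by lra.
by rewrite !expr0 !mul1r mulr_gt0 ?expR_gt0.
Qed.

Lemma diffk_continuous f : diffk 1 f -> continuous f.
Proof.
move=> [g fg _] x; apply: differentiable_continuous; apply/derivable1_diffP.
by have [] := fg x.
Qed.

End smooth_mollifier.

(** * Products of functions of one coordinate *)

Section product_functions.
Context {R : realType}.

(** The shape is kept by partial derivatives, which act on a single factor, and integrals factor as
    well. Test functions and their integrals thus reduce to one variable. *)
Definition prodf n (F : 'I_n -> R -> R) (x : 'rV[R]_n) : R := \prod_i F i (x ord0 i).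

Lemma continuous_prodf n (F : 'I_n -> R -> R) : (forall i, continuous (F i)) -> continuous (prodf F).
Proof.
move=> cF; apply: (@continuous_big R 'I_n *%R 1 xpredT); first exact: mul_continuous.
move=> i _ x; apply: (@continuous_comp _ _ _ (fun z : 'rV[R]_n => z ord0 i) (F i) x).
  exact: coord_continuous.
exact: cF.
Qed.

Lemma is_derive_prodf n (F : 'I_n -> R -> R) i (g : R -> R) (x : 'rV[R]_n) :
  (forall s : R, is_derive s 1 (F i) (g s)) ->
  is_derive x (delta_mx ord0 i) (prodf F) (prodf (fun j => if j == i then g else F j) x).
Proof.
move=> dF; pose P := \prod_(j | j != i) F j (x ord0 j).
have -> : prodf (fun j => if j == i then g else F j) x = P * g (x ord0 i).
  rewrite /prodf (bigD1 i)//= eqxx mulrC; congr (_ * _).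
  by apply: eq_bigr => j /negbTE ->.
have H : h^-1 *: (prodf F (h *: delta_mx ord0 i + x) - prodf F x) @[h --> (0 : R)^'] -->
    P * g (x ord0 i).
  have := cvgM (cvg_cst P) (is_derive_cvg (dF (x ord0 i))).
  move=> /(_ _ _); apply: cvg_trans; apply: near_eq_cvg; near=> h.
  rewrite /= /GRing.scale /= mulrCA mulrBr; congr (_ * (_ - _)).
    rewrite /prodf [RHS](bigD1 i)//= !mxE !eqxx mulrC mulr1; congr (_ * _).
    by apply: eq_bigr => j ji; rewrite !mxE (negbTE ji) andbF mulr0 add0r.
  by rewrite /prodf [RHS](bigD1 i)//= mulrC.
apply: DeriveDef; first by apply/cvg_ex; eexists; exact: H.
exact: cvg_lim H.
Unshelve. all: by end_near.
Qed.

Lemma Ck_prodf N n (F : 'I_n -> R -> R) : (forall i, diffk N.+1 (F i)) -> Ck N (prodf F).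
Proof.
elim: N F => [|N IH] F dF.
  by apply: continuous_prodf => i; exact: diffk_continuous.
split => [|i].
  apply: continuous_prodf => i; apply: diffk_continuous.
  by have [g dg _] := dF i; exists g.
have [g Fg dg] := dF i.
split => [x|]; first by have [] := is_derive_prodf x Fg.
have -> : partial i (prodf F) = prodf (fun j => if j == i then g else F j).
  by apply/funext => x; rewrite /partial; have [_ ->] := is_derive_prodf x Fg.
apply: IH => j; case: ifP => // _.
exact: diffkS (dF j).
Qed.

Lemma prodf_ge0 n (F : 'I_n -> R -> R) x : (forall i s, 0 <= F i s) -> 0 <= prodf F x.
Proof. by move=> F0; rewrite prodr_ge0. Qed.

Lemma prodf_rVcons n (F : 'I_n.+1 -> R -> R) (a : R) (v : 'rV[R]_n) :
  prodf F (rVcons (a, v)) = F ord0 a * prodf (fun i => F (lift ord0 i)) v.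
Proof.
rewrite /prodf big_ord_recl rVcons_ord0; congr (_ * _).
apply: eq_bigr => i _; congr (F _ _).
have -> : lift ord0 i = rshift 1 i :> 'I_(1 + n) by exact/val_inj.
by rewrite /rVcons /= (row_mxEr a%:M).
Qed.

Lemma ge0_integral_prodf n (F : 'I_n -> R -> R) (c : 'I_n -> R) :
  (forall i, continuous (F i)) -> (forall i s, 0 <= F i s) ->
  (forall i, \int[@lebesgue_measure R]_s (F i s)%:E = (c i)%:E)%E ->
  (\int[lebesgue_rV R n]_x (prodf F x)%:E = (\prod_i c i)%:E)%E.
Proof.
elim: n F c => [|n IH] F c cF F0 Fc.
  rewrite ge0_integral_rV0.
    by rewrite /prodf !big_ord0.
  by apply/measurable_EFinP; apply: continuous_measurable_rV; exact: continuous_prodf.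
have m m' (G : 'I_m' -> R -> R) : (forall i, continuous (G i)) ->
    measurable_fun [set: 'rV[R]_m'] (fun x => (prodf G x)%:E).
  by move=> cG; apply/measurable_EFinP; apply: continuous_measurable_rV; exact: continuous_prodf.
rewrite (ge0_integral_rVS (m n.+1 F cF)); last by move=> x; rewrite lee_fin prodf_ge0.
have c0 i : 0 <= c i.
  by rewrite -lee_fin -Fc; apply: integral_ge0 => s _; rewrite lee_fin.
transitivity (\int[@lebesgue_measure R]_a
    ((F ord0 a)%:E * (\prod_(i < n) c (lift ord0 i))%:E))%E.
  apply: eq_integral => a _.
  rewrite -(IH (fun i => F (lift ord0 i))) // -ge0_integralZl ?lee_fin//.
  - by apply: eq_integral => v _; rewrite prodf_rVcons EFinM.
  - exact: m.
  - by move=> v _; rewrite lee_fin prodf_ge0.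
rewrite ge0_integralZr//.
- by rewrite Fc big_ord_recl EFinM.
- by apply/measurable_EFinP; apply: continuous_measurable_fun.
- by move=> s _; rewrite lee_fin.
- by rewrite lee_fin prodr_ge0.
Qed.

End product_functions.

(** * The primitive of a mollifier *)

Section mollifier_primitive.
Context {R : realType} (d : R) (d0 : 0 < d).
Notation mu := (@lebesgue_measure R).

Lemma integrable_mollifier : mu.-integrable setT (EFin \o mollifier d).
Proof.
have cb : continuous (mollifier d) by apply: diffk_continuous; exact: diffk_mollifier.
apply: (@le_integrable _ _ _ mu _ measurableT _ (EFin \o \1_`[-d, d])).
- by apply/measurable_EFinP; exact: continuous_measurable_fun.
- move=> s _; rewrite /= lee_fin !ger0_norm ?mollifier_ge0//.
  rewrite indicE; case: (boolP (_ \in _)) => [_|/negP H]; first exact: mollifier_le1.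
  rewrite mollifier_eq0// leNgt; apply/negP => sd; apply: H; rewrite inE /= in_itv /=.
  by rewrite -ler_norml ltW.
- exact: integrable_indic_itv.
Qed.

Definition mollifier_mass : R := \int[mu]_s mollifier d s.

Definition mollifier_primitive (s : R) : R := \int[mu]_(t in `]-oo, s]) mollifier d t.

Lemma integral_mollifier : (\int[mu]_s (mollifier d s)%:E = mollifier_mass%:E)%E.
Proof.
rewrite /mollifier_mass /Rintegral fineK//.
exact: integrable_fin_num integrable_mollifier.
Qed.

Lemma is_derive_mollifier_primitive (s : R) : is_derive s 1 mollifier_primitive (mollifier d s).
Proof.
have s1 : s < s + 1 by rewrite ltrDl.
have cb : continuous (mollifier d) by apply: diffk_continuous; exact: diffk_mollifier.
have [|//|//|D1 D2] := @continuous_FTC1 R (mollifier d) -oo%O s (s + 1) s1 _ _ _.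
- exact: integrableS integrable_mollifier.
- exact: ltNyr.
- exact: cb.
- by apply: DeriveDef => //; rewrite -derive1E.
Qed.

Lemma diffk_mollifier_primitive k : diffk k mollifier_primitive.
Proof.
case: k => // k; exists (mollifier d); first exact: is_derive_mollifier_primitive.
exact: diffk_mollifier.
Qed.

Lemma mollifier_primitive_le s t : s <= t -> mollifier_primitive s <= mollifier_primitive t.
Proof.
move=> st; rewrite /mollifier_primitive /Rintegral fine_le//.
- by apply: integrable_fin_num => //; exact: integrableS integrable_mollifier.
- by apply: integrable_fin_num => //; exact: integrableS integrable_mollifier.
- apply: ge0_subset_integral => //.
  + apply: measurable_funS (measurable_int _ integrable_mollifier) => //.
  + by move=> x _; rewrite lee_fin mollifier_ge0.
  + by move=> x /=; rewrite !in_itv /= => /le_trans; apply.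
Qed.

Lemma mollifier_primitive_left s : s <= - d -> mollifier_primitive s = 0.
Proof.
move=> sd; rewrite /mollifier_primitive /Rintegral integral0_eq// => t /=.
rewrite in_itv /= => ts; congr (_%:E).
by rewrite mollifier_eq0// ler_normr; apply/orP; right; lra.
Qed.

Lemma mollifier_primitive_right s : d <= s -> mollifier_primitive s = mollifier_mass.
Proof.
move=> sd; rewrite /mollifier_primitive Rintegral_mkcond; apply: eq_Rintegral => t _.
rewrite patchE; case: ifPn => // /negP H; rewrite mollifier_eq0//.
rewrite (le_trans sd)// (le_trans _ (ler_norm _))// leNgt; apply/negP => ts.
by apply: H; rewrite inE /= in_itv /= ltW.
Qed.

Lemma mollifier_primitive_ge0 s : 0 <= mollifier_primitive s.
Proof. by apply: Rintegral_ge0 => t _; exact: mollifier_ge0. Qed.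

Lemma mollifier_primitive_le_mass s : mollifier_primitive s <= mollifier_mass.
Proof.
have [/mollifier_primitive_right ->//|sd] := leP d s.
by rewrite -(mollifier_primitive_right (lexx d)) mollifier_primitive_le// ltW.
Qed.

(** Otherwise the primitive, which lies between 0 and the mass, would be constant, while its
    derivative at 0 is positive. *)
Lemma mollifier_mass_gt0 : 0 < mollifier_mass.
Proof.
have mass0 : 0 <= mollifier_mass by apply: Rintegral_ge0 => t _; exact: mollifier_ge0.
rewrite lt_neqAle mass0 andbT; apply/eqP => E.
have P0 : mollifier_primitive = cst 0.
  apply/funext => s; apply/eqP; rewrite eq_le mollifier_primitive_ge0 andbT.
  by rewrite E mollifier_primitive_le_mass.
have [_ D1] := is_derive_mollifier_primitive 0.
have := mollifier_gt0 (d := d) (s := 0); rewrite normr0 => /(_ d0).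
by rewrite -D1 P0 derive_cst ltxx.
Qed.

End mollifier_primitive.

Lemma Lfun_oo_bounded d (T : measurableType d) (R : realType) (mu : {measure set T -> \bar R})
    (f : T -> R) : f \in Lfun mu +oo%E ->
  measurable_fun setT f /\ exists2 M, 0 <= M & {ae mu, forall x, `|f x| <= M}.
Proof.
move=> /andP[/= mf ff]; split; first by move: mf; rewrite inE.
move: ff; rewrite inE /= /finite_norm unlock.
case: ifPn => [_ /ess_supr_bounded[M fM]|]; last first.
  (* The whole space is a null set here, so any bound holds almost everywhere. *)
  rewrite -leNgt => mu0 _; exists 0 => //.
  exists setT; split => //; apply/eqP.
  by rewrite eq_le mu0 measure_ge0.
by exists `|M| => //; apply: filterS fM => x /le_trans; apply; exact: ler_norm.
Qed.

(** * From a bounded weak derivative to a Lipschitz bound on the first axis *)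

Section weak_partial_lipschitz.
Context {R : realType} {m : nat}.
Notation mu := (lebesgue_rV R m.+1).
Notation e0 := (delta_mx ord0 ord0 : 'rV[R]_m.+1).

Definition axial (d : R) (f : R -> R) (i : 'I_m.+1) : R -> R :=
  if i == ord0 then f else mollifier d.

Lemma prodf_axial d f (x : 'rV[R]_m.+1) : prodf (axial d f) x =
  f (x ord0 ord0) * \prod_(i < m.+1 | i != ord0) mollifier d (x ord0 i).
Proof.
rewrite /prodf (bigD1 ord0)//= /axial eqxx; congr (_ * _).
by apply: eq_bigr => i /negbTE ->.
Qed.

Lemma prodf_axialB d f g (x : 'rV[R]_m.+1) :
  prodf (axial d (f \- g)) x = prodf (axial d f) x - prodf (axial d g) x.
Proof. by rewrite !prodf_axial mulrBl. Qed.

Lemma continuous_axial d f : continuous f -> continuous (prodf (axial d f)).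
Proof.
move=> cf; apply: continuous_prodf => i; rewrite /axial; case: ifP => // _.
by apply: diffk_continuous; exact: diffk_mollifier.
Qed.

Lemma prodf_axial_ge0 d f x : (forall s, 0 <= f s) -> 0 <= prodf (axial d f) x.
Proof.
move=> f0; apply: prodf_ge0 => i s; rewrite /axial; case: ifP => // _.
exact: mollifier_ge0.
Qed.

Lemma prodf_axial_neq0 d f (r a : R) (x : 'rV[R]_m.+1) : 0 <= r -> d <= r ->
  (forall s, r < `|s - a| -> f s = 0) -> prodf (axial d f) x != 0 -> `|x - a *: e0| <= r.
Proof.
move=> r0 dr fr xn; apply: mx_norm_le => // i j; rewrite (ord1 i) !mxE eqxx /=.
rewrite leNgt; apply/negP => H; move/negP: xn; apply; apply/eqP.
have [j0|j0] := eqVneq j ord0.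
  by move: H; rewrite j0 eqxx mulr1 => H; rewrite prodf_axial fr// mul0r.
move: H; rewrite (negbTE j0) mulr0 subr0 => H.
rewrite prodf_axial (bigD1 j)//= mollifier_eq0 ?mul0r ?mulr0//.
by rewrite (le_trans dr)// ltW.
Qed.

Lemma ge0_integral_axial (d : R) (f : R -> R) (c : R) : 0 < d -> continuous f -> (forall s, 0 <= f s) ->
  (\int[@lebesgue_measure R]_s (f s)%:E = c%:E)%E ->
  (\int[mu]_x (prodf (axial d f) x)%:E = (c * mollifier_mass d ^+ m)%:E)%E.
Proof.
move=> d0 cf f0 fc.
rewrite (@ge0_integral_prodf R _ (axial d f)
  (fun i => if i == ord0 then c else mollifier_mass d)).
- by rewrite big_ord_recl /= big_const_ord iter_mulr_1.
- by move=> i; rewrite /axial; case: ifP => // _; apply: diffk_continuous; exact: diffk_mollifier.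
- by move=> i s; rewrite /axial; case: ifP => // _; exact: mollifier_ge0.
- by move=> i; rewrite /axial; case: ifP => // _; rewrite integral_mollifier.
Qed.

(** On the ball of radius [r] the Gaussian of rate 1 is at least [expR (- (m.+1%:R * r ^+ 2))], so
    [f] lies below a multiple of it. *)
Lemma compact_support_integrable (r : R) (f : 'rV[R]_m.+1 -> R) :
  continuous f -> (exists C, forall x, `|f x| <= C) -> (forall x, f x != 0 -> `|x| <= r) ->
  mu.-integrable setT (EFin \o f).
Proof.
move=> cf [C fC] fr.
apply: (@gauss_bound_integrable R m.+1 1 (C * expR (m.+1%:R * r ^+ 2))) => // z.
have C0 : 0 <= C by rewrite (le_trans _ (fC 0)).
have [->|fz] := eqVneq (f z) 0; first by rewrite normr0 !mulr_ge0 ?expR_ge0.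
rewrite (le_trans (fC z))// -mulrA ler_peMr// /gauss -expRD mul1r -[leLHS]expR0 ler_expR.
rewrite subr_ge0 /sumsq mulr_natl -[in leRHS](card_ord m.+1) -sumr_const; apply: ler_sum => i _.
rewrite -real_normK ?num_real// lerXn2r ?nnegrE ?(le_trans _ (fr z fz))//.
by rewrite (le_trans (mx_norm_entry _ _ _))// fr.
Qed.

Lemma compact_support_test_function (r : R) (F : 'I_m.+1 -> R -> R) :
  (forall i k, diffk k (F i)) -> (forall x, prodf F x != 0 -> `|x| <= r) ->
  test_function (prodf F).
Proof.
move=> dF Fr; split => [k|]; first exact: Ck_prodf.
pose K := [set v : 'rV[R]_m.+1 | forall i, `[-r, r]%classic (v ord0 i)].
have cK : compact K.
  by apply: (@rV_compact R m.+1 (fun=> `[-r, r]%classic)) => i; exact: segment_compact.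
have clK : closed K.
  by apply: compact_closed => //; exact: norm_hausdorff.
apply: (subclosed_compact (@closed_closure _ _) cK).
rewrite [X in _ `<=` X](closure_id K).1//; apply: closureS => x /= /Fr xr i.
by rewrite /= in_itv /= -ler_norml (le_trans (mx_norm_entry _ _ _)).
Qed.

Section slab.
Variables (d : R) (d0 : 0 < d).
Implicit Types a h s w C M : R.
Notation c := (mollifier_mass d).

(** Written as [1 * s + - a] so that [diffk_affine] applies syntactically. *)
Definition shifted_mollifier (a s : R) : R := mollifier d (1 * s + - a).

Definition slab (a h s : R) : R :=
  mollifier_primitive d (1 * s + - a) - mollifier_primitive d (1 * s + - (a + h)).

Let psi a := prodf (axial d (shifted_mollifier a)).

Lemma diffk_shifted_mollifier k a : diffk k (shifted_mollifier a).
Proof. by apply: diffk_affine; exact: diffk_mollifier. Qed.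

Lemma diffk_slab k a h : diffk k (slab a h).
Proof.
have -> : slab a h = (fun s => mollifier_primitive d (1 * s + - a)) \+
    ((fun=> -1) \* (fun s => mollifier_primitive d (1 * s + - (a + h)))).
  by apply/funext => s; rewrite /slab /= mulN1r.
apply: diffkD; first by apply: diffk_affine; exact: diffk_mollifier_primitive.
apply: diffkM; first exact: diffk_cst.
by apply: diffk_affine; exact: diffk_mollifier_primitive.
Qed.

Lemma is_derive_slab a h (s : R) : is_derive s 1 (slab a h)
  ((shifted_mollifier a \- shifted_mollifier (a + h)) s).
Proof.
have H b : is_derive s 1 (fun s => mollifier_primitive d (1 * s + - b)) (shifted_mollifier b s).
  have A1 : is_derive s 1 (fun s : R => 1 * s + - b) 1.
    apply: (is_derive_eq (is_deriveD (is_deriveZ 1 (is_derive_id s (1 : R))) (is_derive_cst (- b) s 1))).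
    by rewrite addr0 /GRing.scale /= mulr1.
  apply: (is_derive_eq (@is_derive1_comp _ (mollifier_primitive d) (fun s => 1 * s + - b) s _ _
    (is_derive_mollifier_primitive d _) A1)).
  by rewrite mulr1.
exact: is_deriveB.
Qed.

Lemma slab_ge0 a h s : 0 <= h -> 0 <= slab a h s.
Proof. by move=> h0; rewrite subr_ge0 mollifier_primitive_le//; lra. Qed.

Lemma slab_le_mass a h s : slab a h s <= c.
Proof.
by rewrite lerBlDr (le_trans (mollifier_primitive_le_mass _ _))// lerDl mollifier_primitive_ge0.
Qed.

Lemma slab_eq0 a h s : 0 <= h -> ~~ (a - d <= s <= a + h + d) -> slab a h s = 0.
Proof.
move=> h0; rewrite negb_and -!ltNge /slab => /orP[sa|sa].
  by rewrite !mollifier_primitive_left ?subrr//; lra.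
by rewrite !mollifier_primitive_right ?subrr//; lra.
Qed.

(** The slab has height at most [c] and lives on an interval of length [h + 2 * d]. The surplus
    [2 * d] is harmless, as [d] will be small. *)
Lemma integral_slab a h : 0 <= h -> exists2 b,
  (\int[@lebesgue_measure R]_s (slab a h s)%:E = b%:E)%E & b <= c * (h + 2 * d).
Proof.
move=> h0; have cs : continuous (slab a h) by apply: diffk_continuous; exact: diffk_slab.
pose f := fun s : R => c * \1_`[a - d, a + h + d] s.
have If : (@lebesgue_measure R).-integrable setT (EFin \o f).
  exact: integrableZl (integrable_indic_itv _ _ _ _).
have sf s : slab a h s <= f s.
  rewrite /f indicE; case: (boolP (_ \in _)) => [_|H].
    by rewrite mulr1 slab_le_mass.
  rewrite mulr0 slab_eq0//; apply/negP => H'; move/negP: H; apply.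
  by rewrite inE /= in_itv.
have Is : (@lebesgue_measure R).-integrable setT (EFin \o slab a h).
  apply: (le_integrable _ _ _ If) => //.
    by apply/measurable_EFinP; exact: continuous_measurable_fun.
  move=> s _; rewrite /= lee_fin ger0_norm ?slab_ge0// (le_trans (sf s))//.
  exact: ler_norm.
exists (\int[@lebesgue_measure R]_s slab a h s).
  rewrite /Rintegral fineK//; exact: integrable_fin_num Is.
rewrite (le_trans (le_Rintegral _ Is If _))//.
rewrite RintegralZl//; last exact: integrable_indic_itv.
rewrite ler_wpM2l//.
  by apply: Rintegral_ge0 => s _; exact: mollifier_ge0.
rewrite /Rintegral integral_indic//= setIT lebesgue_measure_itv /= lte_fin.
case: ifP => _ /=; first by lra.
by rewrite addr_ge0 ?mulr_ge0 ?(ltW d0).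
Qed.

Lemma integral_shifted_mollifier a :
  (\int[@lebesgue_measure R]_s (shifted_mollifier a s)%:E = c%:E)%E.
Proof.
have cb : continuous (mollifier d) by apply: diffk_continuous; exact: diffk_mollifier.
have mb : measurable_fun [set: measurableTypeR R] (fun s => (mollifier d s)%:E).
  by apply/measurable_EFinP; exact: continuous_measurable_fun.
rewrite -integral_mollifier//.
rewrite -[RHS](@ge0_integral_slope R (fun s => 1 * s + - a) (fun _ _ => 1) 1)//.
- by apply: eq_integral => s _; rewrite mule1.
- by move=> x y; rewrite mulr1; ring.
- by move=> p; exact: for_continuous_cst.
- by move=> s; rewrite lee_fin mollifier_ge0.
Qed.

Lemma prodf_shifted_neq0 a x : psi a x != 0 -> `|x - a *: e0| <= d.
Proof.
apply: prodf_axial_neq0 => //; first exact: ltW.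
by move=> s ds; rewrite /shifted_mollifier mollifier_eq0// mul1r ltW.
Qed.

Lemma integrable_mul_shifted (phi : 'rV[R]_m.+1 -> R) C a :
  continuous phi -> (forall x, `|phi x| <= C) ->
  mu.-integrable setT (fun x => (phi x * psi a x)%:E).
Proof.
move=> cphi phiC; apply: (@compact_support_integrable (`|a| + d) (phi \* psi a)).
- move=> x; apply: (@continuousM _ _ phi (psi a)); first exact: cphi.
  apply: continuous_axial; apply: diffk_continuous; exact: diffk_shifted_mollifier.
- exists C => x; rewrite /= normrM (le_trans _ (phiC x))// ler_piMr// ger0_norm.
    rewrite /psi /prodf; apply: prodr_ile1 => i _; rewrite /axial.
    by case: ifP => _; rewrite mollifier_ge0 mollifier_le1.
  by apply: prodf_axial_ge0 => s; exact: mollifier_ge0.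
- move=> x; rewrite /= mulf_eq0 negb_or => /andP[_ /prodf_shifted_neq0 xa].
  have -> : x = a *: e0 + (x - a *: e0) by rewrite addrC subrK.
  by rewrite (le_trans (ler_normD _ _))// normrZ norm_delta_rV mulr1 lerD2l.
Qed.

Lemma mollifier_concentrates (phi : 'rV[R]_m.+1 -> R) C w a :
  continuous phi -> (forall x, `|phi x| <= C) ->
  (forall x, `|x - a *: e0| <= d -> `|phi x - phi (a *: e0)| <= w) ->
  `|\int[mu]_x (phi x * psi a x) - phi (a *: e0) * c ^+ m.+1| <= w * c ^+ m.+1.
Proof.
move=> cphi phiC phiw.
have cshift : continuous (shifted_mollifier a).
  by apply: diffk_continuous; exact: diffk_shifted_mollifier.
have Ic k : mu.-integrable setT (fun x => (k * psi a x)%:E).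
  apply: (@integrable_mul_shifted (fun=> k) `|k|) => //.
  by move=> x; exact: for_continuous_cst.
have mass : \int[mu]_x psi a x = c ^+ m.+1.
  rewrite /Rintegral (@ge0_integral_axial d _ c) -?exprS//.
    by move=> s; exact: mollifier_ge0.
  exact: integral_shifted_mollifier.
have massZ k : \int[mu]_x (k * psi a x) = k * c ^+ m.+1.
  rewrite RintegralZl ?mass//.
  by have := Ic 1; apply: eq_integrable => // x _; rewrite mul1r.
rewrite -!massZ -RintegralB//; [|exact: integrable_mul_shifted cphi phiC|exact: Ic].
have Iw : mu.-integrable setT (fun x => (phi x * psi a x - phi (a *: e0) * psi a x)%:E).
  have := integrableB measurableT (integrable_mul_shifted a cphi phiC) (Ic (phi (a *: e0))).
  by apply: eq_integrable.
rewrite (le_trans (le_normr_Rintegral _ Iw))//.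
apply: le_Rintegral => //; first exact: integrable_norm.
  exact: Ic.
move=> x _; rewrite -mulrBl normrM.
have psi0 : 0 <= psi a x by apply: prodf_axial_ge0 => s; exact: mollifier_ge0.
rewrite (ger0_norm psi0); have [->|/prodf_shifted_neq0 xa] := eqVneq (psi a x) 0.
  by rewrite !mulr0.
by rewrite ler_wpM2r// phiw.
Qed.

(** The test function [chi] has first partial derivative [psi a - psi (a + h)], so the left side is
    the integral of [g] against [chi]. One factor [c] comes from the height of the slab, the other
    [m] from the transversal mollifiers. *)
Lemma weak_partial_slab (phi g : 'rV[R]_m.+1 -> R) C M a h :
  continuous phi -> (forall x, `|phi x| <= C) -> weak_partial ord0 phi g ->
  measurable_fun setT g -> {ae mu, forall x, `|g x| <= M} -> 0 <= M -> 0 <= h ->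
  `|\int[mu]_x (phi x * psi (a + h) x) - \int[mu]_x (phi x * psi a x)| <=
    M * (h + 2 * d) * c ^+ m.+1.
Proof.
move=> cphi phiC wp mg gM M0 h0.
have c0 : 0 < c := mollifier_mass_gt0 d0.
pose chi := prodf (axial d (slab a h)).
have chi0 x : 0 <= chi x by apply: prodf_axial_ge0 => s; exact: slab_ge0.
have cslab : continuous (slab a h) by apply: diffk_continuous; exact: diffk_slab.
have mchi : measurable_fun [set: 'rV[R]_m.+1] chi.
  by apply: continuous_measurable_rV; exact: continuous_axial.
have chi_test : test_function chi.
  apply: (@compact_support_test_function (`|a| + h + d)) => [i k|x].
    rewrite /axial; case: ifP => _; [exact: diffk_slab|exact: diffk_mollifier].
  rewrite -[X in `|X|](subr0 x) -(scale0r e0); apply: prodf_axial_neq0.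
  - by rewrite !addr_ge0// ltW.
  - by rewrite lerDr addr_ge0.
  - move=> s; rewrite subr0 => sr; rewrite slab_eq0//; apply/negP => /andP[s1 s2].
    move: sr; rewrite ltNge ler_norml => /negP; apply.
    by have := ler_norm a; have := ler_norm (- a); rewrite normrN; lra.
have chiE x : partial ord0 chi x = psi a x - psi (a + h) x.
  rewrite -prodf_axialB /partial.
  have dchi : forall s : R, is_derive s 1 (axial d (slab a h) ord0)
      ((shifted_mollifier a \- shifted_mollifier (a + h)) s).
    by move=> s; rewrite /axial eqxx; exact: is_derive_slab.
  have [_ ->] := is_derive_prodf x dchi.
  by apply: eq_bigr => j _; rewrite /axial; case: ifP => // ->.
have := wp chi chi_test.
have -> : \int[mu]_x (phi x * partial ord0 chi x) =
    \int[mu]_x (phi x * psi a x) - \int[mu]_x (phi x * psi (a + h) x).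
  rewrite -RintegralB//; [|exact: integrable_mul_shifted cphi phiC..].
  by apply: eq_Rintegral => x _; rewrite chiE mulrBr.
move=> /(congr1 (@GRing.opp R)); rewrite opprB opprK => ->.
have [b slabb bc] := integral_slab a h0.
have chib := ge0_integral_axial d0 cslab (fun s => slab_ge0 a s h0) slabb.
have mgchi : measurable_fun [set: 'rV[R]_m.+1] (fun x => (g x * chi x)%:E).
  by apply/measurable_EFinP; exact: measurable_funM.
have le_chi : (\int[mu]_x `|(g x * chi x)%:E| <= (M * (h + 2 * d) * c ^+ m.+1)%:E)%E.
  apply: (@le_trans _ _ (\int[mu]_x (M%:E * (chi x)%:E))%E).
    apply: ae_ge0_le_integral => //.
    - exact: measurableT_comp mgchi.
    - by move=> x _; rewrite mule_ge0 ?lee_fin.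
    - by apply: emeasurable_funM; [exact: measurable_cst|exact/measurable_EFinP].
    - apply: filterS gM => x gx _.
      by rewrite /= lee_fin normrM (ger0_norm (chi0 x)) ler_wpM2r.
  rewrite ge0_integralZl//; last 2 first.
  - exact/measurable_EFinP.
  - by move=> x _; rewrite lee_fin.
  rewrite chib -EFinM lee_fin -mulrA ler_wpM2l//.
  by rewrite exprS mulrA ler_wpM2r ?exprn_ge0 ?(ltW c0)// mulrC (le_trans bc)// mulrC.
have := le_trans (le_abse_integral mu measurableT mgchi) le_chi.
by rewrite /Rintegral; case: (integral _ _ _) => [y||].
Qed.

End slab.

Lemma weak_partial_lipschitz (phi g : 'rV[R]_m.+1 -> R) C :
  continuous phi -> (forall x, `|phi x| <= C) -> weak_partial ord0 phi g ->
  g \in Lfun mu +oo%E ->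
  exists2 M, 0 <= M & forall a h, 0 <= h -> `|phi ((a + h) *: e0) - phi (a *: e0)| <= M * h.
Proof.
move=> cphi phiC wp /Lfun_oo_bounded[mg [M M0 gM]]; exists M => // a h h0.
apply/ler_addgt0Pr => e e_gt0.
have near_const b : exists2 r, 0 < r &
    forall x, `|x - b *: e0| <= r -> `|phi x - phi (b *: e0)| <= e / 4.
  have /cvgrPdist_le/(_ (e / 4)) := cphi (b *: e0).
  rewrite divr_gt0// => /(_ isT)/nbhs_ballP[r /= r0 br]; exists (r / 2); first exact: divr_gt0.
  move=> x xb; rewrite distrC; apply: br; rewrite -ball_normE /ball_ /= distrC.
  by rewrite (le_lt_trans xb)//; lra.
have [r1 r10 H1] := near_const a; have [r2 r20 H2] := near_const (a + h).
(* Below [r1] and [r2] the two concentration errors add up to at most [e / 2]. The third bound keeps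
   the surplus [M * (2 * d)] of the slab below [e / 2]. *)
pose d := Num.min (Num.min r1 r2) (e / (4 * (M + 1))).
have M1 : 0 < M + 1 by lra.
have d0 : 0 < d by rewrite !lt_min r10 r20 divr_gt0// mulr_gt0.
have dr1 : d <= r1 by rewrite !ge_min lexx.
have dr2 : d <= r2 by rewrite !ge_min lexx orbT.
have dM : M * (2 * d) <= e / 2.
  have : d <= e / (4 * (M + 1)) by rewrite ge_min lexx orbT.
  rewrite ler_pdivlMr ?mulr_gt0// => dM.
  have : 0 < d * 4 by rewrite mulr_gt0.
  by lra.
have c0 : 0 < mollifier_mass d ^+ m.+1 by rewrite exprn_gt0// mollifier_mass_gt0.
have K1 := @mollifier_concentrates d d0 phi C (e / 4) a cphi phiC
  (fun x xa => H1 x (le_trans xa dr1)).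
have K2 := @mollifier_concentrates d d0 phi C (e / 4) (a + h) cphi phiC
  (fun x xa => H2 x (le_trans xa dr2)).
have K3 := @weak_partial_slab d d0 phi g C M a h cphi phiC wp mg gM M0 h0.
rewrite -(ler_pM2r c0) -[X in _ * X <= _]ger0_norm ?(ltW c0)// -normrM.
move: K1 K2 K3; set I1 := Rintegral _ _ _; set I2 := Rintegral _ _ _.
set k := _ ^+ _ => K1 K2 K3.
have -> : (phi ((a + h) *: e0) - phi (a *: e0)) * k =
    (I2 - I1) + ((I1 - phi (a *: e0) * k) - (I2 - phi ((a + h) *: e0) * k)) by ring.
rewrite (le_trans (ler_normD _ _))// (le_trans (lerD K3 (ler_normB _ _)))//.
rewrite (le_trans (lerD (lexx _) (lerD K1 K2)))//.
rewrite -!mulrDl ler_wpM2r ?(ltW c0)//; lra.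
Qed.

End weak_partial_lipschitz.

(** * The radial potential *)

Section euclidean_norm.
Context {R : realType} {n : nat}.
Implicit Types x y : 'rV[R]_n.

Lemma enorm_ge0 x : 0 <= enorm x. Proof. exact: sqrtr_ge0. Qed.

Lemma sqr_enorm x : enorm x ^+ 2 = \sum_i x ord0 i ^+ 2.
Proof. by rewrite sqr_sqrtr// sumr_ge0// => i _; exact: sqr_ge0. Qed.

Lemma entry_le_enorm x i : `|x ord0 i| <= enorm x.
Proof.
rewrite -sqrtr_sqr ler_wsqrtr// (bigD1 i)//= lerDl sumr_ge0// => j _.
exact: sqr_ge0.
Qed.

(** The difference of squares factors coordinate by coordinate, and x_i + y_i is at most the sum of
    the two norms, by which one divides. *)
Lemma enorm_lipschitz x y : `|enorm x - enorm y| <= n%:R * `|x - y|.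
Proof.
have [E0|E0] := leP (enorm x + enorm y) 0.
  have x0 : enorm x = 0 by have := enorm_ge0 x; have := enorm_ge0 y; lra.
  have y0 : enorm y = 0 by have := enorm_ge0 x; have := enorm_ge0 y; lra.
  by rewrite x0 y0 subrr normr0 mulr_ge0.
rewrite -(ler_pM2r E0) -[X in _ * X <= _](gtr0_norm E0) -normrM.
have -> : (enorm x - enorm y) * (enorm x + enorm y) =
    \sum_i (x ord0 i - y ord0 i) * (x ord0 i + y ord0 i).
  transitivity (enorm x ^+ 2 - enorm y ^+ 2); first by ring.
  by rewrite !sqr_enorm -sumrB; apply: eq_bigr => i _; ring.
rewrite (le_trans (ler_norm_sum _ _ _))//.
have -> : n%:R * `|x - y| * (enorm x + enorm y) = \sum_(i < n) `|x - y| * (enorm x + enorm y).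
  by rewrite sumr_const card_ord -mulrA mulr_natl.
apply: ler_sum => i _; rewrite normrM ler_pM//.
  by have := mx_norm_entry (x - y) ord0 i; rewrite !mxE.
by rewrite (le_trans (ler_normD _ _))// lerD// entry_le_enorm.
Qed.

End euclidean_norm.

Lemma enorm_axis {R : realType} m (a : R) :
  enorm (a *: delta_mx ord0 ord0 : 'rV[R]_m.+1) = `|a|.
Proof.
rewrite /enorm (bigD1 ord0)//= big1 => [|i i0].
  by rewrite addr0 !mxE !eqxx mulr1 sqrtr_sqr.
by rewrite !mxE (negbTE i0) andbF mulr0 expr0n.
Qed.

Section radial_potential.
Context {R : realType}.
Variable q0 : R -> R.
Hypothesis q0_loc : forall r : R, (@lebesgue_measure R).-integrable `[0, r] (EFin \o q0).
Hypothesis q0_int : cvg (\int[@lebesgue_measure R]_(s in `[0, r]) q0 s @[r --> +oo]).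

Let Phi (r : R) : R := \int[@lebesgue_measure R]_(s in `[0, r]) q0 s.

Let cPhi (b : R) : 0 <= b -> {within `[0, b], continuous Phi}.
Proof. by move=> b0; exact: parameterized_integral_continuous. Qed.

(** The profile [Phi] stays within 1 of its limit beyond some [b], and is continuous on the segment
    from 0 to [b]. *)
Lemma radial_potential_bounded n :
  exists C, forall x : 'rV[R]_n, `|radial_potential q0 x| <= C.
Proof.
suff [C PC] : exists C, forall r, 0 <= r -> `|Phi r| <= C.
  by exists C => x; apply: PC; exact: enorm_ge0.
have /cvg_ex[l /cvgrPdist_le/(_ 1 ltr01)[A [_ HA]]] := q0_int.
pose b := Num.max A 0 + 1.
have b0 : 0 <= b by rewrite addr_ge0// le_max lexx orbT.
have [c1 _ H1] := EVT_max b0 (cPhi b0); have [c2 _ H2] := EVT_min b0 (cPhi b0).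
exists (`|Phi c1| + `|Phi c2| + (`|l| + 1)) => r r0.
have [rb|br] := leP r b.
  have rI : r \in `[0, b]%R by rewrite in_itv /= r0.
  have := H1 _ rI; have := H2 _ rI; have := ler_norm (Phi c1); have := ler_norm (- Phi c2).
  rewrite normrN ler_norml; have := normr_ge0 l.
  have := normr_ge0 (Phi c1); have := normr_ge0 (Phi c2).
  by move=> *; apply/andP; split; lra.
have /HA H : A < r.
  by rewrite (le_lt_trans _ br)// (le_trans (_ : A <= Num.max A 0)) ?le_max ?lexx// lerDl.
have -> : Phi r = l - (l - Phi r) by ring.
rewrite (le_trans (ler_normB _ _))// -[leLHS]add0r lerD ?addr_ge0//.
exact: lerD.
Qed.

Lemma radial_potential_continuous n : continuous (@radial_potential R n q0).
Proof.
suff H (x : 'rV[R]_n) : radial_potential q0 y @[y --> x] --> radial_potential q0 x by exact: H.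
apply/(@cvgrPdist_le R R 'rV[R]_n (nbhs x) _ (radial_potential q0) (radial_potential q0 x)) => e e0.
pose b := enorm x + 1.
have x0 := enorm_ge0 x; have b0 : 0 <= b by rewrite addr_ge0.
have /subspace_continuousP/(_ (enorm x)) := cPhi b0.
rewrite /= in_itv /= x0 lerDl ler01 => /(_ isT)/cvgrPdist_le/(_ e e0).
move=> /nbhs_ballP[r /= r0 Hr].
have nx0 (a : R) : 0 < a -> \forall y \near x, n%:R * `|x - y| < a.
  move=> a0; have an : 0 < a / (n%:R + 1) by rewrite divr_gt0// ltr_wpDl.
  near=> y; have : `|x - y| < a / (n%:R + 1).
    by near: y; apply: cvgr_dist_lt => //; exact: cvg_id.
  rewrite ltr_pdivlMr ?ltr_wpDl// mulrC mulrDl mul1r; apply: le_lt_trans.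
  by rewrite lerDl.
near=> y; apply: Hr.
  rewrite -ball_normE /ball_ /= (le_lt_trans (enorm_lipschitz _ _))//.
  by near: y; exact: nx0.
rewrite /= in_itv /= enorm_ge0 /b -lerBlDl.
have := ler_norm (enorm y - enorm x); move/le_trans; apply.
rewrite distrC (le_trans (enorm_lipschitz _ _))// ltW//.
by near: y; exact: nx0.
Unshelve. all: by end_near. Qed.

(** On the nonnegative half of the first axis the potential is its own radial profile, so one weak
    partial derivative bounds the increments of the profile. Composing with the Euclidean norm gives
    the rest. *)
Lemma radial_potential_lipschitz n : sobolev_W1oo (@radial_potential R n.+1 q0) ->
  exists2 L, 0 <= L & forall x y : 'rV[R]_n.+1,
    `|radial_potential q0 x - radial_potential q0 y| <= L * `|x - y|.
Proof.
move=> [_ /(_ ord0)[g gL wg]].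
have [C PC] := radial_potential_bounded n.+1.
have [M M0 HM] := weak_partial_lipschitz (@radial_potential_continuous n.+1) PC wg gL.
exists (M * n.+1%:R) => [|x y]; first by rewrite mulr_ge0.
rewrite -mulrA; apply: le_trans (ler_wpM2l M0 (enorm_lipschitz x y)).
rewrite /radial_potential -/(Phi _) -/(Phi (enorm y)).
wlog xy : x y / enorm x <= enorm y => [H|].
  have [/H//|/ltW/H] := leP (enorm x) (enorm y).
  by rewrite distrC [`|enorm y - _|]distrC.
have := HM (enorm x) (enorm y - enorm x); rewrite subr_ge0 => /(_ xy).
have -> : enorm x + (enorm y - enorm x) = enorm y by ring.
rewrite /radial_potential !enorm_axis !(ger0_norm (enorm_ge0 _)).
by rewrite distrC [`|enorm x - _|]distrC (ger0_norm (_ : 0 <= enorm y - enorm x)) ?subr_ge0.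
Qed.

End radial_potential.

Theorem theorem4p2 (R : realType) (n : nat) (n_gt0 : (0 < n)%N)
    (eps : R) (eps_gt0 : 0 < eps)
    (q0 : R -> R)
    (q0_loc : forall r : R,
      (@lebesgue_measure R).-integrable `[0, r] (EFin \o q0))
    (phi0_W1oo : sobolev_W1oo (@radial_potential R n q0))
    (q0_int : cvg (\int[@lebesgue_measure R]_(s in `[0, r]) q0 s @[r --> +oo]))
    (rho0 : 'rV[R]_n -> R)
    (rho0_Loo : rho0 \in Lfun (lebesgue_rV R n) +oo%E)
    (rho0_int : (lebesgue_rV R n).-integrable setT (EFin \o rho0))
    (X : 'rV[R]_n -> R -> R -> 'rV[R]_n)
    (X_char : characteristics (hopf_cole eps (radial_potential q0)) X) :
  let u := hopf_cole eps (@radial_potential R n q0) in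
  let rho := transported_density rho0 X in
  (forall K : set 'rV[R]_n, compact K ->
     {uniform K, (fun t x => u x t) @ +oo --> (fun=> 0 : 'rV[R]_n)}) /\
  (forall t : R, 0 < t ->
     (lebesgue_rV R n).-integrable setT (fun x => (rho x t)%:E) /\
     (\int[lebesgue_rV R n]_x (rho x t)%:E = \int[lebesgue_rV R n]_x (rho0 x)%:E)%E).
Proof.
case: n n_gt0 phi0_W1oo rho0 rho0_Loo rho0_int X X_char => // n _ W rho0 _ Irho X XP u rho.
have [C phiC] := radial_potential_bounded q0_loc q0_int n.+1.
have [L L0 phiL] := radial_potential_lipschitz q0_loc q0_int W.
split=> [K _|t t0]; first exact: (hopf_cole_cvg0 eps_gt0 L0 phiC phiL).
have [Psi cons] := hopf_cole_flow_conserves eps_gt0 L0 phiC phiL XP t0.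
have [[sf _ _] [Iq q]] := (cons, conserves_integral cons Irho).
(* The Jacobian matrix in [rho] is the diagonal of the slope field that the flow provides. *)
have -> : (fun x => (rho x t)%:E) = (fun x => (rho0 (X x t 0) * \det (Psi x x))%:E).
  by apply/funext => x; rewrite /rho /transported_density (slope_field_jacobian x sf).
by rewrite -q.
Qed.
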